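(* Let $B=\mathbb{C}(t_1,d_1,\dots,t_4,d_4)$ and let $F=\mathbb{C}(u_5,v_5,u_6,v_6,u_7,v_7)^{S_3}$ be the field of rational functions on $(\mathbb{C}^2)^3$ invariant under the action of $S_3$ permuting the three pairs $(u_j,v_j)$. (i) For every $\sigma\in F$ there exists a nonzero (monic) polynomial $h_\sigma\in B[x]$ of degree at most four such that every $f\in E^{(4)}$ satisfies $$h_\sigma|_{(t_1,d_1,\dots,t_4,d_4)}\big(\sigma(u_5,v_5,u_6,v_6,u_7,v_7)\big)=0,$$ where $(t_i,d_i)$ and $(u_j,v_j)$ are the spectral data of $f$ (whenever the coefficients of $h_\sigma$ and $\sigma$ are defined at these values). (ii) For each of the functions $e_{1,0}=u_5+u_6+u_7$, $e_{3,0}=u_5u_6u_7$, $e_{0,1}=v_5+v_6+v_7$, $e_{1,1}=u_5v_6+u_5v_7+u_6v_7+u_6v_5+u_7v_5+u_7v_6$, the corresponding relation $h_\sigma(\sigma)=0$ is algebraically independent of (i.e. not a consequence of) the known relations $$\sum_{i=1}^7\frac{1}{u_iv_i}=1,\quad \sum_{i=1}^7\frac{u_i+v_i}{u_iv_i}=4,\quad \sum_{i=1}^7\frac{(u_i+v_i)^2}{u_iv_i}=16,\quad \sum_{i=5}^7\frac1{u_i}=1,\quad \sum_{i=5}^7\frac{v_i}{u_i}=1,$$ where for $i=1,\dots,4$, $u_i,v_i$ denote the eigenvalues of $\mathbf{I}-Df|_{p_i}$ (so $u_i+v_i=t_i$, $u_iv_i=d_i$).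
   Context: Fix a line $\ell\subset\mathbb{P}^2$. $E^{(4)}$ is the variety of holomorphic quadratic self-maps $f$ of $\mathbb{P}^2$ (given by three homogeneous quadratic polynomials without common nontrivial zeros) with $f(\ell)\subset\ell$, all of whose fixed points are isolated and non-degenerate ($\det(\mathbf{I}-Df|_p)\ne0$), with the four fixed points off $\ell$ marked and ordered $p_1,\dots,p_4$. The three fixed points on $\ell$ are denoted $p_5,p_6,p_7$ (in any order). For $i=1,\dots,4$, $t_i,d_i$ are the trace and determinant of $\mathbf{I}-Df|_{p_i}$. For $j=5,6,7$, $u_j,v_j$ are the two eigenvalues of $\mathbf{I}-Df|_{p_j}$, with $u_j$ the one associated to the eigendirection tangent to $\ell$ (i.e. $u_j=1-(f|_\ell)'(p_j)$). *)

(* Defs.v *)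
From HB Require Import structures.
From mathcomp Require Import all_boot all_order all_algebra all_fingroup.
From mathcomp Require Import fraction.
From mathcomp Require Import mpoly.
From mathcomp Require Import complex.
From mathcomp Require Import reals.

Set Implicit Arguments.
Unset Strict Implicit.
Unset Printing Implicit Defensive.

Import Order.TTheory GRing.Theory Num.Theory.
Local Open Scope ring_scope.

Section QuadMaps.
Variable C : fieldType.

(** Points of C^3 (homogeneous coordinates on P^2). *)
Definition pt3 := 'I_3 -> C.

(** A quadratic self-map of P^2 is given by three homogeneous quadratic
    polynomials F 0, F 1, F 2 in the variables X_0, X_1, X_2. *)
Definition Fev (F : 'I_3 -> {mpoly C[3]}) (x : pt3) : pt3 := fun k => (F k).@[x].

(** Linear form with coefficient vector a; the line l is {lin a x = 0}. *)
Definition lin (a x : pt3) : C := \sum_(k < 3) a k * x k.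

Definition nonzero3 (x : pt3) := exists k, x k != 0.

Definition fixedpt (F : 'I_3 -> {mpoly C[3]}) (x : pt3) :=
  nonzero3 x /\ exists lam : C, forall k, Fev F x k = lam * x k.

Definition proj_eq (x y : pt3) := exists c : C, c != 0 /\ forall k, x k = c * y k.

Definition chart (x : pt3) : 'I_3 :=
  if x ord0 != 0 then ord0 else if x (inord 1) != 0 then inord 1 else inord 2.

(** I - Df|_[x], computed in the affine chart {X_k = 1}, k = chart x,
    with affine coordinates (X_{lift k 0}, X_{lift k 1}); the map in this chart
    is (F_{lift k 0}/F_k, F_{lift k 1}/F_k). *)
Definition IDf (F : 'I_3 -> {mpoly C[3]}) (x : pt3) : 'M[C]_2 :=
  let k := chart x in
  let q : pt3 := fun m => x m / x k in
  1%:M - \matrix_(r < 2, s < 2)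
     ((mderiv (lift k s) (F (lift k r)) * F k
        - F (lift k r) * mderiv (lift k s) (F k)).@[q] / ((F k).@[q]) ^+ 2).

Definition trIDf F x := \tr (IDf F x).
Definition detIDf F x := \det (IDf F x).

(** Nonzero tangent vector to the line {lin a = 0} in the chart of x
    (valid when x lies on the line). *)
Definition tangent_vec (a x : pt3) : 'cV[C]_2 :=
  let k := chart x in
  \col_(r < 2) (if r == ord0 then a (lift k (inord 1)) else - a (lift k ord0)).

Definition tangent_eig F (a x : pt3) (u : C) :=
  IDf F x *m tangent_vec a x = u *: tangent_vec a x.

(** Membership in E^(4): F defines a quadratic holomorphic self-map of P^2,
    a defines the line l, f(l) in l, the fixed points are exactly the seven
    distinct points [p 0],...,[p 6], the four points p 0..p 3 (= p_1..p_4)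
    are off l, the three points p 4..p 6 (= p_5,p_6,p_7) lie on l, and all
    fixed points are non-degenerate. *)
Definition isE4 (F : 'I_3 -> {mpoly C[3]}) (a : pt3) (p : 'I_7 -> pt3) :=
  [/\ nonzero3 a,
      (forall k, F k \is 2.-homog) &
      (forall x, (forall k, Fev F x k = 0) -> forall k, x k = 0)] /\
  (forall x, lin a x = 0 -> lin a (Fev F x) = 0) /\
  [/\ (forall i, fixedpt F (p i)),
      (forall x, fixedpt F x -> exists i, proj_eq x (p i)),
      (forall i j, proj_eq (p i) (p j) -> i = j),
      (forall i : 'I_7, (i < 4)%N = (lin a (p i) != 0)) &
      (forall i, detIDf F (p i) != 0)].

Definition frac_val (n : nat) (r : {fraction {mpoly C[n]}}) (x : 'I_n -> C) (v : C) :=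
  exists nu de : {mpoly C[n]},
    [/\ de.@[x] != 0, r = tofrac nu / tofrac de & v = nu.@[x] / de.@[x]].

(** Coordinates (t1,d1,...,t4,d4) of C^8 and (u5,v5,u6,v6,u7,v7) of C^6. *)
Definition pt8 (t d : 'I_4 -> C) : 'I_8 -> C :=
  fun k => if odd k then d (inord k./2) else t (inord k./2).
Definition pt6 (u v : 'I_3 -> C) : 'I_6 -> C :=
  fun k => if odd k then v (inord k./2) else u (inord k./2).

Definition pair_act (s : 'S_3) (q : {mpoly C[6]}) : {mpoly C[6]} :=
  q \mPo [tuple ('X_(inord (2 * s (inord i./2) + odd i)) : {mpoly C[6]}) | i < 6].

Definition S3inv (r : {fraction {mpoly C[6]}}) :=
  forall nu de : {mpoly C[6]}, de != 0 -> r = tofrac nu / tofrac de ->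
    forall s : 'S_3, pair_act s nu * de = nu * pair_act s de.

Definition spec_t F (p : 'I_7 -> pt3) (i : 'I_4) := trIDf F (p (lshift 3 i)).
Definition spec_d F (p : 'I_7 -> pt3) (i : 'I_4) := detIDf F (p (lshift 3 i)).

Definition annihilates (h : {poly {fraction {mpoly C[8]}}})
    (sigma : {fraction {mpoly C[6]}}) :=
  forall (F : 'I_3 -> {mpoly C[3]}) (a : pt3) (p : 'I_7 -> pt3) (u v : 'I_3 -> C),
    isE4 F a p ->
    (forall j : 'I_3, [/\ tangent_eig F a (p (rshift 4 j)) (u j),
                          u j + v j = trIDf F (p (rshift 4 j)) &
                          u j * v j = detIDf F (p (rshift 4 j))]) ->
    forall (c : nat -> C) (s : C),
      (forall k, (k < size h)%N -> frac_val h`_k (pt8 (spec_t F p) (spec_d F p)) (c k)) ->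
      frac_val sigma (pt6 u v) s ->
      \sum_(k < size h) c k * s ^+ k = 0.

Definition not_consequence (h : {poly {fraction {mpoly C[8]}}})
    (sigma : {fraction {mpoly C[6]}}) :=
  exists U V : 'I_7 -> C,
    (forall i, U i * V i != 0) /\
    [/\ \sum_(i < 7) (U i * V i)^-1 = 1,
        \sum_(i < 7) (U i + V i) / (U i * V i) = 4,
        \sum_(i < 7) (U i + V i) ^+ 2 / (U i * V i) = 16,
        \sum_(j < 3) (U (rshift 4 j))^-1 = 1 &
        \sum_(j < 3) V (rshift 4 j) / U (rshift 4 j) = 1] /\
    exists (c : nat -> C) (s : C),
      [/\ forall k, (k < size h)%N ->
            frac_val h`_k (pt8 (fun i => U (lshift 3 i) + V (lshift 3 i))
                               (fun i => U (lshift 3 i) * V (lshift 3 i))) (c k),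
          frac_val sigma (pt6 (fun j => U (rshift 4 j)) (fun j => V (rshift 4 j))) s &
          \sum_(k < size h) c k * s ^+ k != 0].

(** Variables u_{5+j}, v_{5+j} (j = 0,1,2) of C[u5,v5,u6,v6,u7,v7]. *)
Definition uX (j : nat) : {mpoly C[6]} := 'X_(inord (2 * j)).
Definition vX (j : nat) : {mpoly C[6]} := 'X_(inord (2 * j + 1)).

Definition e10 : {fraction {mpoly C[6]}} := tofrac (uX 0 + uX 1 + uX 2).
Definition e30 : {fraction {mpoly C[6]}} := tofrac (uX 0 * uX 1 * uX 2).
Definition e01 : {fraction {mpoly C[6]}} := tofrac (vX 0 + vX 1 + vX 2).
Definition e11 : {fraction {mpoly C[6]}} :=
  tofrac (uX 0 * vX 1 + uX 0 * vX 2 + uX 1 * vX 2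
   + uX 1 * vX 0 + uX 2 * vX 0 + uX 2 * vX 1).

End QuadMaps.

(* Main.v *)
Require Import Defs.
From HB Require Import structures.
From mathcomp Require Import all_boot all_order all_algebra all_fingroup.
From mathcomp Require Import fraction mpoly complex reals boolp ring.
Import GRing.Theory Num.Theory.
Local Open Scope ring_scope.

Set Implicit Arguments.
Unset Strict Implicit.
Unset Printing Implicit Defensive.

(* Put p_1, ..., p_4 in the position of the standard projective frame and scale: then
   f(x) = m(x) x - N (x_2 x_3, x_3 x_1, x_1 x_2)^T with m a linear form and N a 3 x 3 matrix
   of rank at most two killed on both sides.  The (t_i, d_i) confine m to the intersection of
   a line and a conic, then determine the line l, and leave two choices for N; so a generic
   map has coordinates in a field of degree at most four over C(t_1, d_1, ..., t_4, d_4).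
   The fixed points on l correspond to the roots of a cubic over that field, hence a
   symmetric function sigma of the (u_j, v_j) lies in it, too, and is a root of a monic quartic.
   The identity for generic f specialises to every f in E^(4), since all rational functions
   involved are evaluated along the same parametrisation.
   For part (ii), the five known relations are solved by rational functions of nine
   parameters, and on the solutions sigma is algebraically independent of the
   (t_i, d_i), by the Jacobian criterion; so no monic h kills sigma on all of them. *)

(** The relation must hold for every f in E^(4), not only for a generic one, so the parametrisation
    has to reach all of E^(4): it divides only by a_1, a_2, a_1 + a_2 + 1 and multipliers of fixed
    points, none of which vanishes on E^(4). The u_j, v_j are not rational in (a, m, N), being
    attached to the roots of a cubic; therefore the homogeneous coordinates (y_j, z_j) of these
    roots replace N as parameters. This gives ten parameters for an eight-dimensional family, and
    the redundancy is harmless. Every other nonvanishing condition, such as t_3 - t_4 != 0, is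
    needed only in the field of rational functions, where it is certified by the value at one
    explicit point. In the tower the norms are taken with formal conjugates, so neither quadratic
    step has to be a proper extension. In part (ii), fourteen eigenvalues subject to five relations
    leave nine parameters; independence of the nine functions t_i, d_i, sigma says that the five
    relations impose no condition on them at all. *)

Lemma ord3P (j : 'I_3) : j = 0 \/ j = 1 \/ j = inord 2.
Proof.
case: j => [[|[|[|]]] //= i]; [left | right; left | right; right]; apply: val_inj => //=.
by rewrite inordK.
Qed.

Lemma sum_ord3 (V : nmodType) (f : 'I_3 -> V) : \sum_j f j = f 0 + f 1 + f (inord 2).
Proof.
rewrite !big_ord_recl big_ord0 addr0 !addrA.
by congr (f _ + f _ + f _); apply: val_inj => //=; rewrite inordK.
Qed.

Lemma fraction_num_den (R : idomainType) (x : {fraction R}) :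
  exists nu de : R, de != 0 /\ x = tofrac nu / tofrac de.
Proof.
elim/quotW: x => r; exists (\n_r), (\d_r).
have d0 := denom_ratioP r; split=> //.
apply: (canRL (mulfK _)); first by rewrite tofrac_eq0.
unlock FracField.tofrac; rewrite -[LHS]FracField.pi_mul.
apply/eqmodP; rewrite /= FracField.equivfE /FracField.mulf.
by rewrite !numden_Ratio ?mulr1 ?oner_neq0 ?mulf_neq0 ?oner_neq0 // mulrC.
Qed.

(** * Evaluation of rational functions *)

Section FracVal.
Variables (C : fieldType) (n : nat).
Local Notation K := {fraction {mpoly C[n]}}.
Implicit Types (x y : K) (th : 'I_n -> C).

Definition fconst (c : C) : K := tofrac c%:MP.
Definition fvar (i : 'I_n) : K := tofrac 'X_i.

Fact fconst_is_zmod : zmod_morphism fconst.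
Proof. by move=> a b; rewrite /fconst mpolyCB tofracB. Qed.
Fact fconst_is_monoid : monoid_morphism fconst.
Proof. by split=> [|a b]; rewrite /fconst ?tofrac1 // mpolyCM tofracM. Qed.
HB.instance Definition _ := GRing.isZmodMorphism.Build C K fconst fconst_is_zmod.
HB.instance Definition _ := GRing.isMonoidMorphism.Build C K fconst fconst_is_monoid.

Lemma meval_neq0 th (p : {mpoly C[n]}) : p.@[th] != 0 -> p != 0.
Proof. by apply: contra_neq => ->; rewrite meval0. Qed.

Lemma fvC th c : frac_val (fconst c) th c.
Proof.
by exists c%:MP, 1; rewrite meval1 mevalC tofrac1 !divr1 oner_neq0.
Qed.

Lemma fvX th i : frac_val (fvar i) th (th i).
Proof.
by exists 'X_i, 1; rewrite meval1 mevalXU tofrac1 !divr1 oner_neq0.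
Qed.

Lemma fvD th x y a b :
  frac_val x th a -> frac_val y th b -> frac_val (x + y) th (a + b).
Proof.
move=> [p [q [q0 -> ->]]] [p' [q' [q'0 -> ->]]].
have nq := meval_neq0 q0; have nq' := meval_neq0 q'0.
exists (p * q' + p' * q), (q * q').
rewrite !(mevalM, mevalD) !(tofracM, tofracD) mulf_neq0 //.
by rewrite !addf_div ?tofrac_eq0.
Qed.

Lemma fvM th x y a b :
  frac_val x th a -> frac_val y th b -> frac_val (x * y) th (a * b).
Proof.
move=> [p [q [q0 -> ->]]] [p' [q' [q'0 -> ->]]].
exists (p * p'), (q * q').
by rewrite !mevalM !tofracM mulf_neq0 // !mulf_div.
Qed.

Lemma fvN th x a : frac_val x th a -> frac_val (- x) th (- a).
Proof.
move=> [p [q [q0 -> ->]]]; exists (- p), q.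
by rewrite mevalN tofracN !mulNr.
Qed.

Lemma fvB th x y a b :
  frac_val x th a -> frac_val y th b -> frac_val (x - y) th (a - b).
Proof. by move=> fx fy; apply: fvD => //; apply: fvN. Qed.

Lemma fvV th x a : a != 0 -> frac_val x th a -> frac_val x^-1 th a^-1.
Proof.
move=> a0 [p [q [q0 ex ea]]]; exists q, p; rewrite ex ea !invf_div; split=> //.
by apply: contra_neq a0; rewrite ea => ->; rewrite mul0r.
Qed.

Lemma fv_div th x y a b : b != 0 ->
  frac_val x th a -> frac_val y th b -> frac_val (x / y) th (a / b).
Proof. by move=> b0 fx fy; apply: fvM => //; apply: fvV. Qed.

Lemma fv0 th : frac_val (0 : K) th 0.
Proof. by rewrite -(rmorph0 fconst); apply: fvC. Qed.

Lemma fv1 th : frac_val (1 : K) th 1.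
Proof. by rewrite -(rmorph1 fconst); apply: fvC. Qed.

Lemma fv_exp th x a k : frac_val x th a -> frac_val (x ^+ k) th (a ^+ k).
Proof.
move=> fx; elim: k => [|k IH]; first exact: fv1.
by rewrite !exprS; apply: fvM.
Qed.

Lemma fvMn th x a k : frac_val x th a -> frac_val (x *+ k) th (a *+ k).
Proof.
move=> fx; elim: k => [|k IH]; first exact: fv0.
by rewrite !mulrS; apply: fvD.
Qed.

Lemma fv_sum th (I : Type) (r : seq I) (P : pred I) (f : I -> K) (g : I -> C) :
  (forall i, frac_val (f i) th (g i)) ->
  frac_val (\sum_(i <- r | P i) f i) th (\sum_(i <- r | P i) g i).
Proof.
move=> fg; elim/big_rec2: _ => [|i a b _ H]; first exact: fv0.
exact: fvD.
Qed.

Lemma fv_prod th (I : Type) (r : seq I) (P : pred I) (f : I -> K) (g : I -> C) :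
  (forall i, frac_val (f i) th (g i)) ->
  frac_val (\prod_(i <- r | P i) f i) th (\prod_(i <- r | P i) g i).
Proof.
move=> fg; elim/big_rec2: _ => [|i a b _ H]; first exact: fv1.
exact: fvM.
Qed.

(** Values are a relation, since a fraction has many representations; well-definedness rests on the
    fact that every numerator of 0 is the zero polynomial. *)
Lemma fv_zero th a : frac_val (0 : K) th a -> a = 0.
Proof.
move=> [p [q [q0 /esym/eqP ex ->]]].
rewrite mulf_eq0 invr_eq0 !tofrac_eq0 (negPf (meval_neq0 q0)) orbF in ex.
by rewrite (eqP ex) meval0 mul0r.
Qed.

Lemma fv_uniq th x a b : frac_val x th a -> frac_val x th b -> a = b.
Proof.
move=> fa fb; apply/eqP; rewrite -subr_eq0; apply/eqP/(@fv_zero th).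
by rewrite -(subrr x); apply: fvB.
Qed.

(** The certificate for generic nonvanishing used throughout: a nonzero value at a single point. *)
Lemma fv_neq0 th x a : frac_val x th a -> a != 0 -> x != 0.
Proof. by move=> fx; apply: contra_neq => x0; apply: (@fv_zero th); rewrite -x0. Qed.

Lemma fv_mmap th m (g : 'I_m -> K) (c : 'I_m -> C) (P : {mpoly C[m]}) :
  (forall i, frac_val (g i) th (c i)) ->
  frac_val (mmap fconst g P) th P.@[c].
Proof.
move=> gc; rewrite mevalE /mmap; apply: fv_sum => e; apply: fvM; first exact: fvC.
by apply: fv_prod => i; apply: fv_exp.
Qed.

End FracVal.

Ltac fvt := repeat first [ assumption |
  lazymatch goal with
  | |- frac_val (_ + _) _ _ => apply: fvD
  | |- frac_val (- _) _ _ => apply: fvN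
  | |- frac_val (_ / _) _ _ => apply: fv_div
  | |- frac_val (_ * _) _ _ => apply: fvM
  | |- frac_val (_ ^-1) _ _ => apply: fvV
  | |- frac_val (_ ^+ _) _ _ => apply: fv_exp
  | |- frac_val 1 _ _ => exact: fv1
  | |- frac_val (_ *+ _) _ _ => apply: fvMn
  | |- frac_val (fvar _) _ _ => exact: fvX
  end ].

(** * Towers of quadratic extensions *)

Section Subfields.
Variable K : fieldType.
Implicit Types S : K -> Prop.

(** Subfields are predicates on one ambient field, so the whole tower and the value of sigma have a
    common type. Inversion carries no condition because [0^-1 = 0]. *)
Record subfield S : Prop := Subfield {
  sf1 : S 1;
  sfB : forall x y, S x -> S y -> S (x - y);
  sfM : forall x y, S x -> S y -> S (x * y);
  sfV : forall x, S x -> S x^-1 }.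

Section Closure.
Variables (S : K -> Prop) (sS : subfield S).

Lemma sf0 : S 0.
Proof. by rewrite -(subrr 1); apply: (sfB sS); apply: (sf1 sS). Qed.

Lemma sfN x : S x -> S (- x).
Proof. by rewrite -sub0r => ?; apply: (sfB sS) => //; apply: sf0. Qed.

Lemma sfD x y : S x -> S y -> S (x + y).
Proof. by move=> ? ?; rewrite -[y]opprK; apply: (sfB sS) => //; apply: sfN. Qed.

Lemma sf_div x y : S x -> S y -> S (x / y).
Proof. by move=> ? ?; apply: (sfM sS) => //; apply: (sfV sS). Qed.

Lemma sf_exp x k : S x -> S (x ^+ k).
Proof.
move=> Sx; elim: k => [|k IH]; first exact: (sf1 sS).
by rewrite exprS; apply: (sfM sS).
Qed.

Lemma sfMn x k : S x -> S (x *+ k).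
Proof.
move=> Sx; elim: k => [|k IH]; first exact: sf0.
by rewrite mulrS; apply: sfD.
Qed.

Lemma sf_nat k : S k%:R.
Proof. exact/sfMn/(sf1 sS). Qed.

End Closure.
End Subfields.

Ltac sf sS := repeat first [assumption | apply: (sfB sS) | apply: (sfD sS) | apply: (sfM sS)
  | apply: (sfN sS) | apply: (sfV sS) | apply: (sf_exp sS) | apply: (sf_nat sS)
  | apply: (sf1 sS)].

(** * Quadratic extensions and traces from a cubic *)

Section Adjoin.
Variable K : fieldType.
Implicit Types S L : K -> Prop.

Definition adjoin S (al z : K) := exists x y, [/\ S x, S y & z = x + y * al].

Lemma adjoin_base S al x : subfield S -> S x -> adjoin S al x.
Proof. by move=> sS Sx; exists x, 0; rewrite mul0r addr0; split=> //; apply: sf0. Qed.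

Lemma adjoin_gen S al : subfield S -> adjoin S al al.
Proof.
by move=> sS; exists 0, 1; rewrite mul1r add0r; split=> //; [apply: sf0|apply: (sf1 sS)].
Qed.

(* If the norm of x + y al vanishes, then al already lies in S. *)
Lemma adjoin_subfield S al p q : subfield S -> S p -> S q ->
  al ^+ 2 = p + q * al -> subfield (adjoin S al).
Proof.
move=> sS Sp Sq E; split.
- exact/adjoin_base/(sf1 sS).
- move=> _ _ [x [y [Sx Sy ->]]] [x' [y' [Sx' Sy' ->]]].
  by exists (x - x'), (y - y'); split; [sf sS | sf sS | ring].
- move=> _ _ [x [y [Sx Sy ->]]] [x' [y' [Sx' Sy' ->]]].
  exists (x * x' + y * y' * p), (x * y' + y * x' + y * y' * q); split; [sf sS | sf sS |].
  by transitivity (x * x' + (x * y' + y * x') * al + y * y' * al ^+ 2);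
    [ring | rewrite E; ring].
- move=> _ [x [y [Sx Sy ->]]].
  have [y0|yn] := eqVneq y 0.
    by rewrite y0 mul0r addr0; apply: adjoin_base => //; sf sS.
  pose N := x ^+ 2 + x * y * q - y ^+ 2 * p.
  have SN : S N by rewrite /N; sf sS.
  have EN : (x + y * al) * (x + y * q - y * al) = N.
    transitivity (x ^+ 2 + x * y * q + y ^+ 2 * q * al - y ^+ 2 * al ^+ 2); first by ring.
    by rewrite E /N; ring.
  have [N0|Nn] := eqVneq N 0.
    have Sal : S al.
      move/eqP: EN; rewrite N0 mulf_eq0 => /orP[]/eqP H.
        have -> : al = - x / y.
          by rewrite (_ : x = - (y * al)) ?opprK; [field | apply/eqP; rewrite -addr_eq0 H].
        by sf sS.
      have -> : al = (x + y * q) / y.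
        by rewrite (_ : x + y * q = y * al); [field | apply/eqP; rewrite -subr_eq0 H].
      by sf sS.
    by apply: adjoin_base => //; sf sS.
  exists ((x + y * q) / N), (- y / N); split; [sf sS | sf sS |].
  have xn : x + y * al != 0 by apply: contra_neq Nn => H; rewrite -EN H mul0r.
  rewrite -{1}EN in Nn; rewrite -EN; move: Nn; rewrite mulf_eq0 negb_or => /andP[_ n2].
  by field; rewrite xn n2.
Qed.

(** Over S(al) the element s is a root of the monic quadratic given by its trace and norm.
    Multiplying this quadratic by its conjugate under al -> q - al yields a quartic over S. *)
Lemma tower_quartic S al be p q s :
  subfield S -> S p -> S q -> al ^+ 2 = p + q * al ->
  (exists p' q', [/\ adjoin S al p', adjoin S al q' & be ^+ 2 = p' + q' * be]) ->
  adjoin (adjoin S al) be s ->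
  exists c : nat -> K, (forall k, S (c k)) /\ \sum_(k < 4) c k * s ^+ k + s ^+ 4 = 0.
Proof.
move=> sS Sp Sq E [p' [q' [Sp' Sq' E']]] [x [y [Sx Sy es]]].
have sA := adjoin_subfield sS Sp Sq E.
have [e1 [f1 [Se1 Sf1 E1]]] : adjoin S al (- (2 * x + y * q')) by sf sA.
have [e0 [f0 [Se0 Sf0 E0]]] : adjoin S al (x ^+ 2 + x * y * q' - y ^+ 2 * p') by sf sA.
have R : s ^+ 2 + (e1 + f1 * al) * s + (e0 + f0 * al) = 0.
  rewrite -E1 -E0 es; transitivity (y ^+ 2 * be ^+ 2 - y ^+ 2 * q' * be - y ^+ 2 * p').
    by ring.
  by rewrite E'; ring.
(* The quadratic relation reads A + al G = 0 with A and G over S; its norm is A^2 + q A G - p G^2,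
   because al (q - al) = - p. *)
pose A := s ^+ 2 + e1 * s + e0; pose G := f1 * s + f0.
have NR : A ^+ 2 + q * A * G - p * G ^+ 2 = 0.
  transitivity ((A + al * G) * (A + (q - al) * G)).
    transitivity (A ^+ 2 + q * A * G + q * al * G ^+ 2 - al ^+ 2 * G ^+ 2);
      [by rewrite E; ring | by ring].
  by rewrite (_ : A + al * G = 0) ?mul0r // -R /A /G; ring.
exists (fun k => match k with
  | 0 => e0 ^+ 2 + q * e0 * f0 - p * f0 ^+ 2
  | 1 => 2 * e0 * e1 + q * (e1 * f0 + e0 * f1) - 2 * p * f0 * f1
  | 2 => e1 ^+ 2 + 2 * e0 + q * (e1 * f1 + f0) - p * f1 ^+ 2
  | _ => 2 * e1 + q * f1 end); split.
  by case=> [|[|[|k]]]; sf sS.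
by rewrite -[RHS]NR !big_ord_recl big_ord0 /= /A /G /bump /=; ring.
Qed.

(* Rational functions with coefficients in L, evaluated at the three roots of a
   cubic over L and reduced modulo that cubic. *)
Definition cubic_fun L (eta f : 'I_3 -> K) :=
  exists x y z, [/\ L x, L y, L z & forall j, f j = x + y * eta j + z * eta j ^+ 2].

(** * Functions on the roots of a cubic *)

Section CubicFun.
Variables (L : K -> Prop) (sL : subfield L) (eta : 'I_3 -> K) (s1 s2 s3 : K).
Hypotheses (L1 : L s1) (L2 : L s2) (L3 : L s3) (n6 : (6%:R : K) != 0).
Hypothesis cub : forall j, eta j ^+ 3 = s1 * eta j ^+ 2 - s2 * eta j + s3.
Hypothesis tr1 : \sum_j eta j = s1.
Hypothesis tr2 : \sum_j eta j ^+ 2 = s1 ^+ 2 - 2 * s2.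
Notation CF := (cubic_fun L eta).

Lemma cf_const x : L x -> CF (fun=> x).
Proof.
move=> Lx; exists x, 0, 0; split=> //; try exact: sf0.
by move=> j; rewrite !mul0r !addr0.
Qed.

Lemma cf_gen : CF eta.
Proof.
exists 0, 1, 0; split; try exact: sf0; first exact: (sf1 sL).
by move=> j; rewrite !mul0r mul1r addr0 add0r.
Qed.

Lemma cfD f g : CF f -> CF g -> CF (fun j => f j + g j).
Proof.
move=> [x [y [z [Lx Ly Lz Ef]]]] [x' [y' [z' [Lx' Ly' Lz' Eg]]]].
exists (x + x'), (y + y'), (z + z'); split; [sf sL | sf sL | sf sL |].
by move=> j; rewrite Ef Eg; ring.
Qed.

Lemma cfM f g : CF f -> CF g -> CF (fun j => f j * g j).
Proof.
move=> [x [y [z [Lx Ly Lz Ef]]]] [x' [y' [z' [Lx' Ly' Lz' Eg]]]].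
pose a := y * z' + z * y'; pose b := z * z'.
exists (x * x' + a * s3 + b * s1 * s3), (x * y' + y * x' - a * s2 + b * (s3 - s1 * s2)),
  (x * z' + y * y' + z * x' + a * s1 + b * (s1 ^+ 2 - s2)).
split; rewrite /a /b; [sf sL | sf sL | sf sL |].
move=> j; rewrite Ef Eg; have E := cub j.
transitivity (x * x' + (x * y' + y * x') * eta j + (x * z' + y * y' + z * x') * eta j ^+ 2
  + (y * z' + z * y') * eta j ^+ 3 + z * z' * (eta j * eta j ^+ 3)); first by ring.
rewrite E.
transitivity (x * x' + (x * y' + y * x') * eta j + (x * z' + y * y' + z * x') * eta j ^+ 2
  + (y * z' + z * y') * (s1 * eta j ^+ 2 - s2 * eta j + s3)
  + z * z' * (s1 * eta j ^+ 3 - s2 * eta j ^+ 2 + s3 * eta j)); first by ring.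
by rewrite E; ring.
Qed.

Lemma cfN f : CF f -> CF (fun j => - f j).
Proof.
move=> [x [y [z [Lx Ly Lz Ef]]]].
exists (- x), (- y), (- z); split; [sf sL | sf sL | sf sL |].
by move=> j; rewrite Ef; ring.
Qed.

Lemma cfB f g : CF f -> CF g -> CF (fun j => f j - g j).
Proof. by move=> Lf Lg; apply: cfD => //; apply: cfN. Qed.

Lemma cf_exp f k : CF f -> CF (fun j => f j ^+ k).
Proof.
move=> Lf; elim: k => [|k IH]; first exact/cf_const/(sf1 sL).
have [x [y [z [? ? ? E]]]] := cfM Lf IH.
by exists x, y, z; split=> // j; rewrite exprS E.
Qed.

Lemma cf_ext f g : f =1 g -> CF f -> CF g.
Proof. by move=> fg [x [y [z [? ? ? E]]]]; exists x, y, z; split=> // j; rewrite -fg. Qed.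

Lemma cf_trace f : CF f -> L (\sum_j f j).
Proof.
move=> [x [y [z [Lx Ly Lz Ef]]]].
rewrite (eq_bigr _ (fun j _ => Ef j)) !big_split /= -!mulr_sumr tr1 tr2.
by rewrite sumr_const; sf sL; apply: (sfMn sL).
Qed.

(* Cayley-Hamilton: the inverse of f is a polynomial in f whose coefficients are
   symmetric functions of the values of f, hence polynomials in traces of powers. *)
Lemma cfV f : (forall j, f j != 0) -> CF f -> CF (fun j => (f j)^-1).
Proof.
move=> fn Lf.
pose p1 := \sum_j f j; pose p2 := \sum_j f j ^+ 2; pose p3 := \sum_j f j ^+ 3.
have Lp1 : L p1 by apply: cf_trace.
have Lp2 : L p2 by apply/cf_trace/cf_exp.
have Lp3 : L p3 by apply/cf_trace/cf_exp.
have n2 : (2%:R : K) != 0 by apply: contra_neq n6; rewrite (_ : 6 = 2 * 3)%N // natrM => ->; rewrite mul0r.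
(* Newton's identities: [t2] and [t3] are the second and third elementary symmetric functions of the
   values of f, whence the divisions by 2 and 6. *)
pose t2 := (p1 ^+ 2 - p2) / 2; pose t3 := (p1 ^+ 3 - 3 * p1 * p2 + 2 * p3) / 6.
have Lt2 : L t2 by rewrite /t2; sf sL.
have Lt3 : L t3 by rewrite /t3; sf sL.
have E1 : p1 = f 0 + f 1 + f (inord 2) by exact: sum_ord3.
have E2 : p2 = f 0 ^+ 2 + f 1 ^+ 2 + f (inord 2) ^+ 2 by exact: sum_ord3.
have E3 : p3 = f 0 ^+ 3 + f 1 ^+ 3 + f (inord 2) ^+ 3 by exact: sum_ord3.
have T2 : t2 = f 0 * f 1 + f 0 * f (inord 2) + f 1 * f (inord 2).
  by rewrite /t2 E1 E2; field.
have T3 : t3 = f 0 * f 1 * f (inord 2) by rewrite /t3 E1 E2 E3; field.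
have t3n : t3 != 0 by rewrite T3 !mulf_neq0.
apply: (@cf_ext (fun j => (f j ^+ 2 - p1 * f j + t2) * t3^-1)); last first.
  apply: cfM; last exact/cf_const/(sfV sL).
  apply: cfD; last exact: cf_const.
  by apply: cfB; [exact: cf_exp | apply: cfM => //; exact: cf_const].
move=> j; have CH : f j * (f j ^+ 2 - p1 * f j + t2) = t3.
  rewrite E1 T2 T3.
  by case: (ord3P j) => [->|[->|->]]; ring.
by rewrite -CH; field; rewrite fn -(mulrI_eq0 _ (mulfI (fn j))) CH.
Qed.

End CubicFun.
End Adjoin.

(** * The normal form and its spectral data *)

(* A map with frame p_1,...,p_4 = e_1, e_2, e_3, e_1 + e_2 + e_3 and line
   a_1 X_1 + a_2 X_2 + X_3 = 0 has the form
     F(x) = m(x) x - N (x_2 x_3, x_3 x_1, x_1 x_2)^T,  N (1,1,1)^T = 0,  (a_1,a_2,1) N = 0,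
   where m = X_1 + m_2 X_2 + m_3 X_3 after scaling; N is determined by its upper left
   2 x 2 block. *)
Record datum (K : Type) := Datum {
  a1 : K; a2 : K; m2 : K; m3 : K; n11 : K; n12 : K; n21 : K; n22 : K }.

Section Formulas.
Variables (K : fieldType) (D : datum K).

Definition n13 := - n11 D - n12 D.
Definition n23 := - n21 D - n22 D.
Definition n31 := - a1 D * n11 D - a2 D * n21 D.
Definition n32 := - a1 D * n12 D - a2 D * n22 D.
Definition n33 := - a1 D * n13 - a2 D * n23.
Definition a4 := a1 D + a2 D + 1.
Definition m4 := 1 + m2 D + m3 D.
(** [T1], ..., [T4] are the traces t_i times the multipliers 1, m_2, m_3, m_4 of the four frame
    points. *)
Definition T1 := n23 + n32.
Definition T2 := n13 + n31.
Definition T3 := n12 D + n21 D.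
Definition T4 := - (n11 D + n22 D + n33).
(** Since N kills (1,1,1)^T and is killed by (a_1,a_2,1), its adjugate is [cN] times (1,1,1)^T
    (a_1,a_2,1); hence every determinant d_i is a multiple of [cN]. *)
Definition cN := n11 D * n22 D - n12 D * n21 D.

Definition tD (i : 'I_4) : K :=
  match val i with 0 => T1 | 1 => T2 / m2 D | 2 => T3 / m3 D | _ => T4 / m4 end.
Definition dD (i : 'I_4) : K :=
  match val i with 0 => - cN * a1 D | 1 => - cN * a2 D / m2 D ^+ 2
  | 2 => - cN / m3 D ^+ 2 | _ => cN * a4 / m4 ^+ 2 end.

(* The quantities below refer to the point (y, z, - a_1 y - a_2 z) of the line. *)
Definition Y0 (y z : K) := - (a1 D * n12 D * y ^+ 2
  + ((a1 D + 1) * n11 D + (a2 D + 1) * n12 D) * y * z + a2 D * n11 D * z ^+ 2).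
Definition Y1 (y z : K) := - (a1 D * n22 D * y ^+ 2
  + ((a1 D + 1) * n21 D + (a2 D + 1) * n22 D) * y * z + a2 D * n21 D * z ^+ 2).
Definition mD (y z : K) := y + m2 D * z - m3 D * (a1 D * y + a2 D * z).
Definition trY (y z : K) := y * T1 + z * T2 - (a1 D * y + a2 D * z) * T3.
(** At a fixed point of the line the N-part of F equals [kap] times the point, so the multiplier is
    [mD - kap]. [uD] is the tangential and [vD] the transverse eigenvalue of I - Df. *)
Definition uD (y z kap : K) := (trY y z - 3 * kap) / (mD y z - kap).
Definition vD (y z kap : K) := kap / (kap - mD y z).

Definition g0 := a1 D * n22 D.
Definition g1 := - a1 D * n12 D + (a1 D + 1) * n21 D + (a2 D + 1) * n22 D.
Definition g2 := - ((a1 D + 1) * n11 D + (a2 D + 1) * n12 D) + a2 D * n21 D.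
Definition g3 := - a2 D * n11 D.

Lemma fixed_cubic y z :
  z * Y0 y z - y * Y1 y z = g0 * y ^+ 3 + g1 * y ^+ 2 * z + g2 * y * z ^+ 2 + g3 * z ^+ 3.
Proof. by rewrite /Y0 /Y1 /g0 /g1 /g2 /g3; ring. Qed.

Lemma uD_scale z eta : z != 0 -> mD (z * eta) z != Y1 (z * eta) z / z ->
  uD (z * eta) z (Y1 (z * eta) z / z) = uD eta 1 (Y1 eta 1)
  /\ vD (z * eta) z (Y1 (z * eta) z / z) = vD eta 1 (Y1 eta 1).
Proof.
move=> z0; rewrite -subr_eq0.
have -> : mD (z * eta) z = z * mD eta 1 by rewrite /mD; ring.
have -> : Y1 (z * eta) z / z = z * Y1 eta 1 by rewrite /Y1; field.
have et : trY (z * eta) z = z * trY eta 1 by rewrite /trY; ring.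
rewrite -mulrBr mulf_eq0 negb_or => /andP[_ h].
rewrite /uD /vD et.
have -> : mD (z * eta) z = z * mD eta 1 by rewrite /mD; ring.
move: (trY eta 1) (mD eta 1) (Y1 eta 1) h => t m k h.
have h' : k - m != 0 by rewrite -opprB oppr_eq0.
have zh : z * m - z * k != 0 by rewrite -mulrBr mulf_neq0.
have zh' : z * k - z * m != 0 by rewrite -mulrBr mulf_neq0.
by split; field; rewrite ?h ?h' ?zh ?zh'.
Qed.

End Formulas.

(** N is recovered from the fixed points on the line: the cubic with coefficients [g0], ..., [g3] is
    required to be the product of the forms z_j Y - y_j Z. This is a linear system for the four free
    entries of N, with determinant a_1 a_2 (a_1 + a_2 + 1) up to sign. *)
Definition cubic_datum (K : fieldType) (a1 a2 m2 m3 : K) (y z : 'I_3 -> K) : datum K :=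
  let i2 : 'I_3 := inord 2 in
  let c0 := z 0 * z 1 * z i2 in
  let c1 := - (y 0 * z 1 * z i2 + z 0 * y 1 * z i2 + z 0 * z 1 * y i2) in
  let c2 := y 0 * y 1 * z i2 + y 0 * z 1 * y i2 + z 0 * y 1 * y i2 in
  let c3 := - (y 0 * y 1 * y i2) in
  let n22 := c0 / a1 in
  let n11 := - c3 / a2 in
  let r1 := c1 - (a2 + 1) * n22 in
  let r2 := c2 + (a1 + 1) * n11 in
  let n12 := (a2 * r1 - (a1 + 1) * r2) / (a1 + a2 + 1) in
  let n21 := (- a1 * r2 + (a2 + 1) * r1) / (a1 + a2 + 1) in
  Datum a1 a2 m2 m3 n11 n12 n21 n22.

Section CubicDatum.
Variables (K : fieldType) (b1 b2 b3 b4 : K) (y z : 'I_3 -> K).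
Notation D := (cubic_datum b1 b2 b3 b4 y z).
Notation i2 := (inord 2 : 'I_3).
Hypotheses (a1n : b1 != 0) (a2n : b2 != 0) (a4n : b1 + b2 + 1 != 0).

Lemma cubic_datumE : [/\ g0 D = z 0 * z 1 * z i2,
  g1 D = - (y 0 * z 1 * z i2 + z 0 * y 1 * z i2 + z 0 * z 1 * y i2),
  g2 D = y 0 * y 1 * z i2 + y 0 * z 1 * y i2 + z 0 * y 1 * y i2 &
  g3 D = - (y 0 * y 1 * y i2)].
Proof. by rewrite /g0 /g1 /g2 /g3 /=; split; field; rewrite ?a1n ?a2n ?a4n. Qed.

Lemma cubic_datum_root j : z j * Y0 D (y j) (z j) = y j * Y1 D (y j) (z j).
Proof.
apply/eqP; rewrite -subr_eq0 fixed_cubic; have [-> -> -> ->] := cubic_datumE.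
by apply/eqP; case: (ord3P j) => [->|[->|->]]; ring.
Qed.

End CubicDatum.

Lemma cubic_datum_uniq (K : fieldType) (D : datum K) (y z : 'I_3 -> K) :
  a1 D != 0 -> a2 D != 0 -> a4 D != 0 ->
  (let D' := cubic_datum (a1 D) (a2 D) (m2 D) (m3 D) y z in
   [/\ g0 D = g0 D', g1 D = g1 D', g2 D = g2 D' & g3 D = g3 D']) ->
  D = cubic_datum (a1 D) (a2 D) (m2 D) (m3 D) y z.
Proof.
case: D => b1 b2 b3 b4 e11 e12 e21 e22; rewrite /a4 /= => h1 h2 h4.
have [-> -> -> ->] := cubic_datumE b3 b4 y z h1 h2 h4.
rewrite /g0 /g1 /g2 /g3 /cubic_datum /= => -[<- <- <- <-].
by f_equal; field; rewrite ?h1 ?h2 ?h4.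
Qed.

(** * Recovering the map from the data at the four frame points *)

Section SpectralRelations.
Variables (K : fieldType) (D : datum K).
Hypotheses (m2n : m2 D != 0) (m3n : m3 D != 0) (m4n : m4 D != 0).
Let t1 := tD D 0.
Let t2 := tD D 1.
Let t3 := tD D (inord 2).
Let t4 := tD D (inord 3).
Let d1 := dD D 0.
Let d2 := dD D 1.
Let d3 := dD D (inord 2).
Let d4 := dD D (inord 3).

Lemma tdE : (t1 = T1 D) * (t2 = T2 D / m2 D) * (t3 = T3 D / m3 D) * (t4 = T4 D / m4 D)
  * (d1 = - cN D * a1 D) * (d2 = - cN D * a2 D / m2 D ^+ 2) * (d3 = - cN D / m3 D ^+ 2)
  * (d4 = cN D * a4 D / m4 D ^+ 2).
Proof. by rewrite /t1 /t2 /t3 /t4 /d1 /d2 /d3 /d4 /tD /dD /= !inordK. Qed.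

(** The entries of N sum to zero, which says T_1 + T_2 + T_3 = T_4. *)
Lemma trace_relation : (t1 - t4) + (t2 - t4) * m2 D + (t3 - t4) * m3 D = 0.
Proof.
have m4' := m4n; move: m4'; rewrite !tdE /T1 /T2 /T3 /T4 /m4 => m4'.
rewrite /n33 /n32 /n31 /n23 /n13.
by field; rewrite m2n m3n m4'.
Qed.

(** The products of the d_i with the squared multipliers are [cN] times - a_1, - a_2, - 1 and a_1 +
    a_2 + 1. *)
Lemma det_relation : d1 + d2 * m2 D ^+ 2 + d3 * m3 D ^+ 2 + d4 * m4 D ^+ 2 = 0.
Proof.
have m4' := m4n; move: m4'; rewrite !tdE /a4 /m4 => m4'.
by field; rewrite m2n m3n m4'.
Qed.

Variable S : K -> Prop.
Hypotheses (sS : subfield S) (St : forall i, S (tD D i)) (Sd : forall i, S (dD D i)).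
Hypotheses (cn : cN D != 0) (t34 : t3 - t4 != 0).
Hypotheses (a1n : a1 D + 1 != 0) (a2n : a2 D + 1 != 0) (a12n : a1 D + a2 D != 0).
Hypothesis n2 : (2%:R : K) != 0.
(** The trace relation is the line m_3 = r0 + r1 m_2, and [lead] is the coefficient of m_2^2 in the
    determinant relation restricted to it. *)
Let r0 := - (t1 - t4) / (t3 - t4).
Let r1 := - (t2 - t4) / (t3 - t4).
Let lead := d2 + d3 * r1 ^+ 2 + d4 * (1 + r1) ^+ 2.
Hypothesis leadn : lead != 0.

(* Given the t_i and d_i, the point (1 : m_2 : m_3) lies on a line and on a conic, which
   leaves two choices; m and the d_i determine a, and then N is known up to
   the value of n12, a root of a quadratic polynomial. *)
Lemma datum_in_tower : exists al be p q, [/\ S p, S q, al ^+ 2 = p + q * al,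
  (exists p' q', [/\ adjoin S al p', adjoin S al q' & be ^+ 2 = p' + q' * be]) &
  subfield (adjoin (adjoin S al) be) ->
  let L := adjoin (adjoin S al) be in
  [/\ L (a1 D), L (a2 D), L (m2 D) & L (m3 D)] /\
  [/\ L (n11 D), L (n12 D), L (n21 D) & L (n22 D)]].
Proof.
have St1 : S t1 by apply: St.
have St2 : S t2 by apply: St.
have St3 : S t3 by apply: St.
have St4 : S t4 by apply: St.
have Sd1 : S d1 by apply: Sd.
have Sd2 : S d2 by apply: Sd.
have Sd3 : S d3 by apply: Sd.
have Sd4 : S d4 by apply: Sd.
have Sr0 : S r0 by rewrite /r0; sf sS.
have Sr1 : S r1 by rewrite /r1; sf sS.
have Sl : S lead by rewrite /lead; sf sS.
have Em3 : m3 D = r0 + r1 * m2 D.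
  apply/eqP; rewrite -subr_eq0; apply/eqP.
  transitivity (((t1 - t4) + (t2 - t4) * m2 D + (t3 - t4) * m3 D) / (t3 - t4)).
    by rewrite /r0 /r1; field.
  by rewrite trace_relation mul0r.
pose p := - (d1 + d3 * r0 ^+ 2 + d4 * (1 + r0) ^+ 2) / lead.
pose q := - (2 * d3 * r0 * r1 + 2 * d4 * (1 + r0) * (1 + r1)) / lead.
have Sp : S p by rewrite /p; sf sS.
have Sq : S q by rewrite /q; sf sS.
have Eal : m2 D ^+ 2 = p + q * m2 D.
  apply/eqP; rewrite -subr_eq0; apply/eqP.
  transitivity ((d1 + d2 * m2 D ^+ 2 + d3 * m3 D ^+ 2 + d4 * m4 D ^+ 2) / lead).
    by rewrite /m4 Em3 /p /q /lead; field.
  by rewrite det_relation mul0r.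
have sA := adjoin_subfield sS Sp Sq Eal.
pose A := adjoin S (m2 D).
have SA x : S x -> A x by apply: adjoin_base.
have Am2 : A (m2 D) by apply: adjoin_gen.
have [Ar0 Ar1] : A r0 /\ A r1 by split; apply: SA.
have [At1 At2 At3] : [/\ A t1, A t2 & A t3] by split; apply: SA.
have [Ad1 Ad2 Ad3] : [/\ A d1, A d2 & A d3] by split; apply: SA.
have Am3 : A (m3 D) by rewrite Em3; sf sA.
(* The common factor [cN] cancels in quotients of determinants, which gives a_1 and a_2 before N is
   known. *)
have Ea1 : a1 D = d1 / (d3 * m3 D ^+ 2).
  by rewrite !tdE; move: (cN D) cn => c c0; field; rewrite oppr_eq0 c0 m3n.
have Ea2 : a2 D = d2 * m2 D ^+ 2 / (d3 * m3 D ^+ 2).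
  by rewrite !tdE; move: (cN D) cn => c c0; field; rewrite ?oppr_eq0 c0 m3n m2n.
have Aa1 : A (a1 D) by rewrite Ea1; sf sA.
have Aa2 : A (a2 D) by rewrite Ea2; sf sA.
have AT1 : A (T1 D) by rewrite (_ : T1 D = t1) ?tdE.
have AT2 : A (T2 D).
  by rewrite (_ : T2 D = t2 * m2 D); [sf sA | rewrite tdE; field].
have AT3 : A (T3 D).
  by rewrite (_ : T3 D = t3 * m3 D); [sf sA | rewrite tdE; field].
(* T_1, T_2, T_3 are three linear equations for the four free entries of N; elimination expresses
   the others affinely in n12. *)
pose B := - 1 + (a1 D + a2 D) / (a1 D + 1).
pose B0 := - (a2 D * T3 D + T2 D) / (a1 D + 1).
pose B' := 1 - (a1 D + a2 D) / (a2 D + 1).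
pose B0' := - T3 D - (- a2 D * T3 D + T1 D) / (a2 D + 1).
have AB : A B by rewrite /B; sf sA.
have AB0 : A B0 by rewrite /B0; sf sA.
have AB' : A B' by rewrite /B'; sf sA.
have AB0' : A B0' by rewrite /B0'; sf sA.
have E21 : n21 D = T3 D - n12 D by rewrite /T3; ring.
have E11 : n11 D = B0 + B * n12 D.
  by rewrite /B0 /B /T2 /T3 /n31 /n13; field.
have E22 : n22 D = B0' + B' * n12 D.
  by rewrite /B0' /B' /T1 /T3 /n32 /n23; field.
(* The remaining equation [cN = - d3 m3^2] is quadratic in n12 with leading coefficient B B' + 1 =
   l; this is where a_1 + a_2 != 0 and 2 != 0 enter. *)
pose l := 2 * (a1 D + a2 D) / ((a1 D + 1) * (a2 D + 1)).
have ln : l != 0 by rewrite /l !mulf_neq0 ?invr_eq0 ?mulf_neq0.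
have El : B * B' + 1 = l by rewrite /B /B' /l; field; rewrite ?a1n ?a2n.
clearbody l B B0 B' B0'.
have Ec : cN D = - (d3 * m3 D ^+ 2) by rewrite tdE; move: (cN D) => c; field.
pose p' := - (B0 * B0' + d3 * m3 D ^+ 2) / l.
pose q' := - (B0 * B' + B0' * B - T3 D) / l.
have Al : A l by rewrite -El; sf sA.
exists (m2 D), (n12 D), p, q; split=> //.
  exists p', q'; split; [by rewrite /p'; sf sA | by rewrite /q'; sf sA |].
  have : cN D + d3 * m3 D ^+ 2 = 0 by rewrite Ec addNr.
  rewrite /cN E11 E22 E21 => H.
  apply/eqP; rewrite -subr_eq0; apply/eqP.
  transitivity (((B0 + B * n12 D) * (B0' + B' * n12 D) - n12 D * (T3 D - n12 D)
     + d3 * m3 D ^+ 2) / l); last by rewrite H mul0r.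
  by rewrite /p' /q' -El; field; rewrite El.
move=> sL L.
have AL x : A x -> L x by apply: adjoin_base.
have Lb : L (n12 D) by apply: adjoin_gen.
split; first by split; apply: AL.
have LT3 := AL _ AT3.
by split; rewrite ?E11 ?E22 ?E21 //; sf sL; apply: AL.
Qed.

End SpectralRelations.

(** * Power sums of the spectra on the line *)

Section PowerSums.
Variables (K : fieldType) (b1 b2 b3 b4 : K) (y z : 'I_3 -> K) (L : K -> Prop).
Notation i2 := (inord 2 : 'I_3).
Notation D := (cubic_datum b1 b2 b3 b4 y z).
Hypotheses (a1n : b1 != 0) (a2n : b2 != 0) (a4n : b1 + b2 + 1 != 0).
Hypotheses (n6 : (6%:R : K) != 0) (zn : forall j, z j != 0).
Hypothesis kapn : forall j, mD D (y j) (z j) != Y1 D (y j) (z j) / z j.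
Hypothesis sL : subfield L.
Hypotheses (La1 : L (a1 D)) (La2 : L (a2 D)) (Lm2 : L (m2 D)) (Lm3 : L (m3 D)).
Hypotheses (Ln11 : L (n11 D)) (Ln12 : L (n12 D)) (Ln21 : L (n21 D)) (Ln22 : L (n22 D)).

(** The ratios y_j / z_j are the roots of a cubic over L, and u_j, v_j are one and the same rational
    function over L of each root; the power sums are traces. *)
Lemma power_sum_in i k :
  L (\sum_j uD D (y j) (z j) (Y1 D (y j) (z j) / z j) ^+ i
           * vD D (y j) (z j) (Y1 D (y j) (z j) / z j) ^+ k).
Proof.
have [Eg0 Eg1 Eg2 Eg3] := cubic_datumE b3 b4 y z a1n a2n a4n.
have [z0 z1 z2] : [/\ z 0 != 0, z 1 != 0 & z i2 != 0] by split.
have g0n : g0 D != 0 by rewrite Eg0 !mulf_neq0.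
move: kapn La1 La2 Lm2 Lm3 Ln11 Ln12 Ln21 Ln22 Eg0 Eg1 Eg2 Eg3 g0n.
(* The datum is made opaque: the only equations that still tie it to the y_j, z_j are the four
   factored coefficients of the cubic, which is why the y_j, z_j need not lie in L. *)
move: D => E kapE LE1 LE2 LE3 LE4 LE5 LE6 LE7 LE8 Eg0 Eg1 Eg2 Eg3 g0n.
have [Lg0 Lg1 Lg2 Lg3] : [/\ L (g0 E), L (g1 E), L (g2 E) & L (g3 E)].
  by rewrite /g0 /g1 /g2 /g3; split; sf sL.
have [LT1 LT2 LT3] : [/\ L (T1 E), L (T2 E) & L (T3 E)].
  by rewrite /T1 /T2 /T3 /n31 /n32 /n13 /n23; split; sf sL.
pose h j := y j / z j.
have yE j : y j = z j * h j by rewrite /h mulrC divfK.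
pose s1 := - g1 E / g0 E; pose s2 := g2 E / g0 E; pose s3 := - g3 E / g0 E.
have Ls1 : L s1 by rewrite /s1; sf sL.
have Ls2 : L s2 by rewrite /s2; sf sL.
have Ls3 : L s3 by rewrite /s3; sf sL.
have Es1 : s1 = h 0 + h 1 + h i2.
  by rewrite /s1 Eg0 Eg1 /h; field; rewrite z0 z1 z2.
have Es2 : s2 = h 0 * h 1 + h 0 * h i2 + h 1 * h i2.
  by rewrite /s2 Eg0 Eg2 /h; field; rewrite z0 z1 z2.
have Es3 : s3 = h 0 * h 1 * h i2.
  by rewrite /s3 Eg0 Eg3 /h; field; rewrite z0 z1 z2.
clearbody s1 s2 s3 h.
have cub j : h j ^+ 3 = s1 * h j ^+ 2 - s2 * h j + s3.
  by rewrite Es1 Es2 Es3; case: (ord3P j) => [->|[->|->]]; ring.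
have tr1 : \sum_j h j = s1 by rewrite sum_ord3 Es1.
have tr2 : \sum_j h j ^+ 2 = s1 ^+ 2 - 2 * s2 by rewrite sum_ord3 Es1 Es2; ring.
pose kk j := Y1 E (h j) 1; pose mm j := mD E (h j) 1; pose tt j := trY E (h j) 1.
have Eu j : uD E (y j) (z j) (Y1 E (y j) (z j) / z j) = uD E (h j) 1 (kk j)
    /\ vD E (y j) (z j) (Y1 E (y j) (z j) / z j) = vD E (h j) 1 (kk j).
  by have := kapE j; rewrite !yE; apply: uD_scale.
have kn j : mm j - kk j != 0.
  have := kapE j; rewrite -subr_eq0 yE.
  have -> : mD E (z j * h j) (z j) = z j * mm j by rewrite /mm /mD; ring.
  have -> : Y1 E (z j * h j) (z j) / z j = z j * kk j by rewrite /kk /Y1; field.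
  by rewrite -mulrBr mulf_eq0 negb_or => /andP[].
have kn' j : kk j - mm j != 0 by rewrite -opprB oppr_eq0 kn.
have cst x : L x -> cubic_fun L h (fun=> x) by apply: cf_const.
have CM := cfM sL Ls1 Ls2 Ls3 cub; have CD := @cfD _ _ sL h; have CN := @cfN _ _ sL h.
have CB := @cfB _ _ sL h; have CV := cfV sL Ls1 Ls2 Ls3 n6 cub tr1 tr2.
have Ch : cubic_fun L h h by apply: cf_gen.
have Ck : cubic_fun L h kk.
  apply: (@cf_ext _ _ h (fun j => - (a1 E * n22 E * (h j * h j)
      + ((a1 E + 1) * n21 E + (a2 E + 1) * n22 E) * h j + a2 E * n21 E))).
    by move=> j; rewrite /kk /Y1; ring.
  apply CN; apply CD; last by apply cst; sf sL.
  by apply CD; apply CM; first [by apply cst; sf sL | exact: CM | exact: Ch].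
have Cm : cubic_fun L h mm.
  apply: (@cf_ext _ _ h (fun j => (1 - m3 E * a1 E) * h j + (m2 E - m3 E * a2 E))).
    by move=> j; rewrite /mm /mD; ring.
  apply CD; last by apply cst; sf sL.
  by apply CM => //; apply cst; sf sL.
have Ct : cubic_fun L h tt.
  apply: (@cf_ext _ _ h (fun j => (T1 E - a1 E * T3 E) * h j + (T2 E - a2 E * T3 E))).
    by move=> j; rewrite /tt /trY; move: (T1 E) (T2 E) (T3 E) => t t' t''; ring.
  apply CD; last by apply cst; sf sL.
  by apply CM => //; apply cst; sf sL.
have Cu : cubic_fun L h (fun j => uD E (h j) 1 (kk j)).
  change (cubic_fun L h (fun j => (tt j - 3 * kk j) * (mm j - kk j)^-1)).
  apply CM; last by apply CV; [exact: kn | exact: CB].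
  by apply CB => //; apply CM => //; apply cst; sf sL.
have Cv : cubic_fun L h (fun j => vD E (h j) 1 (kk j)).
  change (cubic_fun L h (fun j => kk j * (kk j - mm j)^-1)).
  by apply CM => //; apply CV; [exact: kn' | exact: CB].
have C := CM _ _ (cf_exp sL Ls1 Ls2 Ls3 cub i Cu) (cf_exp sL Ls1 Ls2 Ls3 cub k Cv).
have := cf_trace sL Ls1 Ls2 tr1 tr2 C.
rewrite (eq_bigr (fun j => uD E (y j) (z j) (Y1 E (y j) (z j) / z j) ^+ i
           * vD E (y j) (z j) (Y1 E (y j) (z j) / z j) ^+ k)) // => j _.
by have [-> ->] := Eu j.
Qed.

End PowerSums.

(** * Symmetric functions of the spectra on the line *)

Section OrbitSums.
Variables (C : fieldType) (n : nat).
Notation K := {fraction {mpoly C[n]}}.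
Notation i2 := (inord 2 : 'I_3).

Lemma mmap_comp m l (g : 'I_l -> K) (lq : m.-tuple {mpoly C[l]}) (q : {mpoly C[m]}) :
  mmap (@fconst C n) g (q \mPo lq) =
  mmap (@fconst C n) (fun i => mmap (@fconst C n) g (tnth lq i)) q.
Proof.
rewrite comp_mpolyE rmorph_sum; apply: eq_bigr => e _ /=.
rewrite mmapZ rmorph_prod; congr (_ * _).
by apply: eq_bigr => i _; rewrite rmorphXn.
Qed.

Lemma inord_0 m : inord 0 = 0 :> 'I_m.+1.
Proof. by apply: val_inj; rewrite /= inordK. Qed.

Lemma inord_1 m : inord 1 = 1 :> 'I_m.+2.
Proof. by apply: val_inj; rewrite /= inordK. Qed.

Lemma mmap_pair_act (u v : 'I_3 -> K) (s : 'S_3) (q : {mpoly C[6]}) :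
  mmap (@fconst C n) (pt6 u v) (pair_act s q) =
  mmap (@fconst C n) (pt6 (u \o s) (v \o s)) q.
Proof.
rewrite /pair_act mmap_comp; congr (mmap _ _ q).
apply: funext => i.
rewrite tnth_mktuple mmapX mmap1U /pt6.
set j := s _.
have hk : (2 * j + odd i < 6)%N by case: j => [[|[|[|]]]] //= _; case: (odd i).
rewrite inordK //.
have -> : odd (2 * j + odd i) = odd i by rewrite oddD mul2n odd_double oddb.
have -> : (2 * j + odd i)./2 = j :> nat.
  by rewrite halfD mul2n odd_double /= doubleK; case: (odd i); rewrite !addn0.
by rewrite /= inord_val.
Qed.

(** An explicit list turns sums over the orbit into six-term expressions. *)
Definition orbit_perms : seq 'S_3 :=
  [:: 1%g; tperm 0 1; tperm 0 i2; tperm 1 i2;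
      (tperm 0%R 1%R * tperm 1%R i2)%g; (tperm 1%R i2 * tperm 0%R 1%R)%g].

Lemma orbit_permsE (V : nmodType) (f : 'I_3 -> 'I_3 -> 'I_3 -> V) :
  \sum_(s <- orbit_perms) f (s 0) (s 1) (s i2) =
  f 0 1 i2 + f 1 0 i2 + f i2 1 0 + f 0 i2 1 + f i2 0 1 + f 1 i2 0.
Proof.
have n01 : (0 : 'I_3) != 1 by [].
have n02 : (0 : 'I_3) != i2 by rewrite -val_eqE /= inordK.
have n12 : (1 : 'I_3) != i2 by rewrite -val_eqE /= inordK.
rewrite !big_cons big_nil !permM !perm1 !tpermL !tpermR.
rewrite ![tperm 0 1 i2]tpermD // ![tperm 1 i2 0]tpermD 1?eq_sym //.
rewrite ![tperm 0 i2 1]tpermD 1?eq_sym // !tpermL !tpermR.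
by rewrite addr0 !addrA.
Qed.

Variables (u v : 'I_3 -> K).
Notation ev s := (mmap (@fconst C n) (pt6 (u \o fun_of_perm s) (v \o fun_of_perm s))).
Variable L : K -> Prop.
Hypotheses (sL : subfield L) (LC : forall c, L (fconst n c)).
Hypothesis Lp : forall i k, L (\sum_j u j ^+ i * v j ^+ k).

(** For a monomial the orbit sum runs over triples of distinct indices. Inclusion-exclusion over
    coinciding indices rewrites it as a polynomial in sums over one index, which are power sums. *)
Lemma orbit_sum_in (q : {mpoly C[6]}) : L (\sum_(s <- orbit_perms) ev s q).
Proof.
elim/mpolyind: q => [|c m p _ _ IH].
  by rewrite big1 => [|s _]; [exact: (sf0 sL) | rewrite raddf0].
under eq_bigr => s _ do rewrite raddfD /= mmapZ mmapX.
rewrite big_split /= -mulr_sumr; apply: (sfD sL) => //; apply: (sfM sL) => //.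
rewrite /mmap1; under eq_bigr => s _ do rewrite !big_ord_recl big_ord0 /pt6 /= inord_0 inord_1.
set e0 := m _; set e1 := m _; set e2 := m _; set e3 := m _; set e4 := m _; set e5 := m _.
pose f0 j := u j ^+ e0 * v j ^+ e1; pose f1 j := u j ^+ e2 * v j ^+ e3.
pose f2 j := u j ^+ e4 * v j ^+ e5.
rewrite (eq_bigr (fun s : 'S_3 => f0 (s 0) * f1 (s 1) * f2 (s i2))); last first.
  by move=> s _; rewrite /f0 /f1 /f2 mulr1 !mulrA.
rewrite (orbit_permsE (fun i j k => f0 i * f1 j * f2 k)).
pose S0 := \sum_j f0 j; pose S1 := \sum_j f1 j; pose S2 := \sum_j f2 j.
pose S01 := \sum_j f0 j * f1 j; pose S02 := \sum_j f0 j * f2 j.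
pose S12 := \sum_j f1 j * f2 j; pose S012 := \sum_j f0 j * f1 j * f2 j.
have [L0 L1 L2] : [/\ L S0, L S1 & L S2] by split; apply: Lp.
have L01 : L S01.
  rewrite /S01 (eq_bigr (fun j => u j ^+ (e0 + e2) * v j ^+ (e1 + e3))) //.
  by move=> j _; rewrite /f0 /f1 !exprD mulrACA.
have L02 : L S02.
  rewrite /S02 (eq_bigr (fun j => u j ^+ (e0 + e4) * v j ^+ (e1 + e5))) //.
  by move=> j _; rewrite /f0 /f2 !exprD mulrACA.
have L12 : L S12.
  rewrite /S12 (eq_bigr (fun j => u j ^+ (e2 + e4) * v j ^+ (e3 + e5))) //.
  by move=> j _; rewrite /f1 /f2 !exprD mulrACA.
have L012 : L S012.
  rewrite /S012 (eq_bigr (fun j => u j ^+ (e0 + e2 + e4) * v j ^+ (e1 + e3 + e5))) //.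
  by move=> j _; rewrite /f0 /f1 /f2 !exprD; ring.
have -> : f0 0 * f1 1 * f2 i2 + f0 1 * f1 0 * f2 i2 + f0 i2 * f1 1 * f2 0
   + f0 0 * f1 i2 * f2 1 + f0 i2 * f1 0 * f2 1 + f0 1 * f1 i2 * f2 0
   = S0 * S1 * S2 - S01 * S2 - S02 * S1 - S12 * S0 + 2 * S012.
  rewrite /S0 /S1 /S2 /S01 /S02 /S12 /S012 !sum_ord3.
  move: (f0 0) (f0 1) (f0 i2) (f1 0) (f1 1) (f1 i2) (f2 0) (f2 1) (f2 i2).
  by move=> *; ring.
apply: (sfD sL); last by apply: (sfM sL) => //; apply: (sf_nat sL).
by do !apply: (sfB sL); do ?apply: (sfM sL).
Qed.

(* Both parts of a fraction are multiplied by a polynomial w and summed over the orbit;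
   some monomial w in v_0, v_1 keeps the denominator nonzero, since a suitable linear
   combination of such monomials vanishes at all permuted points but one. *)
Lemma sym_value_in (sigma : {fraction {mpoly C[6]}}) (nu de : {mpoly C[6]}) :
  S3inv sigma -> sigma = tofrac nu / tofrac de ->
  mmap (@fconst C n) (pt6 u v) de != 0 ->
  v 0 != v 1 -> v 0 != v i2 -> v 1 != v i2 ->
  L (mmap (@fconst C n) (pt6 u v) nu / mmap (@fconst C n) (pt6 u v) de).
Proof.
move=> inv es de0 v01 v02 v12.
have den0 : de != 0 by apply: contra_neq de0 => ->; rewrite raddf0.
set N := mmap _ _ nu; set Dn := mmap _ _ de.
(* Invariance is cross-multiplied, so this holds even where the permuted denominator vanishes. *)
have key (s : 'S_3) : ev s nu = N / Dn * ev s de.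
  have := congr1 (mmap (@fconst C n) (pt6 u v)) (inv nu de den0 es s).
  rewrite !rmorphM /= !mmap_pair_act -/N -/Dn => H.
  by apply: (mulIf de0); rewrite H -/Dn mulrAC divfK.
pose w (i k : nat) : {mpoly C[6]} := 'X_(inord 1) ^+ i * 'X_(inord 3) ^+ k.
have evw (s : 'S_3) i k q : ev s (w i k * q) = v (s 0) ^+ i * v (s 1) ^+ k * ev s q.
  rewrite !rmorphM !rmorphXn /= !mmapX !mmap1U /pt6 /= !inordK //=.
  by rewrite inord_0 inord_1.
pose S i k := \sum_(s <- orbit_perms) ev s (w i k * de).
have main i k : S i k != 0 -> L (N / Dn).
  move=> Sn; have -> : N / Dn = (\sum_(s <- orbit_perms) ev s (w i k * nu)) / S i k.
    apply: (canRL (mulfK Sn)); rewrite /S mulr_sumr; apply: eq_bigr => s _.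
    by rewrite !evw key mulrCA.
  by apply: (sf_div sL); apply: orbit_sum_in.
have [/existsP[i /existsP[k]]|/existsPn H] := boolP [exists i : 'I_3, exists k : 'I_3, S i k != 0].
  exact: main.
exfalso; have Z (i k : nat) : (i < 3)%N -> (k < 3)%N -> S i k = 0.
  by move=> hi hk; have /existsPn/(_ (Ordinal hk)) := H (Ordinal hi); rewrite negbK => /eqP.
pose A0 := v 1 * v i2; pose A1 := - (v 1 + v i2).
pose B0 := v 0 * v i2; pose B1 := - (v 0 + v i2).
(* The weight vanishes unless s fixes 0 and 1, so only the identity survives. It has degree two in
   each of v (s 0) and v (s 1), so it is a combination of the nine sums S i k with i, k < 3. *)
have : \sum_(s <- orbit_perms)
  (v (s 0) - v 1) * (v (s 0) - v i2) * ((v (s 1) - v 0) * (v (s 1) - v i2)) * ev s de = 0.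
  transitivity (A0 * B0 * S 0%N 0%N + A0 * B1 * S 0%N 1%N + A0 * S 0%N 2%N + A1 * B0 * S 1%N 0%N
    + A1 * B1 * S 1%N 1%N + A1 * S 1%N 2%N + B0 * S 2%N 0%N + B1 * S 2%N 1%N + S 2%N 2%N); last first.
    by rewrite !Z // !mulr0 !addr0.
  rewrite /S !mulr_sumr -!big_split /=; apply: eq_bigr => s _.
  rewrite !evw /A0 /A1 /B0 /B1.
  by move: (ev s de) (v (s 0)) (v (s 1)) => e x y; ring.
rewrite !big_cons big_nil !permM !perm1.
have n02 : (0 : 'I_3) != i2 by rewrite -val_eqE /= inordK.
have n12 : (1 : 'I_3) != i2 by rewrite -val_eqE /= inordK.
have o02 : i2 != (0 : 'I_3) by rewrite eq_sym.
have o12 : i2 != (1 : 'I_3) by rewrite eq_sym.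
rewrite !tpermL !tpermR ![tperm 0 i2 1]tpermD // ![tperm 1 i2 0]tpermD // ![tperm 0 1 i2]tpermD //.
rewrite ?tpermL ?tpermR.
rewrite !subrr !(mul0r, mulr0, addr0).
move/eqP; rewrite !mulf_eq0 !subr_eq0 (negPf v01) (negPf v02) (negPf v12) eq_sym (negPf v01) /=.
have -> : ev (1%g : 'S_3) de = Dn.
  rewrite /Dn; congr (mmap _ _ de); apply: funext => i.
  by rewrite /pt6 /= !perm1.
by rewrite (negPf de0).
Qed.

End OrbitSums.

(** * The generic map *)

Section RatiosOf.
Variables (R : comPzRingType) (K : fieldType) (f : {rmorphism R -> K}).

Lemma ratio_cross P Q P' Q' :
  f Q' != 0 -> f Q != 0 -> P' * Q = P * Q' -> f P / f Q = f P' / f Q'.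
Proof. by move=> b0 e0 E; apply/eqP; rewrite eqr_div // -!rmorphM E. Qed.

(** For an evaluation map this is the field generated by its values. Quotients of images avoid any
    assumption of injectivity, here that the t_i, d_i are independent. *)
Definition ratios_of (x : K) := exists P Q, f Q != 0 /\ x = f P / f Q.

Lemma ratios_of_image P : ratios_of (f P).
Proof. by exists P, 1; rewrite rmorph1 oner_neq0 divr1. Qed.

Lemma ratios_of_subfield : subfield ratios_of.
Proof.
split.
- by rewrite -(rmorph1 f); apply: ratios_of_image.
- move=> _ _ [P [Q [Qn ->]]] [P' [Q' [Qn' ->]]].
  exists (P * Q' - P' * Q), (Q * Q'); rewrite rmorphB !rmorphM mulf_neq0 //.
  by split=> //; field; rewrite Qn Qn'.
- move=> _ _ [P [Q [Qn ->]]] [P' [Q' [Qn' ->]]].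
  by exists (P * P'), (Q * Q'); rewrite !rmorphM mulf_neq0 // mulf_div.
- move=> _ [P [Q [Qn ->]]]; have [->|Pn] := eqVneq (f P) 0.
    by rewrite mul0r invr0 -(rmorph0 f); apply: ratios_of_image.
  by exists Q, P; rewrite invf_div.
Qed.

End RatiosOf.

Section GenericMap.
Variable C : numFieldType.
Notation i2 := (inord 2 : 'I_3).

(** Rescaling the pairs (y_j, z_j) by factors with product one does not change the datum: ten
    coordinates for eight dimensions. Homogeneous pairs keep fixed points with z_j = 0 within
    reach. *)
Definition param (K : fieldType) (x : 'I_10 -> K) : datum K :=
  cubic_datum (x (inord 0)) (x (inord 1)) (x (inord 2)) (x (inord 3))
    (fun j : 'I_3 => x (inord (4 + j))) (fun j : 'I_3 => x (inord (7 + j))).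
Notation yp x j := (x (inord (4 + nat_of_ord (j : 'I_3)))).
Notation zp x j := (x (inord (7 + nat_of_ord (j : 'I_3)))).

(** [kap] is given separately because neither Y_0 / y nor Y_1 / z is defined at every fixed point on
    the line. *)
Definition good (th : 'I_10 -> C) (kap : 'I_3 -> C) :=
  let D := param th in
  [/\ a1 D != 0, a2 D != 0, a4 D != 0 & m2 D != 0] /\ m3 D != 0 /\ m4 D != 0 /\
  forall j : 'I_3, [/\ yp th j != 0 \/ zp th j != 0,
    Y0 D (yp th j) (zp th j) = kap j * yp th j,
    Y1 D (yp th j) (zp th j) = kap j * zp th j &
    mD D (yp th j) (zp th j) - kap j != 0].

Notation K := {fraction {mpoly C[10]}}.
Notation X := (@fvar C 10).
Notation D := (param X).
Definition kapK (j : 'I_3) : K := Y1 D (yp X j) (zp X j) / zp X j.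
Definition uK (j : 'I_3) : K := uD D (yp X j) (zp X j) (kapK j).
Definition vK (j : 'I_3) : K := vD D (yp X j) (zp X j) (kapK j).

Lemma fvar_neq0 (i : 'I_10) : X i != 0.
Proof.
by apply: (@fv_neq0 _ _ (fun=> 1) _ 1); [exact: fvX | exact: oner_neq0].
Qed.

Section Specialise.
Variables (th : 'I_10 -> C) (kap : 'I_3 -> C).
Hypothesis gd : good th kap.
Notation d := (param th).

Lemma good_neq0 : [/\ a1 d != 0, a2 d != 0, a4 d != 0 & m2 d != 0] /\ m3 d != 0 /\ m4 d != 0.
Proof. by case: gd => ? [? [? _]]. Qed.

Lemma fv_datum : [/\ frac_val (a1 D) th (a1 d), frac_val (a2 D) th (a2 d),
    frac_val (m2 D) th (m2 d) & frac_val (m3 D) th (m3 d)] /\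
  [/\ frac_val (n11 D) th (n11 d), frac_val (n12 D) th (n12 d),
      frac_val (n21 D) th (n21 d) & frac_val (n22 D) th (n22 d)].
Proof.
have [[h1 h2 h4 _] _] := good_neq0.
by split; [split; exact: fvX | rewrite /= /a4 /= in h1 h2 h4 *; split; fvt; exact: fvX].
Qed.

Lemma fv_derived :
  [/\ frac_val (T1 D) th (T1 d), frac_val (T2 D) th (T2 d),
    frac_val (T3 D) th (T3 d) & frac_val (T4 D) th (T4 d)] /\
  [/\ frac_val (cN D) th (cN d), frac_val (a4 D) th (a4 d) & frac_val (m4 D) th (m4 d)].
Proof.
have [[f1 f2 f3 f4] [f5 f6 f7 f8]] := fv_datum.
move: D d f1 f2 f3 f4 f5 f6 f7 f8 => E e *.
rewrite /T1 /T2 /T3 /T4 /cN /a4 /m4 /n33 /n32 /n31 /n23 /n13.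
by split; split; fvt.
Qed.

Lemma fv_td i : frac_val (tD D i) th (tD d i) /\ frac_val (dD D i) th (dD d i).
Proof.
have [[f1 f2 f3 f4] _] := fv_datum; have [[g1 g2 g3 g4] [g5 g6 g7]] := fv_derived.
have [[_ _ _ h1] [h2 h3]] := good_neq0.
move: D d f1 f2 f3 f4 g1 g2 g3 g4 g5 g6 g7 h1 h2 h3 => E e *.
by rewrite /tD /dD; case: (val i) => [|[|[|k]]]; split; fvt; rewrite ?expf_neq0.
Qed.

Lemma fv_line (y z : K) (y' z' : C) : frac_val y th y' -> frac_val z th z' ->
  [/\ frac_val (Y0 D y z) th (Y0 d y' z'), frac_val (Y1 D y z) th (Y1 d y' z'),
    frac_val (mD D y z) th (mD d y' z') & frac_val (trY D y z) th (trY d y' z')].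
Proof.
have [[f1 f2 f3 f4] [f5 f6 f7 f8]] := fv_datum; have [[g1 g2 g3 g4] _] := fv_derived.
move: D d f1 f2 f3 f4 f5 f6 f7 f8 g1 g2 g3 g4 => E e *.
by rewrite /Y0 /Y1 /mD /trY; split; fvt.
Qed.

Lemma param_root (j : 'I_3) : zp X j * Y0 D (yp X j) (zp X j) = yp X j * Y1 D (yp X j) (zp X j).
Proof.
have [[h1 h2 h4 _] _] := good_neq0; have [_ [_ f4 _]] := fv_derived.
apply: (@cubic_datum_root _ _ _ _ _ (fun j : 'I_3 => yp X j) (fun j : 'I_3 => zp X j)).
- exact: fvar_neq0.
- exact: fvar_neq0.
- exact: (fv_neq0 f4 h4).
Qed.

(** In the function field Y_0 / y = Y_1 / z, so the generic quotient can be evaluated through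
    whichever of the two has a nonzero denominator at [th]. *)
Lemma fv_kap (j : 'I_3) : frac_val (kapK j) th (kap j).
Proof.
have [_ [_ [_ /(_ j)[nz e0 e1 _]]]] := gd.
have [f0 f1 _ _] := fv_line (fvX th (inord (4 + j))) (fvX th (inord (7 + j))).
case: nz => nz; last first.
  by rewrite -(mulfK nz (kap j)) -e1; apply: fv_div => //; exact: fvX.
rewrite (_ : kapK j = Y0 D (yp X j) (zp X j) / yp X j).
  by rewrite -(mulfK nz (kap j)) -e0; apply: fv_div => //; exact: fvX.
rewrite /kapK; apply/eqP; rewrite eqr_div ?fvar_neq0 //.
by rewrite mulrC -param_root mulrC.
Qed.

Lemma fv_uv (j : 'I_3) : frac_val (uK j) th (uD d (yp th j) (zp th j) (kap j)) /\
  frac_val (vK j) th (vD d (yp th j) (zp th j) (kap j)).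
Proof.
have [_ [_ [_ /(_ j)[_ _ _ nz]]]] := gd.
have [_ _ f2 f3] := fv_line (fvX th (inord (4 + j))) (fvX th (inord (7 + j))).
have fk := fv_kap j.
have nz' : kap j - mD d (yp th j) (zp th j) != 0 by rewrite -opprB oppr_eq0.
by rewrite /uK /vK /uD /vD; split; fvt.
Qed.

Lemma mD_kap_neq0 (j : 'I_3) : mD D (yp X j) (zp X j) != kapK j.
Proof.
have [_ [_ [_ /(_ j)[_ _ _ nz]]]] := gd.
have [_ _ f2 _] := fv_line (fvX th (inord (4 + j))) (fvX th (inord (7 + j))).
by rewrite -subr_eq0; exact: (fv_neq0 (fvB f2 (fv_kap j)) nz).
Qed.

End Specialise.

Lemma fv_pt8 th (t e : 'I_4 -> K) (t' e' : 'I_4 -> C) :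
  (forall i, frac_val (t i) th (t' i) /\ frac_val (e i) th (e' i)) ->
  forall k, frac_val (pt8 t e k) th (pt8 t' e' k).
Proof. by move=> H k; rewrite /pt8; case: (odd k); have [] := H (inord k./2). Qed.

Lemma fv_pt6 th (t e : 'I_3 -> K) (t' e' : 'I_3 -> C) :
  (forall i, frac_val (t i) th (t' i) /\ frac_val (e i) th (e' i)) ->
  forall k, frac_val (pt6 t e k) th (pt6 t' e' k).
Proof. by move=> H k; rewrite /pt6; case: (odd k); have [] := H (inord k./2). Qed.

(** The representation that gives r a value need not be P / Q. Both have nonzero image in their
    denominators, and cross-multiplication identifies the two images in the function field. *)
Lemma fv_subst th m (g : 'I_m -> K) (c : 'I_m -> C) (r : {fraction {mpoly C[m]}}) P Q v :
  (forall i, frac_val (g i) th (c i)) -> r = tofrac P / tofrac Q ->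
  mmap (@fconst C 10) g Q != 0 -> frac_val r c v ->
  frac_val (mmap (@fconst C 10) g P / mmap (@fconst C 10) g Q) th v.
Proof.
move=> gc er Qn [nu [de [de0 er' ->]]].
have fn := fv_mmap nu gc; have fd := fv_mmap de gc.
have dn := fv_neq0 fd de0.
have nQ : Q != 0 by apply: contra_neq Qn => ->; rewrite raddf0.
have nde := meval_neq0 de0.
have : nu * Q = P * de.
  apply/eqP; rewrite -tofrac_eq !tofracM -eqr_div ?tofrac_eq0 //.
  by rewrite -er' er.
move=> E; pose ev : {rmorphism {mpoly C[m]} -> K} := mmap (@fconst C 10) g.
by have := @ratio_cross _ _ ev _ _ _ _ dn Qn E => /= ->; apply: fv_div.
Qed.

Notation ev8 := (mmap (@fconst C 10) (pt8 (tD D) (dD D))).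
Definition ratB : K -> Prop := ratios_of ev8.

Lemma ratB_subfield : subfield ratB.
Proof. exact: ratios_of_subfield. Qed.

Lemma ratB_mmap P : ratB (ev8 P).
Proof. exact: ratios_of_image. Qed.

Lemma ratB_const c : ratB (fconst 10 c).
Proof. by rewrite -(mmapC (pt8 (tD D) (dD D)) (@fconst C 10)); apply: ratB_mmap. Qed.

Lemma ratB_td i : ratB (tD D i) /\ ratB (dD D i).
Proof.
have h : (2 * i < 8)%N by case: i => [[|[|[|[|]]]]].
have h' : (2 * i + 1 < 8)%N by case: i h => [[|[|[|[|]]]]].
have -> : tD D i = mmap (@fconst C 10) (pt8 (tD D) (dD D)) 'X_(inord (2 * i)).
  by rewrite mmapX mmap1U /pt8 inordK // mul2n odd_double doubleK inord_val.
have -> : dD D i = mmap (@fconst C 10) (pt8 (tD D) (dD D)) 'X_(inord (2 * i + 1)).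
  by rewrite mmapX mmap1U /pt8 inordK // addn1 mul2n /= odd_double /= uphalf_double inord_val.
by split; apply: ratB_mmap.
Qed.

(** A test point with small integer coordinates where all generic nonvanishing conditions hold and
    the three v_j (4, -4, 2) are distinct; [kap0] lists the quotients Y_1 / z there. *)
Definition th0 (i : 'I_10) : C := nth 0 [:: 1; 2; 1; -1; 0; 1; -1; 1; 1; 1] i.
Definition kap0 (i : 'I_3) : C := nth 0 [:: 4; 4; 2] i.

Lemma param_th0 : param th0 = Datum 1 2 1 (- 1) 0 (- 1) (- 2) 1.
Proof.
rewrite /param /cubic_datum /th0 !inordK //=.
by f_equal; field.
Qed.

End GenericMap.

Lemma natS_neq0 (F : numDomainType) (x : F) k : x = k.+1%:R -> x != 0.
Proof. by move=> ->; rewrite pnatr_eq0. Qed.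

Lemma negS_neq0 (F : numDomainType) (x : F) k : - x = k.+1%:R -> x != 0.
Proof. by rewrite -oppr_eq0 => ->; rewrite pnatr_eq0. Qed.

(** * The quartic of the generic map and its specialisation *)

Section GenericMain.
Variable C : numFieldType.
Notation i2 := (inord 2 : 'I_3).
Notation j2 := (inord 2 : 'I_4).
Notation i3 := (inord 3 : 'I_4).
Notation yp x j := (x (inord (4 + nat_of_ord (j : 'I_3)))).
Notation zp x j := (x (inord (7 + nat_of_ord (j : 'I_3)))).
Notation K := {fraction {mpoly C[10]}}.
Notation X := (@fvar C 10).
Notation D := (param X).
Notation d0 := (param (th0 C)).

Lemma good_th0 : good (th0 C) (kap0 C).
Proof.
rewrite /good param_th0 /a4 /m4 /Y0 /Y1 /mD /=; split; first split.
- exact: oner_neq0.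
- by rewrite pnatr_eq0.
- by apply: (@natS_neq0 _ _ 3); ring.
- exact: oner_neq0.
split; first by rewrite oppr_eq0 oner_neq0.
split; first by apply: (@natS_neq0 _ _ 0); ring.
move=> j; rewrite /th0 /kap0; case: (ord3P j) => [->|[->|->]]; rewrite ?inordK //=; split.
all: try by [left; rewrite oner_neq0 | right; rewrite oner_neq0].
all: try by ring.
- by apply: (@negS_neq0 _ _ 0); ring.
- by apply: (@natS_neq0 _ _ 0); ring.
- by apply: (@negS_neq0 _ _ 0); ring.
Qed.

Lemma td_th0 : (tD d0 1 = 5) * (tD d0 j2 = 3) * (tD d0 i3 = 2)
  * (dD d0 1 = 4) * (dD d0 j2 = 2) * (dD d0 i3 = - 8).
Proof.
rewrite param_th0 /tD /dD /= !inordK //= /T1 /T2 /T3 /T4 /cN /a4 /m4 /n13 /n31 /n33 /n13 /n23 /=.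
by do !split; field.
Qed.

Lemma vD_th0 j : vD d0 (yp (th0 C) j) (zp (th0 C) j) (kap0 C j) = nth 0 [:: 4; - 4; 2] j.
Proof.
rewrite param_th0 /vD /mD /th0 /kap0 /=.
by case: (ord3P j) => [->|[->|->]]; rewrite ?inordK //=; field.
Qed.

Lemma vK_neq (i j : 'I_3) : (nth 0 [:: 4; - 4; 2] i : C) != nth 0 [:: 4; - 4; 2] j ->
  vK C i != vK C j.
Proof.
have [_ fi] := fv_uv good_th0 i; have [_ fj] := fv_uv good_th0 j.
rewrite -(vD_th0 i) -(vD_th0 j) -subr_eq0 -[vK C i == _]subr_eq0.
exact: (fv_neq0 (fvB fi fj)).
Qed.

Lemma natK_neq0 k : (k.+1%:R : K) != 0.
Proof.
apply: (fv_neq0 (fvMn k.+1 (fv1 (th0 C)))).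
by rewrite pnatr_eq0.
Qed.

Notation t1 := (tD D 1).
Notation t2 := (tD D j2).
Notation t3 := (tD D i3).
Notation r1 := (- (t1 - t3) / (t2 - t3)).

Lemma generic_neq0 :
  [/\ cN D != 0, t2 - t3 != 0, a1 D + 1 != 0, a2 D + 1 != 0 & a1 D + a2 D != 0] /\
  [/\ dD D 1 + dD D j2 * r1 ^+ 2 + dD D i3 * (1 + r1) ^+ 2 != 0,
     m2 D != 0, m3 D != 0, m4 D != 0 & a4 D != 0] /\
  a1 D != 0 /\ a2 D != 0.
Proof.
have g := good_th0.
have [[f1 f2 f3 f4] _] := fv_datum g; have [_ [f5 f6 f7]] := fv_derived g.
have [[h1 h2 h4 h3] [h5 h6]] := good_neq0 g.
have [ft1 fd1] := fv_td g 1; have [ft2 fd2] := fv_td g j2; have [ft3 fd3] := fv_td g i3.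
rewrite !td_th0 in ft1 fd1 ft2 fd2 ft3 fd3.
have n23 : (3 - 2 : C) != 0 by apply: (@natS_neq0 _ _ 0); ring.
have f23 := fvB ft2 ft3.
have fr : frac_val r1 (th0 C) (- (5 - 2) / (3 - 2)) by apply: fv_div => //; apply/fvN/fvB.
have fl := fvD (fvD fd1 (fvM fd2 (fv_exp 2 fr))) (fvM fd3 (fv_exp 2 (fvD (fv1 _) fr))).
split; [split | split; [split | split]].
- apply: (fv_neq0 f5); rewrite param_th0 /cN /=.
  by apply: (@negS_neq0 _ _ 1); ring.
- exact: (fv_neq0 f23).
- apply: (fv_neq0 (fvD f1 (fv1 _))); rewrite param_th0 /=.
  by apply: (@natS_neq0 _ _ 1); ring.
- apply: (fv_neq0 (fvD f2 (fv1 _))); rewrite param_th0 /=.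
  by apply: (@natS_neq0 _ _ 2); ring.
- apply: (fv_neq0 (fvD f1 f2)); rewrite param_th0 /=.
  by apply: (@natS_neq0 _ _ 2); ring.
- apply: (fv_neq0 fl).
  by apply: (@negS_neq0 _ _ 9); field.
- exact: (fv_neq0 f3).
- exact: (fv_neq0 f4).
- exact: (fv_neq0 f7).
- exact: (fv_neq0 f6).
- exact: (fv_neq0 f1).
- exact: (fv_neq0 f2).
Qed.

Lemma generic_annihilator (sigma : {fraction {mpoly C[6]}}) : S3inv sigma ->
  exists h : {poly {fraction {mpoly C[8]}}}, [/\ h \is monic, (size h <= 5)%N &
  forall th kap, good th kap -> forall (c : nat -> C) (s : C),
    let D := param th in
    (forall k, (k < size h)%N -> frac_val h`_k (pt8 (tD D) (dD D)) (c k)) ->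
    frac_val sigma (pt6 (fun j : 'I_3 => uD D (yp th j) (zp th j) (kap j))
                        (fun j : 'I_3 => vD D (yp th j) (zp th j) (kap j))) s ->
    \sum_(k < size h) c k * s ^+ k = 0].
Proof.
move=> inv.
pose ev6 : {rmorphism {mpoly C[6]} -> K} := mmap (@fconst C 10) (pt6 (uK C) (vK C)).
have fv6 (th : 'I_10 -> C) kap (g : good th kap) := fv_pt6 (fv_uv g).
(* If every denominator of sigma vanishes at the generic (u, v), then sigma has no value at any good
   point, and the polynomial X serves vacuously. *)
have [[nu [de [den es]]]|nex] :=
  EM (exists nu de, ev6 de != 0 /\ sigma = tofrac nu / tofrac de); last first.
  exists 'X; rewrite monicX size_polyX; split=> // th kap g c s /= _ [nu [de [de0 es _]]].
  case: nex; exists nu, de; split=> //.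
  exact: (fv_neq0 (fv_mmap de (fv6 _ _ g)) de0).
have [[cn t23 a1n a2n a12] [[ln m2n m3n m4n a4n] [b1n b2n]]] := generic_neq0.
have sB := ratB_subfield C.
have [al [be [p [q [Sp Sq Eal Ebe H]]]]] := datum_in_tower m2n m3n m4n sB
  (fun i => (ratB_td C i).1) (fun i => (ratB_td C i).2) cn t23 a1n a2n a12 (natK_neq0 1) ln.
have sA := adjoin_subfield sB Sp Sq Eal.
have sL : subfield (adjoin (adjoin (@ratB C) al) be).
  have [p' [q' [Sp' Sq' Ebe']]] := Ebe; exact: adjoin_subfield Ebe'.
have {H}[[La1 La2 Lm2 Lm3] Ln] := H sL.
have LC c : adjoin (adjoin (@ratB C) al) be (fconst 10 c).
  by do 2?apply: adjoin_base => //; apply: ratB_const.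
have zn (j : 'I_3) : zp X j != 0 by apply: fvar_neq0.
have [Ln1 Ln2 Ln3 Ln4] := Ln.
have Lp : forall i k, adjoin (adjoin (@ratB C) al) be (\sum_j uK C j ^+ i * vK C j ^+ k) :=
  power_sum_in b1n b2n a4n (natK_neq0 5) zn (mD_kap_neq0 good_th0) sL
    La1 La2 Lm2 Lm3 Ln1 Ln2 Ln3 Ln4.
have Ls := sym_value_in sL LC Lp inv es den.
have {}Ls : adjoin (adjoin (@ratB C) al) be (ev6 nu / ev6 de).
  apply: Ls; apply: vK_neq; rewrite ?inordK //= -subr_eq0.
  - by apply: (@natS_neq0 _ _ 7); ring.
  - by apply: (@natS_neq0 _ _ 1); ring.
  - by apply: (@negS_neq0 _ _ 5); ring.
have [c [Sc Ec]] := tower_quartic sB Sp Sq Eal Ebe Ls.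
pose ev8 : {rmorphism {mpoly C[8]} -> K} := mmap (@fconst C 10) (pt8 (tD D) (dD D)).
have /fin_all_exists[P HP] (k : 'I_4) : exists PQ : {mpoly C[8]} * {mpoly C[8]},
    ev8 PQ.2 != 0 /\ c k = ev8 PQ.1 / ev8 PQ.2.
  by have [P [Q [? ?]]] := Sc k; exists (P, Q).
(* The coefficients of the quartic are lifted from the subfield of K generated by the t_i, d_i back
   to rational functions of eight variables; the value 1 at k = 4 makes h monic of degree exactly
   four. *)
pose r (k : nat) : {fraction {mpoly C[8]}} :=
  if (k < 4)%N then tofrac (P (inord k)).1 / tofrac (P (inord k)).2 else 1.
pose h := \poly_(k < 5) r k.
have sh : size h = 5 by rewrite size_poly_eq // /r /= oner_neq0.
exists h; split; rewrite ?sh //.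
  by rewrite monicE lead_coefE sh coef_poly.
move=> th kap g b s /= hb hs.
have fs : frac_val (ev6 nu / ev6 de) th s := fv_subst (fv6 _ _ g) es den hs.
have f8 := fv_pt8 (fv_td g).
have fc (k : 'I_4) : frac_val (c k) th (b k).
  have [Qn ->] := HP k; apply: (fv_subst f8 _ Qn (hb k _)).
    by rewrite coef_poly /r (ltn_trans (ltn_ord k)) // ltn_ord inord_val.
  exact: (ltn_trans (ltn_ord k)).
have b4 : b 4%N = 1.
  by have := hb 4%N isT; rewrite coef_poly /r /= => /fv_uniq; apply; apply: fv1.
(* The number in question is a value at [th] of the quartic at sigma, which is 0 in K. *)
rewrite big_ord_recr /= b4 mul1r; apply: (@fv_zero _ _ th); rewrite -Ec.
by apply: fvD; [apply: fv_sum => k; apply: fvM => // |]; apply: fv_exp.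
Qed.

End GenericMain.

(** * Reduction to the normal form *)

Lemma sum_ord2 (V : nmodType) (f : 'I_2 -> V) : \sum_j f j = f 0 + f 1.
Proof. by rewrite !big_ord_recl big_ord0 addr0; congr (_ + f _); apply: val_inj. Qed.

Section SmallDet.
Variable R : comNzRingType.
Notation i2 := (inord 2 : 'I_3).

Lemma mxtrace2E (A : 'M[R]_2) : \tr A = A 0 0 + A 1 1.
Proof. exact: sum_ord2. Qed.

Lemma mxtrace3E (A : 'M[R]_3) : \tr A = A 0 0 + A 1 1 + A i2 i2.
Proof. exact: sum_ord3. Qed.

Lemma det2E (A : 'M[R]_2) : \det A = A 0 0 * A 1 1 - A 0 1 * A 1 0.
Proof.
rewrite (expand_det_row _ 0) !big_ord_recl big_ord0 addr0 /cofactor !det_mx11 !mxE /=.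
rewrite (_ : lift 0 0 = 1 :> 'I_2); last exact: val_inj.
rewrite (_ : lift (1 : 'I_2) 0 = 0); last exact: val_inj.
by rewrite expr0 mul1r expr1 mulN1r mulrN.
Qed.

Lemma ord3_lift : (lift (0 : 'I_3) (0 : 'I_2) = 1) * (lift (0 : 'I_3) (1 : 'I_2) = i2)
  * (lift (1 : 'I_3) (0 : 'I_2) = 0) * (lift (1 : 'I_3) (1 : 'I_2) = i2)
  * (lift i2 (0 : 'I_2) = 0) * (lift i2 (1 : 'I_2) = 1).
Proof. by do !split; apply: val_inj; rewrite /= ?inordK. Qed.

Lemma det3E (A : 'M[R]_3) : \det A =
  A 0 0 * (A 1 1 * A i2 i2 - A 1 i2 * A i2 1)
  - A 0 1 * (A 1 0 * A i2 i2 - A 1 i2 * A i2 0)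
  + A 0 i2 * (A 1 0 * A i2 1 - A 1 1 * A i2 0).
Proof.
rewrite (expand_det_row _ 0) sum_ord3 /cofactor !det2E !mxE !ord3_lift inordK //=.
by rewrite !expr0 !expr1 -signr_odd /= expr0; ring.
Qed.

Lemma det3_char (A : 'M[R]_3) (l : R) : \det (l%:M - A) =
  (l - A 0 0) * ((l - A 1 1) * (l - A i2 i2) - A 1 i2 * A i2 1)
  - A 0 1 * (A 1 0 * (l - A i2 i2) + A 1 i2 * A i2 0)
  - A 0 i2 * (A 1 0 * A i2 1 + (l - A 1 1) * A i2 0).
Proof.
rewrite det3E !mxE.
have n02 : (0 : 'I_3) == i2 = false by rewrite -val_eqE /= inordK.
have n12 : (1 : 'I_3) == i2 = false by rewrite -val_eqE /= inordK.
rewrite !eqxx ![i2 == _]eq_sym n02 n12 -[(1 : 'I_3) == 0]/false -[(0 : 'I_3) == 1]/false.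
by rewrite !mulr1n !mulr0n; ring.
Qed.

End SmallDet.

(** * Quadratic maps, their Jacobians and fixed points *)

Section QuadraticForms.
Variable C : fieldType.
Implicit Types (x y : 'I_3 -> C) (q : {mpoly C[3]}).

Lemma hom2_ind (P : {mpoly C[3]} -> Prop) :
  P 0 -> (forall q r, P q -> P r -> P (q + r)) ->
  (forall c i j, P (c *: ('X_i * 'X_j))) -> forall q, q \is 2.-homog -> P q.
Proof.
move=> P0 PD PX q /dhomogP hq; rewrite [q]mpolyE big_seq.
elim/big_ind: _ => // m /hq dm.
have [i mi] : exists i, m i != 0%N.
  apply/existsP; apply: contraT; rewrite negb_exists => /forallP H.
  move: dm; rewrite /= mdegE big1 // => i _; by apply/eqP; have := H i; rewrite negbK.
have lm : (U_(i) <= m)%MM.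
  by apply/mnm_lepP => j; rewrite mnmE; case: eqP => [<-|//]; rewrite lt0n.
have : mdeg (m - U_(i))%MM == 1%N.
  by have := congr1 (@mdeg 3) (submK lm); rewrite mdegD mdeg1 dm addn1 => -[->].
move/mdeg1P => [j /eqP ej].
by rewrite -(submK lm) ej mpolyXD mulrC.
Qed.

Lemma hom2_polar q x y : q \is 2.-homog ->
  q.@[fun k => x k + y k] = q.@[x] + q.@[y] + \sum_s (q^`M(s)).@[x] * y s.
Proof.
move=> hq; elim/hom2_ind: q / hq => [|q r Eq Er|c i j].
- by rewrite !meval0 big1 ?addr0 // => s _; rewrite mderiv0 meval0 mul0r.
- under eq_bigr => s _ do rewrite mderivD mevalD mulrDl.
  by rewrite !mevalD Eq Er big_split /= -!addrA; congr (_ + _); ring.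
- have D1 (k : 'I_3) s : ('X_k : {mpoly C[3]})^`M(s).@[x] = (k == s)%:R.
    rewrite mderivX mevalZ mnm1E; case: eqP => [->|_]; last by rewrite mul0r.
    rewrite (_ : (U_(s) - U_(s))%MM = 0%MM) ?mpolyX0 ?meval1 ?mulr1 //.
    by apply/mnmP => l; rewrite !mnmE subnn.
  have S1 (k : 'I_3) : \sum_s (k == s)%:R * y s = y k.
    rewrite (bigD1 k) //= eqxx mul1r big1 ?addr0 // => s sk.
    by rewrite eq_sym (negPf sk) mul0r.
  under eq_bigr => s _ do
    rewrite mderivZ mderivM mevalZ mevalD !mevalM !mevalXU !D1.
  rewrite (_ : \sum_s _ = c * (x j * \sum_s (i == s)%:R * y s + x i * \sum_s (j == s)%:R * y s)).
    by rewrite !S1 !mevalZ !mevalM !mevalXU; ring.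
  by rewrite !mulr_sumr -big_split mulr_sumr; apply: eq_bigr => s _ /=; ring.
Qed.

Lemma hom2_scale q (c : C) x : q \is 2.-homog ->
  q.@[fun k => c * x k] = c ^+ 2 * q.@[x].
Proof.
move=> hq; elim/hom2_ind: q / hq => [|q r Eq Er|d i j].
- by rewrite !meval0 mulr0.
- by rewrite !mevalD Eq Er mulrDr.
- by rewrite !mevalZ !mevalM !mevalXU; ring.
Qed.

End QuadraticForms.

Section QuadraticMaps.
Variable C : fieldType.
Variable F : 'I_3 -> {mpoly C[3]}.
Hypothesis hF : forall k, F k \is 2.-homog.
Notation i2 := (inord 2 : 'I_3).
Implicit Types x y : 'I_3 -> C.

Definition jac x : 'M[C]_3 := \matrix_(r, s) ((F r)^`M(s)).@[x].
Definition cvec x : 'cV[C]_3 := \col_k x k.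

Lemma Fev_polar x y k :
  Fev F (fun l => x l + y l) k = Fev F x k + Fev F y k + (jac x *m cvec y) k 0.
Proof.
rewrite /Fev hom2_polar // mxE; congr (_ + _).
by apply: eq_bigr => s _; rewrite !mxE.
Qed.

Lemma Fev_scale c x k : Fev F (fun l => c * x l) k = c ^+ 2 * Fev F x k.
Proof. by rewrite /Fev hom2_scale. Qed.

Lemma cvecZ c x : cvec (fun l => c * x l) = c *: cvec x.
Proof. by apply/colP => k; rewrite !mxE. Qed.

Lemma jac_sym x y : jac x *m cvec y = jac y *m cvec x.
Proof.
apply/colP => k; apply: (@addrI _ (Fev F x k + Fev F y k)).
rewrite -Fev_polar [Fev F x k + _]addrC -Fev_polar /Fev.
by apply: meval_eq => l; rewrite addrC.
Qed.

(** By [jac_sym] the scalar moves to the argument in which the matrix product is visibly linear. *)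
Lemma jac_scale c x : jac (fun l => c * x l) = c *: jac x.
Proof.
have E y : jac (fun l => c * x l) *m cvec y = c *: jac x *m cvec y.
  by rewrite jac_sym cvecZ -scalemxAr jac_sym -scalemxAl.
apply/matrixP => r s; have := congr1 (fun v : 'cV_3 => v r 0) (E (fun l => (l == s)%:R)).
rewrite !mxE (bigD1 s) //= big1 ?addr0; last by move=> l ls; rewrite !mxE (negPf ls) mulr0.
rewrite (bigD1 s) //= big1 ?addr0; last by move=> l ls; rewrite !mxE (negPf ls) mulr0.
by rewrite !mxE eqxx !mulr1.
Qed.

Lemma jac_euler x k : (jac x *m cvec x) k 0 = 2 * Fev F x k.
Proof.
have := Fev_polar x x k.
have -> : Fev F (fun l => x l + x l) k = Fev F (fun l => 2 * x l) k.
  by apply: meval_eq => l; ring.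
by rewrite Fev_scale => E; apply: (@addrI _ (Fev F x k + Fev F x k)); rewrite -E; ring.
Qed.

Lemma chart_neq0 x : nonzero3 x -> x (chart x) != 0.
Proof.
move=> [k xk]; rewrite /chart -[ord0]/(0 : 'I_3) inord_1.
case: ifP => // /negbFE/eqP x0; case: ifP => // /negbFE/eqP x1.
by case: (ord3P k) xk => [->|[->|->]] //; rewrite ?x0 ?x1 eqxx.
Qed.

Section FixedPoint.
Variables (x : 'I_3 -> C) (lam : C).
Hypotheses (xn : nonzero3 x) (ln : lam != 0).
Hypothesis fx : forall k, Fev F x k = lam * x k.
Notation J := (jac x).
Notation kx := (chart x).

Lemma IDfE r s : IDf F x r s = (r == s)%:R -
  (J (lift kx r) (lift kx s) - x (lift kx r) / x kx * J kx (lift kx s)) / lam.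
Proof.
have kn := chart_neq0 xn.
rewrite /IDf /= !mxE; congr (_ - _).
set q := fun m => x m / x kx.
have eq1 : q =1 (fun m => (x kx)^-1 * x m) by move=> m; rewrite /q mulrC.
have Fq k : (F k).@[q] = (x kx)^-1 ^+ 2 * (lam * x k).
  by rewrite (meval_eq _ eq1) -fx -Fev_scale.
have Dq k l : ((F k)^`M(l)).@[q] = (x kx)^-1 * ((F k)^`M(l)).@[x].
  rewrite (meval_eq _ eq1); have := congr1 (fun M : 'M_3 => M k l) (jac_scale (x kx)^-1 x).
  by rewrite !mxE.
rewrite mevalB !mevalM !Fq !Dq.
move: ((F (lift kx r))^`M(lift kx s)).@[x] ((F kx)^`M(lift kx s)).@[x] (x (lift kx r)) (x kx) kn => a b c d dn.
by field; rewrite ln dn.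
Qed.

Lemma euler_lam r : J r 0 * x 0 + J r 1 * x 1 + J r i2 * x i2 = 2 * lam * x r.
Proof. by have := jac_euler x r; rewrite fx mxE sum_ord3 !(mxE _ _ _ 0) mulrA. Qed.

(** By Euler's relation x is an eigenvector of J for 2 lam, and on the quotient of C^3 by x the
    matrix J induces lam Df. Hence tr J = 2 lam + lam tr Df. *)
Lemma trIDfE : trIDf F x = 4 - \tr J / lam.
Proof.
have kn := chart_neq0 xn; rewrite /trIDf mxtrace2E mxtrace3E !IDfE !eqxx !mulr1n.
have := (euler_lam 0, euler_lam 1, euler_lam i2).
move: (J) => A; case: (ord3P kx) kn => [|[|]] -> kn [[E0 E1] E2]; rewrite !ord3_lift.
- have -> : A 0 0 = 2 * lam - A 0 1 * x 1 / x 0 - A 0 i2 * x i2 / x 0.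
    by apply: (mulIf kn); rewrite !mulrBl !divfK // -E0; ring.
  by field; rewrite ln kn.
- have -> : A 1 1 = 2 * lam - A 1 0 * x 0 / x 1 - A 1 i2 * x i2 / x 1.
    by apply: (mulIf kn); rewrite !mulrBl !divfK // -E1; ring.
  by field; rewrite ln kn.
- have -> : A i2 i2 = 2 * lam - A i2 0 * x 0 / x i2 - A i2 1 * x 1 / x i2.
    by apply: (mulIf kn); rewrite !mulrBl !divfK // -E2; ring.
  by field; rewrite ln kn.
Qed.

(** On the span of x the matrix lam - J acts as - lam, and on the quotient as lam (I - Df); this
    accounts for the sign and the cube. *)
Lemma detIDfE : detIDf F x = - \det (lam%:M - J) / lam ^+ 3.
Proof.
have kn := chart_neq0 xn; rewrite /detIDf det2E !IDfE det3_char.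
rewrite !eqxx -[(1 : 'I_2) == 0]/false -[(0 : 'I_2) == 1]/false !mulr1n !mulr0n !sub0r.
have := (euler_lam 0, euler_lam 1, euler_lam i2).
move: (J) => A; case: (ord3P kx) kn => [|[|]] -> kn [[E0 E1] E2]; rewrite !ord3_lift.
- have e r : A r 0 * x 0 + A r 1 * x 1 + A r i2 * x i2 = 2 * lam * x r ->
      A r 0 = (2 * lam * x r - A r 1 * x 1 - A r i2 * x i2) / x 0.
    by move=> E; apply: (mulIf kn); rewrite divfK // -E; ring.
  by rewrite (e _ E0) (e _ E1) (e _ E2); field; rewrite ln kn.
- have e r : A r 0 * x 0 + A r 1 * x 1 + A r i2 * x i2 = 2 * lam * x r ->
      A r 1 = (2 * lam * x r - A r 0 * x 0 - A r i2 * x i2) / x 1.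
    by move=> E; apply: (mulIf kn); rewrite divfK // -E; ring.
  by rewrite (e _ E0) (e _ E1) (e _ E2); field; rewrite ln kn.
- have e r : A r 0 * x 0 + A r 1 * x 1 + A r i2 * x i2 = 2 * lam * x r ->
      A r i2 = (2 * lam * x r - A r 0 * x 0 - A r 1 * x 1) / x i2.
    by move=> E; apply: (mulIf kn); rewrite divfK // -E; ring.
  by rewrite (e _ E0) (e _ E1) (e _ E2); field; rewrite ln kn.
Qed.

(* The linear form a restricts to a left eigenvector of I - Df for the eigenvalue
   1 - mu / lam, transverse to the line. *)
Lemma tangent_eigenvalues (a : 'I_3 -> C) (u v mu : C) :
  nonzero3 a -> lin a x = 0 ->
  (forall s, \sum_r a r * J r s = mu * a s) ->
  tangent_eig F a x u -> u + v = trIDf F x ->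
  v = 1 - mu / lam /\ u = 3 - (\tr J - mu) / lam.
Proof.
move=> an ax aJ tu uv.
have kn := chart_neq0 xn.
suff ev : v = 1 - mu / lam.
  split=> //; have -> : u = trIDf F x - v by rewrite -uv addrK.
  by rewrite ev trIDfE; field.
pose M := IDf F x; pose b0 := a (lift kx 0); pose b1 := a (lift kx 1).
have ak : a kx * x kx = - (b0 * x (lift kx 0) + b1 * x (lift kx 1)).
  move: ax; rewrite /lin sum_ord3 /b0 /b1 => E; apply/eqP; rewrite -addr_eq0 -E; apply/eqP.
  by case: (ord3P kx) => [|[|]] ->; rewrite !ord3_lift; ring.
have bn : (b0 != 0) || (b1 != 0).
  apply: contraT; rewrite negb_or !negbK => /andP[/eqP z0 /eqP z1].
  move/eqP: ak; rewrite z0 z1 !mul0r addr0 oppr0 mulf_eq0 (negPf kn) orbF => /eqP zk.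
  case: an => k; move: zk z0 z1; rewrite /b0 /b1.
  by case: (ord3P kx) => [|[|]] ->; rewrite !ord3_lift => zk z0 z1;
    case: (ord3P k) => [|[|]] ->; rewrite ?zk ?z0 ?z1 eqxx.
have L s : b0 * M 0 s + b1 * M 1 s = (1 - mu / lam) * a (lift kx s).
  rewrite /M !IDfE; have := aJ (lift kx s); rewrite sum_ord3 => E.
  have E' : a kx * J kx (lift kx s) + b0 * J (lift kx 0) (lift kx s)
     + b1 * J (lift kx 1) (lift kx s) = mu * a (lift kx s).
    by rewrite -E /b0 /b1; case: (ord3P kx) => [|[|]] ->; rewrite !ord3_lift; ring.
  have ek : a kx = - (b0 * x (lift kx 0) + b1 * x (lift kx 1)) / x kx.
    by apply: (mulIf kn); rewrite divfK.
  rewrite (_ : (1 - mu / lam) * a (lift kx s) = a (lift kx s) - mu * a (lift kx s) / lam); last by ring.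
  rewrite -E' ek.
  have [-> | ->] : s = 0 \/ s = 1.
  - by case: (s) => [[|[|]]] //= i; [left | right]; apply: val_inj.
  - by rewrite eqxx -[(1 : 'I_2) == 0]/false mulr1n mulr0n -/b0; field; rewrite ln kn.
  - by rewrite eqxx -[(0 : 'I_2) == 1]/false mulr1n mulr0n -/b1; field; rewrite ln kn.
have tr : M 0 0 + M 1 1 = u + v.
  by rewrite uv /trIDf mxtrace2E.
have tuM : M *m tangent_vec a x = u *: tangent_vec a x := tu.
clearbody M.
have e1 : lift kx (inord 1) = lift kx (1 : 'I_2) by rewrite inord_1.
have T r : M r 0 * b1 - M r 1 * b0 = u * (if r == 0 then b1 else - b0).
  have := congr1 (fun N : 'cV_2 => N r 0) tuM.
  by rewrite !mxE sum_ord2 !mxE /= !e1 mulrN.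
have R0 := T 0; have R1 := T 1; rewrite /= in R0 R1.
have [L0 L1] := (L 0, L 1); rewrite -/b0 -/b1 in L0 L1.
set w := 1 - mu / lam in L0 L1 *.
(* The left eigenvector (b0, b1) annihilates the tangent vector (b1, - b0), so its eigenvalue w is
   the complementary one, tr M - u. *)
case/orP: bn => bn; apply: (mulIf bn).
- transitivity ((M 0 0 + M 1 1 - u) * b0); first by rewrite tr; ring.
  transitivity (M 0 0 * b0 + (M 1 1 * b0 - M 1 0 * b1 - u * b0) + M 1 0 * b1); first by ring.
  by rewrite -L0 (_ : M 1 1 * b0 = M 1 0 * b1 - u * - b0); [ring | rewrite -R1; ring].
- transitivity ((M 0 0 + M 1 1 - u) * b1); first by rewrite tr; ring.
  transitivity (M 1 1 * b1 + (M 0 0 * b1 - M 0 1 * b0 - u * b1) + M 0 1 * b0); first by ring.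
  by rewrite -L1 R0; ring.
Qed.

End FixedPoint.
End QuadraticMaps.

(** * The normal form and its spectra *)

Section NormalForm.
Variable C : fieldType.
Notation i2 := (inord 2 : 'I_3).
Notation j2 := (inord 2 : 'I_4).
Notation j3 := (inord 3 : 'I_4).

Definition basis_pt (j : 'I_3) : 'I_3 -> C := fun k => (k == j)%:R.
Definition vec3 (x0 x1 x2 : C) : 'I_3 -> C :=
  fun k => match val k with 0 => x0 | 1 => x1 | _ => x2 end.

Lemma vec3E (x0 x1 x2 : C) :
  (vec3 x0 x1 x2 0 = x0) * (vec3 x0 x1 x2 1 = x1) * (vec3 x0 x1 x2 i2 = x2).
Proof. by rewrite /vec3 /= inordK. Qed.

Lemma basis_ptE : (basis_pt 0 0 = 1) * (basis_pt 0 1 = 0) * (basis_pt 0 i2 = 0)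
  * (basis_pt 1 0 = 0) * (basis_pt 1 1 = 1) * (basis_pt 1 i2 = 0)
  * (basis_pt i2 0 = 0) * (basis_pt i2 1 = 0) * (basis_pt i2 i2 = 1).
Proof.
rewrite /basis_pt !eqxx -[(1 : 'I_3) == 0]/false -[(0 : 'I_3) == 1]/false.
have -> : i2 == 0 = false by rewrite -val_eqE /= inordK.
have -> : i2 == 1 = false by rewrite -val_eqE /= inordK.
by rewrite ![_ == i2]eq_sym -!val_eqE /= inordK.
Qed.

Variables (f : ('I_3 -> C) -> 'I_3 -> C) (J : ('I_3 -> C) -> 'M[C]_3).
Hypotheses (n2 : (2%:R : C) != 0)
  (Jsym : forall x y, J x *m cvec y = J y *m cvec x)
  (Jeuler : forall x k, (J x *m cvec x) k 0 = 2 * f x k).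
Variables (b1 b2 l1 l2 l3 : C).
Hypotheses (b1n : b1 != 0) (b2n : b2 != 0) (b4n : b1 + b2 + 1 != 0).
Hypotheses (f0 : forall k, f (basis_pt 0) k = basis_pt 0 k)
  (f1 : forall k, f (basis_pt 1) k = l1 * basis_pt 1 k)
  (f2 : forall k, f (basis_pt i2) k = l2 * basis_pt i2 k)
  (f3 : forall k, f (fun=> 1) k = l3).
Hypothesis fline : forall x, b1 * x 0 + b2 * x 1 + x i2 = 0 ->
  b1 * f x 0 + b2 * f x 1 + f x i2 = 0.

Lemma jac_entry x r s : J x r s =
  J (basis_pt s) r 0 * x 0 + J (basis_pt s) r 1 * x 1 + J (basis_pt s) r i2 * x i2.
Proof.
have := congr1 (fun v : 'cV_3 => v r 0) (Jsym x (basis_pt s)).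
rewrite !mxE (bigD1 s) //= big1 => [|i si].
  by rewrite mxE /basis_pt eqxx mulr1 addr0 => ->; rewrite sum_ord3 !mxE.
by rewrite mxE /basis_pt (negPf si) mulr0.
Qed.

Lemma jac_swap r s t : J (basis_pt s) r t = J (basis_pt t) r s.
Proof.
by rewrite jac_entry; case: (ord3P s) => [|[|]] ->; rewrite !basis_ptE !(mulr0, mulr1, addr0, add0r).
Qed.

Lemma jac_diag r s : J (basis_pt s) r s = 2 * f (basis_pt s) r.
Proof.
rewrite -Jeuler mxE sum_ord3 !(mxE _ _ _ 0).
by case: (ord3P s) => [|[|]] ->; rewrite !basis_ptE !(mulr0, mulr1, addr0, add0r).
Qed.

Lemma quad_euler x r : 2 * f x r = J x r 0 * x 0 + J x r 1 * x 1 + J x r i2 * x i2.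
Proof. by rewrite -Jeuler mxE sum_ord3 !(mxE _ _ _ 0). Qed.

(** The Jacobian matrix of m(x) x - N (x_2 x_3, x_3 x_1, x_1 x_2)^T. *)
Definition jD (D : datum C) (x : 'I_3 -> C) (r s : nat) : C :=
  match r, s with
  | 0, 0 => 2 * x 0 + (m2 D - n13 D) * x 1 + (m3 D - n12 D) * x i2
  | 0, 1 => (m2 D - n13 D) * x 0 - n11 D * x i2
  | 0, _ => (m3 D - n12 D) * x 0 - n11 D * x 1
  | 1, 0 => (1 - n23 D) * x 1 - n22 D * x i2
  | 1, 1 => (1 - n23 D) * x 0 + 2 * m2 D * x 1 + (m3 D - n21 D) * x i2
  | 1, _ => (m3 D - n21 D) * x 1 - n22 D * x 0
  | _, 0 => (1 - n32 D) * x i2 - n33 D * x 1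
  | _, 1 => (m2 D - n31 D) * x i2 - n33 D * x 0
  | _, _ => (1 - n32 D) * x 0 + (m2 D - n31 D) * x 1 + 2 * m3 D * x i2
  end.

(** Only an abstract quadratic map f with polar matrix J is used, so a conjugate of F can be
    inserted without computing its polynomials. The entries of N are read off the mixed coefficients
    of f. *)
Lemma normal_jac : exists D : datum C,
  [/\ a1 D = b1, a2 D = b2, m2 D = l1 & m3 D = l2] /\ m4 D = l3 /\
  forall x r s, J x r s = jD D x r s.
Proof.
pose c01 r := J (basis_pt 0) r 1; pose c02 r := J (basis_pt 0) r i2.
pose c12 r := J (basis_pt 1) r i2.
have Jx x r : [/\ J x r 0 = 2 * basis_pt 0 r * x 0 + c01 r * x 1 + c02 r * x i2,
    J x r 1 = c01 r * x 0 + 2 * l1 * basis_pt 1 r * x 1 + c12 r * x i2 &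
    J x r i2 = c02 r * x 0 + c12 r * x 1 + 2 * l2 * basis_pt i2 r * x i2].
  rewrite /c01 /c02 /c12; split; rewrite jac_entry jac_diag ?f0 ?f1 ?f2.
  - by ring.
  - by rewrite (jac_swap r 1 0); ring.
  - by rewrite (jac_swap r i2 0) (jac_swap r i2 1); ring.
have fx x r : f x r = basis_pt 0 r * x 0 ^+ 2 + l1 * basis_pt 1 r * x 1 ^+ 2
    + l2 * basis_pt i2 r * x i2 ^+ 2 + c01 r * x 0 * x 1 + c02 r * x 0 * x i2 + c12 r * x 1 * x i2.
  by apply: (mulfI n2); rewrite quad_euler; have [-> -> ->] := Jx x r; ring.
have s0 : c01 0 = l3 - 1 - c02 0 - c12 0.
  by rewrite -(f3 0) fx !basis_ptE; ring.
have s1 : c01 1 = l3 - l1 - c02 1 - c12 1.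
  by rewrite -(f3 1) fx !basis_ptE; ring.
have s2 : c01 i2 = l3 - l2 - c02 i2 - c12 i2.
  by rewrite -(f3 i2) fx !basis_ptE; ring.
(* The invariance of the line is tested at its intersections with the three coordinate lines; each
   test fixes one combination of mixed coefficients. *)
have q01 : b1 * c01 0 + b2 * c01 1 + c01 i2 = b2 + b1 * l1.
  have := fline (x := vec3 b2 (- b1) 0); rewrite !fx !vec3E !basis_ptE => /(_ ltac:(ring)) E.
  apply: (mulfI b1n); apply: (mulfI b2n).
  by apply/eqP; rewrite -subr_eq0 -oppr_eq0 -E; apply/eqP; ring.
have q02 : b1 * c02 0 + b2 * c02 1 + c02 i2 = 1 + b1 * l2.
  have := fline (x := vec3 1 0 (- b1)); rewrite !fx !vec3E !basis_ptE => /(_ ltac:(ring)) E.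
  apply: (mulfI b1n).
  by apply/eqP; rewrite -subr_eq0 -oppr_eq0 -E; apply/eqP; ring.
have q12 : b1 * c12 0 + b2 * c12 1 + c12 i2 = l1 + b2 * l2.
  have := fline (x := vec3 0 1 (- b2)); rewrite !fx !vec3E !basis_ptE => /(_ ltac:(ring)) E.
  apply: (mulfI b2n).
  by apply/eqP; rewrite -subr_eq0 -oppr_eq0 -E; apply/eqP; ring.
(* Applying the linear form of the line to f(1,1,1) in two ways gives b4 l3 = b4 (1 + l1 + l2),
   where b4 = b1 + b2 + 1 is nonzero as the fourth point is off the line. *)
have e3 : l3 = 1 + l1 + l2.
  apply: (mulfI b4n).
  transitivity (b1 * (1 + c01 0 + c02 0 + c12 0) + b2 * (l1 + c01 1 + c02 1 + c12 1)
     + (l2 + c01 i2 + c02 i2 + c12 i2)); first by rewrite s0 s1 s2; ring.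
  transitivity ((b1 * c01 0 + b2 * c01 1 + c01 i2) + (b1 * c02 0 + b2 * c02 1 + c02 i2)
     + (b1 * c12 0 + b2 * c12 1 + c12 i2) + b1 + b2 * l1 + l2); first by ring.
  by rewrite q01 q02 q12; ring.
exists (Datum b1 b2 l1 l2 (- c12 0) (l2 - c02 0) (l2 - c12 1) (- c02 1)).
split=> //; split; first by rewrite /m4 /= e3.
have p2 : c02 i2 = 1 + b1 * l2 - b1 * c02 0 - b2 * c02 1 by rewrite -q02; ring.
have p12 : c12 i2 = l1 + b2 * l2 - b1 * c12 0 - b2 * c12 1 by rewrite -q12; ring.
move=> x r s; have [E0 E1 E2] := Jx x r.
case: (ord3P s) => [|[|]] ->; rewrite ?E0 ?E1 ?E2;
case: (ord3P r) => [|[|]] ->; rewrite !basis_ptE ?inordK // ?s0 ?s1 ?s2 ?p2 ?p12 ?e3 /jD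
  /n13 /n23 /n31 /n32 /n33 /n13 /n23 /=; ring.
Qed.

End NormalForm.

Section NormalSpectrum.
Variable C : fieldType.
Notation i2 := (inord 2 : 'I_3).
Notation j2 := (inord 2 : 'I_4).
Notation j3 := (inord 3 : 'I_4).
Variables (D : datum C) (x : 'I_3 -> C) (M : 'M[C]_3).
Hypothesis ME : forall r s, M r s = jD D x r s.

Lemma spectrum_e1 : x =1 basis_pt C 0 ->
  4 - \tr M / 1 = tD D 0 /\ - \det (1%:M - M) / 1 ^+ 3 = dD D 0.
Proof.
move=> xE; rewrite mxtrace3E det3_char !ME /jD !inordK //= !xE !basis_ptE /tD /dD /=.
rewrite /T1 /cN /n13 /n23 /n31 /n32 /n33 /n13 /n23.
by rewrite !expr1n !divr1; split; ring.
Qed.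

Lemma spectrum_e2 : m2 D != 0 -> x =1 basis_pt C 1 ->
  4 - \tr M / m2 D = tD D 1 /\ - \det ((m2 D)%:M - M) / m2 D ^+ 3 = dD D 1.
Proof.
move=> mn xE; rewrite mxtrace3E det3_char !ME /jD !inordK //= !xE !basis_ptE /tD /dD /=.
rewrite /T2 /cN /n13 /n23 /n31 /n32 /n33 /n13 /n23.
by split; field.
Qed.

Lemma spectrum_e3 : m3 D != 0 -> x =1 basis_pt C i2 ->
  4 - \tr M / m3 D = tD D j2 /\ - \det ((m3 D)%:M - M) / m3 D ^+ 3 = dD D j2.
Proof.
move=> mn xE; rewrite mxtrace3E det3_char !ME /jD !inordK //= !xE !basis_ptE /tD /dD /= !inordK //=.
rewrite /T3 /cN /n13 /n23 /n31 /n32 /n33 /n13 /n23.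
by split; field.
Qed.

Lemma spectrum_e4 : m4 D != 0 -> x =1 (fun=> 1) ->
  4 - \tr M / m4 D = tD D j3 /\ - \det ((m4 D)%:M - M) / m4 D ^+ 3 = dD D j3.
Proof.
move=> mn xE; rewrite mxtrace3E det3_char !ME /jD !inordK //= !xE /tD /dD /= !inordK //=.
rewrite /T4 /cN /a4 /n13 /n23 /n31 /n32 /n33 /n13 /n23.
move: mn; rewrite /m4 => mn.
by split; field.
Qed.

(** The normal form satisfies a(F) = m a for the form a of the line. Differentiating where a = 0
    gives the left eigenvector (a_1, a_2, 1) of M with eigenvalue m(x). *)
Lemma spectrum_line (mu : C) (fx : 'I_3 -> C) : (2%:R : C) != 0 -> mu != 0 ->
  a1 D * x 0 + a2 D * x 1 + x i2 = 0 ->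
  (forall r, 2 * fx r = M r 0 * x 0 + M r 1 * x 1 + M r i2 * x i2) ->
  (forall r, fx r = mu * x r) ->
  let kap := mD D (x 0) (x 1) - mu in
  [/\ Y0 D (x 0) (x 1) = kap * x 0, Y1 D (x 0) (x 1) = kap * x 1,
    3 - (\tr M - mD D (x 0) (x 1)) / mu = uD D (x 0) (x 1) kap &
    1 - mD D (x 0) (x 1) / mu = vD D (x 0) (x 1) kap] /\
  forall s, a1 D * M 0 s + a2 D * M 1 s + M i2 s =
    mD D (x 0) (x 1) * match val s with 0 => a1 D | 1 => a2 D | _ => 1 end.
Proof.
move=> n2 mn xl fE fm kap.
have x2 : x i2 = - a1 D * x 0 - a2 D * x 1.
  by rewrite -[RHS]addr0 -xl; ring.
have E0 := fE 0; have E1 := fE 1.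
rewrite !fm !ME inordK //= x2 in E0 E1.
split; last first.
  move=> s; rewrite !ME; case: (ord3P s) => [|[|]] ->; rewrite /= ?inordK //= x2 /mD
    /n13 /n23 /n31 /n32 /n33 /n13 /n23; ring.
rewrite /uD /vD (_ : kap - mD D (x 0) (x 1) = - mu); last by rewrite /kap; move: (mD _ _ _) => m; ring.
rewrite (_ : mD D (x 0) (x 1) - kap = mu); last by rewrite /kap; move: (mD _ _ _) => m; ring.
split.
- apply: (mulfI n2); rewrite (_ : 2 * (kap * x 0) = 2 * mD D (x 0) (x 1) * x 0 - 2 * (mu * x 0)).
    by rewrite E0 /Y0 /mD /n13; ring.
  by rewrite /kap; move: (mD _ _ _) => m; ring.
- apply: (mulfI n2); rewrite (_ : 2 * (kap * x 1) = 2 * mD D (x 0) (x 1) * x 1 - 2 * (mu * x 1)).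
    by rewrite E1 /Y1 /mD /n23; ring.
  by rewrite /kap; move: (mD _ _ _) => m; ring.
- rewrite mxtrace3E !ME inordK //= x2 /kap /trY /T1 /T2 /T3 /mD /n13 /n23 /n31 /n32 /n33 /n13 /n23.
  by field.
- by rewrite /kap; move: (mD _ _ _) => m; field; rewrite oppr_eq0 mn.
Qed.

End NormalSpectrum.

(** * Factoring binary forms with given roots *)

Section BinaryForms.
Variable C : fieldType.
Implicit Types y z : C.

(** This and the next two lemmas divide a binary form by the linear form vanishing at (y : z); which
    coefficient can be solved for depends on the nonzero coordinate. *)
Lemma binary_root1 y z (l0 l1 : C) : y != 0 \/ z != 0 -> l0 * y + l1 * z = 0 ->
  exists k, l0 = k * z /\ l1 = - k * y.
Proof.
move=> nz E; case: nz => nz.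
- exists (- l1 / y); split; last by field.
  by apply: (mulIf nz); apply/eqP; rewrite -subr_eq0 -E; apply/eqP; field.
- exists (l0 / z); split; first by field.
  by apply: (mulIf nz); apply/eqP; rewrite -subr_eq0 -E; apply/eqP; field.
Qed.

Lemma binary_root2 y z (q0 q1 q2 : C) : y != 0 \/ z != 0 ->
  q0 * y ^+ 2 + q1 * y * z + q2 * z ^+ 2 = 0 ->
  exists l0 l1, [/\ q0 = z * l0, q1 = z * l1 - y * l0 & q2 = - y * l1].
Proof.
move=> nz E; case: nz => nz.
- pose l1 := - q2 / y; pose l0 := (z * l1 - q1) / y.
  exists l0, l1; split; rewrite /l0 /l1; [|by field|by field].
  apply: (mulIf (expf_neq0 2 nz)); apply/eqP; rewrite -subr_eq0 -E; apply/eqP; by field.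
- pose l0 := q0 / z; pose l1 := (q1 + y * l0) / z.
  exists l0, l1; split; rewrite /l1 /l0; [by field|by field|].
  apply: (mulIf (expf_neq0 2 nz)); apply/eqP; rewrite -subr_eq0 -E; apply/eqP; by field.
Qed.

Lemma binary_root3 y z (c0 c1 c2 c3 : C) : y != 0 \/ z != 0 ->
  c0 * y ^+ 3 + c1 * y ^+ 2 * z + c2 * y * z ^+ 2 + c3 * z ^+ 3 = 0 ->
  exists q0 q1 q2, [/\ c0 = z * q0, c1 = z * q1 - y * q0, c2 = z * q2 - y * q1 & c3 = - y * q2].
Proof.
move=> nz E; case: nz => nz.
- pose q2 := - c3 / y; pose q1 := (z * q2 - c2) / y; pose q0 := (z * q1 - c1) / y.
  exists q0, q1, q2; split; rewrite /q0 /q1 /q2; [|by field|by field|by field].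
  apply: (mulIf (expf_neq0 3 nz)); apply/eqP; rewrite -subr_eq0 -E; apply/eqP; by field.
- pose q0 := c0 / z; pose q1 := (c1 + y * q0) / z; pose q2 := (c2 + y * q1) / z.
  exists q0, q1, q2; split; rewrite /q2 /q1 /q0; [by field|by field|by field|].
  apply: (mulIf (expf_neq0 3 nz)); apply/eqP; rewrite -subr_eq0 -E; apply/eqP; by field.
Qed.

Lemma binary_cubic (y z : 'I_3 -> C) (c0 c1 c2 c3 : C) :
  (forall j, y j != 0 \/ z j != 0) ->
  (forall i j, i != j -> y i * z j != y j * z i) ->
  (forall j, c0 * y j ^+ 3 + c1 * y j ^+ 2 * z j + c2 * y j * z j ^+ 2 + c3 * z j ^+ 3 = 0) ->
  let i2 : 'I_3 := inord 2 in
  exists k, [/\ c0 = k * (z 0 * z 1 * z i2),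
    c1 = - k * (y 0 * z 1 * z i2 + z 0 * y 1 * z i2 + z 0 * z 1 * y i2),
    c2 = k * (y 0 * y 1 * z i2 + y 0 * z 1 * y i2 + z 0 * y 1 * y i2) &
    c3 = - k * (y 0 * y 1 * y i2)].
Proof.
move=> nz ne E i2.
have n02 : (0 : 'I_3) != i2 by rewrite -val_eqE /= inordK.
have n12 : (1 : 'I_3) != i2 by rewrite -val_eqE /= inordK.
have [q0 [q1 [q2 [e0 e1 e2 e3]]]] := binary_root3 (nz 0) (E 0).
have V j : y j * z 0 != y 0 * z j -> q0 * y j ^+ 2 + q1 * y j * z j + q2 * z j ^+ 2 = 0.
  rewrite -subr_eq0 => h; apply: (mulfI h); rewrite mulr0 -(E j) e0 e1 e2 e3; ring.
have [l0 [l1 [f0 f1 f2]]] := binary_root2 (nz 1) (V 1 (ne 1 0 isT)).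
have W : l0 * y i2 + l1 * z i2 = 0.
  have h : y i2 * z 1 - y 1 * z i2 != 0 by rewrite subr_eq0; apply: ne; rewrite eq_sym.
  apply: (mulfI h); rewrite mulr0 -(V i2); last by apply: ne; rewrite eq_sym.
  by rewrite f0 f1 f2; ring.
have [k [g0 g1]] := binary_root1 (nz i2) W.
by exists k; rewrite e0 e1 e2 e3 f0 f1 f2 g0 g1; split; ring.
Qed.

End BinaryForms.

(** * General position of the four points *)

Section Frame.
Variable C : numFieldType.
Variables (F : 'I_3 -> {mpoly C[3]}) (a : 'I_3 -> C) (p : 'I_7 -> 'I_3 -> C).
Hypothesis HE : isE4 F a p.
Notation i2 := (inord 2 : 'I_3).

Lemma E4_homog k : F k \is 2.-homog. Proof. by case: HE => -[]. Qed.

Lemma E4_multiplier i : exists2 lam, lam != 0 & forall k, Fev F (p i) k = lam * p i k.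
Proof.
case: HE => -[_ _ nd] [_ [fx _ _ _ _]]; have [[k pk] [lam E]] := fx i.
exists lam => //; apply: contra_neq pk => l0; apply: nd => l.
by rewrite E l0 mul0r.
Qed.

Lemma E4_nonzero i : nonzero3 (p i).
Proof. by case: HE => _ [_ [fx _ _ _ _]]; have [] := fx i. Qed.

Lemma E4_distinct i j c : (forall k, p i k = c * p j k) -> i = j.
Proof.
case: HE => _ [_ [_ _ inj _ _]] E; apply: inj; exists c; split=> //.
have [k pk] := E4_nonzero i.
by apply: contra_neq pk => c0; rewrite E c0 mul0r.
Qed.

Lemma lin_lin c d x y : lin a (fun k => c * x k + d * y k) = c * lin a x + d * lin a y.
Proof. by rewrite /lin !sum_ord3; ring. Qed.

Lemma lin_ext x y : x =1 y -> lin a x = lin a y.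
Proof. by move=> xy; rewrite /lin; apply: eq_bigr => k _; rewrite xy. Qed.

Lemma Fev_ext x y k : x =1 y -> Fev F x k = Fev F y k.
Proof. exact: meval_eq. Qed.

Lemma det_kernel (M : 'M[C]_3) (w : 'cV_3) : M *m w = 0 -> w != 0 -> \det M = 0.
Proof.
move=> Mw; apply: contra_neq_eq => dM.
have uM : M \in unitmx by rewrite unitmxE unitfE.
by rewrite -[w](mulKmx uM) Mw mulmx0.
Qed.

(* If p_k = al p_i + be p_j, invariance of the line a = 0 makes F act on the
   span of p_i and p_j as multiplication by a linear form, so the fixed point p_i
   is degenerate. *)
Lemma E4_no_collinear (i j k : 'I_7) al be :
  (i < 4)%N -> (j < 4)%N -> (k < 4)%N -> i != j -> i != k -> j != k ->
  (forall l, p k l = al * p i l + be * p j l) -> False.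
Proof.
move=> i4 j4 k4 nij nik njk E.
have [al0|aln] := eqVneq al 0.
  by move/eqP: njk; apply; apply/esym/(@E4_distinct _ _ be) => l; rewrite E al0 mul0r add0r.
have [be0|ben] := eqVneq be 0.
  by move/eqP: nik; apply; apply/esym/(@E4_distinct _ _ al) => l; rewrite E be0 mul0r addr0.
have [li lin0 Ei] := E4_multiplier i; have [lj ljn0 Ej] := E4_multiplier j.
have [lk _ Ek] := E4_multiplier k.
have hF := E4_homog.
have [_ [Hl [_ _ _ off nd]]] := HE.
have An : [/\ lin a (p i) != 0, lin a (p j) != 0 & lin a (p k) != 0] by rewrite -!off.
have [Ai Aj Ak] := An.
pose B l := (jac F (p i) *m cvec (p j)) l 0.
have FB c d l : Fev F (fun m => c * p i m + d * p j m) l =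
    c ^+ 2 * li * p i l + d ^+ 2 * lj * p j l + c * d * B l.
  rewrite Fev_polar // !Fev_scale // Ei Ej jac_scale // cvecZ -scalemxAl -scalemxAr scalerA.
  by rewrite mxE /B; ring.
pose s := (lk - al * li) / be; pose t := (lk - be * lj) / al.
have Bst l : B l = s * p i l + t * p j l.
  have := Ek l; rewrite (Fev_ext l E) FB E => H.
  apply: (mulfI aln); apply: (mulfI ben); apply/eqP; rewrite -subr_eq0; apply/eqP.
  transitivity (al ^+ 2 * li * p i l + be ^+ 2 * lj * p j l + al * be * B l
     - lk * (al * p i l + be * p j l)); last by rewrite H subrr.
  by rewrite /s /t; field; rewrite aln ben.
(* [om] is the obstruction to F acting on the span of p_i, p_j as multiplication by the form c li +
   d lj. It is killed by evaluating F where that span meets the line a = 0. *)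
pose om := lk - al * li - be * lj.
have om0 : om = 0.
  have H0 := Hl (fun m => lin a (p j) * p i m + (- lin a (p i)) * p j m).
  have {H0} : lin a (Fev F (fun m => lin a (p j) * p i m + (- lin a (p i)) * p j m)) = 0.
    by apply: H0; rewrite lin_lin; ring.
  rewrite (lin_ext (y := fun l => (lin a (p j) ^+ 2 * li - lin a (p j) * lin a (p i) * s) * p i l
     + (lin a (p i) ^+ 2 * lj - lin a (p j) * lin a (p i) * t) * p j l)); last first.
    by move=> l; rewrite FB Bst; ring.
  rewrite lin_lin => H0.
  have Ek' : lin a (p k) = al * lin a (p i) + be * lin a (p j) by rewrite (lin_ext E) lin_lin.
  move: Ai Aj Ak H0; rewrite Ek'; move: (lin a (p i)) (lin a (p j)) => A B' A0n Bn Kn H0.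
  have nn : A * B' * (al * A + be * B') != 0 by rewrite !mulf_neq0.
  apply: (mulfI nn); rewrite mulr0.
  transitivity (- (al * be) * ((B' ^+ 2 * li - B' * A * s) * A + (A ^+ 2 * lj - B' * A * t) * B')).
    by rewrite /om /s /t; field; rewrite aln ben.
  by rewrite H0 mulr0.
have es : s = lj by apply: (mulIf ben); rewrite /s divfK //; apply/eqP; rewrite -subr_eq0 -om0; apply/eqP; rewrite /om; ring.
have et : t = li by apply: (mulIf aln); rewrite /t divfK //; apply/eqP; rewrite -subr_eq0 -om0; apply/eqP; rewrite /om; ring.
have := nd i; rewrite (detIDfE hF (E4_nonzero i) lin0 Ei).
(* li p_j - lj p_i is the zero of the linear form c li + d lj; it lies in the kernel of li - J at
   p_i, which makes the determinant of I - Df vanish. *)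
rewrite (@det_kernel _ (li *: cvec (p j) - lj *: cvec (p i))) ?oppr0 ?mul0r ?eqxx //.
  rewrite mulmxBl mul_scalar_mx mulmxBr -!scalemxAr.
  have -> : jac F (p i) *m cvec (p j) = lj *: cvec (p i) + li *: cvec (p j).
    by apply/colP => l; have := Bst l; rewrite /B es et => ->; rewrite !mxE.
  have -> : jac F (p i) *m cvec (p i) = (2 * li) *: cvec (p i).
    by apply/colP => l; rewrite jac_euler // Ei !mxE mulrA.
  by apply/colP => l; rewrite !mxE; ring.
apply/eqP => /colP H; move/eqP: nij; apply; apply/esym/(@E4_distinct _ _ (lj / li)) => l.
have := H l; rewrite !mxE => /eqP; rewrite subr_eq0 => /eqP Hl'.
by apply: (mulfI lin0); rewrite Hl' mulrA mulrCA divff // mulr1.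
Qed.

End Frame.

Section LineScaling.
Variables (K : fieldType) (D : datum K) (s y z kap : K).

Lemma Y0_scale : Y0 D (s * y) (s * z) = s ^+ 2 * Y0 D y z.
Proof. by rewrite /Y0; ring. Qed.

Lemma Y1_scale : Y1 D (s * y) (s * z) = s ^+ 2 * Y1 D y z.
Proof. by rewrite /Y1; ring. Qed.

Lemma mD_scale : mD D (s * y) (s * z) = s * mD D y z.
Proof. by rewrite /mD; ring. Qed.

Lemma uD_hom : s != 0 -> mD D y z - kap != 0 ->
  uD D (s * y) (s * z) (s * kap) = uD D y z kap /\ vD D (s * y) (s * z) (s * kap) = vD D y z kap.
Proof.
move=> sn h; have h' : kap - mD D y z != 0 by rewrite -opprB oppr_eq0.
rewrite /uD /vD mD_scale (_ : trY D (s * y) (s * z) = s * trY D y z); last first.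
  by rewrite /trY; move: (T1 D) (T2 D) (T3 D) => *; ring.
move: (mD D y z) (trY D y z) h h' => m t h h'.
rewrite -!mulrBr (_ : s * t - 3 * (s * kap) = s * (t - 3 * kap)); last by ring.
by split; rewrite -mulf_div divff // mul1r.
Qed.

End LineScaling.

(** * Every map in E^(4) comes from the parametrisation *)

Section E4NormalForm.
Variable C : numFieldType.
Variables (F : 'I_3 -> {mpoly C[3]}) (a : 'I_3 -> C) (p : 'I_7 -> 'I_3 -> C).
Hypothesis HE : isE4 F a p.
Notation i2 := (inord 2 : 'I_3).
Notation j2 := (inord 2 : 'I_4).
Notation j3 := (inord 3 : 'I_4).
Notation off i := (lshift 3 (i : 'I_4)).
Let hF := E4_homog HE.

Lemma td_scale (x : 'I_3 -> C) lam c : nonzero3 x -> lam != 0 ->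
  (forall k, Fev F x k = lam * x k) -> c != 0 ->
  trIDf F (fun k => c * x k) = trIDf F x /\ detIDf F (fun k => c * x k) = detIDf F x.
Proof.
move=> xn ln fx cn.
have xn' : nonzero3 (fun k => c * x k) by case: xn => k xk; exists k; rewrite mulf_neq0.
have ln' : c * lam != 0 by rewrite mulf_neq0.
have fx' k : Fev F (fun k => c * x k) k = c * lam * (c * x k) by rewrite Fev_scale // fx; ring.
rewrite !(trIDfE hF xn' ln' fx', detIDfE hF xn' ln' fx', trIDfE hF xn ln fx, detIDfE hF xn ln fx).
rewrite jac_scale // mxtraceZ.
have -> : (c * lam)%:M - c *: jac F x = c *: (lam%:M - jac F x).
  by rewrite scalerBr scale_scalar_mx.
by rewrite detZ; split; field; rewrite cn ln.
Qed.

Lemma E4_frame : exists c : 'I_3 -> C, (forall s, c s != 0) /\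
  let g : 'M[C]_3 := \matrix_(r, s) (c s * p (off (inord s)) r) in
  g \in unitmx /\ forall r, p (off j3) r = \sum_s g r s.
Proof.
pose G : 'M[C]_3 := \matrix_(r, s) p (off (inord s)) r.
have GE (v : 'cV_3) r : (G *m v) r 0 = p (off 0) r * v 0 0 + p (off 1) r * v 1 0 + p (off j2) r * v i2 0.
  by rewrite mxE sum_ord3 !mxE /= inord_0 inord_1 inordK.
have ne (i j : 'I_4) : i != j -> off i != off j by rewrite (inj_eq (@lshift_inj _ _)).
have n4 (i : 'I_4) : (off i < 4)%N by exact: (ltn_ord i).
have n01 : (0 : 'I_4) != 1 by [].
have n02 : (0 : 'I_4) != j2 by rewrite -val_eqE /= inordK.
have n12 : (1 : 'I_4) != j2 by rewrite -val_eqE /= inordK.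
have n03 : (0 : 'I_4) != j3 by rewrite -val_eqE /= inordK.
have n13 : (1 : 'I_4) != j3 by rewrite -val_eqE /= inordK.
have n23 : j2 != j3 by rewrite -val_eqE /= !inordK.
have ncol (i j k : 'I_4) al be : i != j -> i != k -> j != k ->
    ~ forall l, p (off k) l = al * p (off i) l + be * p (off j) l.
  by move=> ij ik jk; apply: (E4_no_collinear HE) => //; apply: ne.
have uG : G \in unitmx.
  rewrite -unitmx_tr unitmxE unitfE; apply/negP => /eqP/eqP/det0P[v vn vG].
  have E r : p (off 0) r * v 0 0 + p (off 1) r * v 0 1 + p (off j2) r * v 0 i2 = 0.
    have := GE v^T r; rewrite !mxE => <-.
    by have := congr1 (fun w : 'rV_3 => w 0 r) vG; rewrite !mxE => H; rewrite -[RHS]H;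
      apply: eq_bigr => s _; rewrite !mxE mulrC.
  have [z2|z2] := eqVneq (v 0 i2) 0; last first.
    apply: (ncol 0 1 j2 (- v 0 0 / v 0 i2) (- v 0 1 / v 0 i2)) => // l.
    by apply: (mulIf z2); apply/eqP; rewrite -subr_eq0 -(E l); apply/eqP; field.
  have [z1|z1] := eqVneq (v 0 1) 0; last first.
    apply: (ncol 0 j2 1 (- v 0 0 / v 0 1) (- v 0 i2 / v 0 1)) => //; first by rewrite eq_sym.
    by move=> l; apply: (mulIf z1); apply/eqP; rewrite -subr_eq0 -(E l); apply/eqP; field.
  have [z0|z0] := eqVneq (v 0 0) 0; last first.
    apply: (ncol 1 j2 0 (- v 0 1 / v 0 0) (- v 0 i2 / v 0 0)) => //; first by rewrite eq_sym.
    by move=> l; apply: (mulIf z0); apply/eqP; rewrite -subr_eq0 -(E l); apply/eqP; field.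
  move/eqP: vn; apply; apply/rowP => s; rewrite mxE.
  by case: (ord3P s) => [|[|]] ->.
pose c s := (invmx G *m cvec (p (off j3))) s 0.
have Ec r : p (off j3) r = p (off 0) r * c 0 + p (off 1) r * c 1 + p (off j2) r * c i2.
  by rewrite -GE mulKVmx // mxE.
have cn s : c s != 0.
  apply/negP => /eqP c0; case: (ord3P s) c0 => [|[|]] -> c0.
  - by apply: (ncol 1 j2 j3 (c 1) (c i2)) => // l; rewrite Ec c0; ring.
  - by apply: (ncol 0 j2 j3 (c 0) (c i2)) => // l; rewrite Ec c0; ring.
  - by apply: (ncol 0 1 j3 (c 0) (c 1)) => // l; rewrite Ec c0; ring.
exists c; split=> //=.
set g := \matrix_(r, s) _; have -> : g = G *m diag_mx (\row_s c s).
  by apply/matrixP => r s; rewrite mul_mx_diag !mxE mulrC.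
split.
  rewrite unitmx_mul uG unitmxE det_diag unitfE /=.
  by apply/prodf_neq0 => s _; rewrite mxE.
move=> r; rewrite Ec sum_ord3 !mul_mx_diag !mxE /= inord_0 inord_1 inordK //.
Qed.

Lemma E4_normal_form (u v : 'I_3 -> C) :
  (forall j : 'I_3, [/\ tangent_eig F a (p (rshift 4 j)) (u j),
                        u j + v j = trIDf F (p (rshift 4 j)) &
                        u j * v j = detIDf F (p (rshift 4 j))]) ->
  exists th kap, good th kap /\
  let D := param th in
  [/\ spec_t F p = tD D, spec_d F p = dD D,
    u = (fun j : 'I_3 => uD D (th (inord (4 + j))) (th (inord (7 + j))) (kap j)) &
    v = (fun j : 'I_3 => vD D (th (inord (4 + j))) (th (inord (7 + j))) (kap j))].
Proof.
move=> Huv.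
have [[an _ _] [Hl [_ _ _ offl nd]]] := HE.
have [c [cn [ug p3E]]] := E4_frame.
set g := \matrix_(r, s) _ in ug p3E.
pose gp (X : 'I_3 -> C) : 'I_3 -> C := fun r => (g *m cvec X) r 0.
have cgp X : cvec (gp X) = g *m cvec X by apply/colP => r; rewrite mxE.
have gpE X r : gp X r = c 0 * p (off 0) r * X 0 + c 1 * p (off 1) r * X 1
    + c i2 * p (off j2) r * X i2.
  by rewrite /gp mxE sum_ord3 !mxE /= inord_0 inord_1 inordK.
have gp0 : gp (basis_pt C 0) =1 fun r => c 0 * p (off 0) r.
  by move=> r; rewrite gpE !basis_ptE; ring.
have gp1 : gp (basis_pt C 1) =1 fun r => c 1 * p (off 1) r.
  by move=> r; rewrite gpE !basis_ptE; ring.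
have gp2 : gp (basis_pt C i2) =1 fun r => c i2 * p (off j2) r.
  by move=> r; rewrite gpE !basis_ptE; ring.
have gp3 : gp (fun=> 1) =1 p (off j3).
  by move=> r; rewrite p3E sum_ord3 gpE !mxE /= inord_0 inord_1 inordK //; ring.
have [t0 t0n E0] := E4_multiplier HE (off 0); have [t1 t1n E1] := E4_multiplier HE (off 1).
have [t2 t2n E2] := E4_multiplier HE (off j2); have [t3 t3n E3] := E4_multiplier HE (off j3).
pose L0 := c 0 * t0.
have L0n : L0 != 0 by rewrite mulf_neq0.
(* Division by [L0] makes the multiplier at e_1 equal to one, that is, the coefficient of X_1 in
   m. *)
pose f X k := L0^-1 * (invmx g *m cvec (Fev F (gp X))) k 0.
pose J X : 'M[C]_3 := L0^-1 *: (invmx g *m jac F (gp X) *m g).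
have Jsym X Y : J X *m cvec Y = J Y *m cvec X.
  by rewrite /J -!scalemxAl -!mulmxA -!cgp (jac_sym hF).
have Jeuler X k : (J X *m cvec X) k 0 = 2 * f X k.
  rewrite /J -!scalemxAl -!mulmxA -cgp.
  have -> : jac F (gp X) *m cvec (gp X) = 2 *: cvec (Fev F (gp X)).
    by apply/colP => l; rewrite (jac_euler hF) !mxE.
  by rewrite -scalemxAr /f mxE [in LHS]mxE mulrCA.
have ffix X mu : (forall k, Fev F (gp X) k = mu * gp X k) -> forall k, f X k = mu / L0 * X k.
  move=> H k; rewrite /f (_ : cvec (Fev F (gp X)) = mu *: cvec (gp X)); last first.
    by apply/colP => l; rewrite !mxE H.
  by rewrite cgp -scalemxAr mulKmx // !mxE mulrA [_ / L0]mulrC.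
have Fg0 k : Fev F (gp (basis_pt C 0)) k = L0 * gp (basis_pt C 0) k.
  by rewrite (Fev_ext F _ gp0) gp0 (Fev_scale hF) E0 /L0; ring.
have Fg1 k : Fev F (gp (basis_pt C 1)) k = c 1 * t1 * gp (basis_pt C 1) k.
  by rewrite (Fev_ext F _ gp1) gp1 (Fev_scale hF) E1; ring.
have Fg2 k : Fev F (gp (basis_pt C i2)) k = c i2 * t2 * gp (basis_pt C i2) k.
  by rewrite (Fev_ext F _ gp2) gp2 (Fev_scale hF) E2; ring.
have Fg3 k : Fev F (gp (fun=> 1)) k = t3 * gp (fun=> 1) k.
  by rewrite (Fev_ext F _ gp3) gp3 E3.
have fJ X k : L0 * gp (f X) k = Fev F (gp X) k.
  rewrite /gp (_ : cvec (f X) = L0^-1 *: (invmx g *m cvec (Fev F (gp X)))); last first.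
    by apply/colP => l; rewrite mxE /f [RHS]mxE.
  by rewrite -scalemxAr mulKVmx // !mxE mulVKf.
pose A0 := c 0 * lin a (p (off 0)); pose A1 := c 1 * lin a (p (off 1)).
pose A2 := c i2 * lin a (p (off j2)).
have linA X : lin a (gp X) = A0 * X 0 + A1 * X 1 + A2 * X i2.
  rewrite (lin_ext _ (gpE X)) /A0 /A1 /A2 /lin !sum_ord3; ring.
have offn (i : 'I_4) : lin a (p (off i)) != 0 by rewrite -offl; exact: (ltn_ord i).
have A0n : A0 != 0 by rewrite mulf_neq0.
have A1n : A1 != 0 by rewrite mulf_neq0.
have A2n : A2 != 0 by rewrite mulf_neq0.
pose b1 := A0 / A2; pose b2 := A1 / A2.
have b1n : b1 != 0 by rewrite mulf_neq0 ?invr_eq0.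
have b2n : b2 != 0 by rewrite mulf_neq0 ?invr_eq0.
have b4n : b1 + b2 + 1 != 0.
  have := offn j3; rewrite -(lin_ext _ gp3) linA !mulr1 => H.
  by rewrite (_ : b1 + b2 + 1 = (A0 + A1 + A2) / A2) ?mulf_neq0 ?invr_eq0 // /b1 /b2; field.
have linb X : lin a (gp X) = A2 * (b1 * X 0 + b2 * X 1 + X i2).
  by rewrite linA /b1 /b2; field.
have fline X : b1 * X 0 + b2 * X 1 + X i2 = 0 -> b1 * f X 0 + b2 * f X 1 + f X i2 = 0.
  move=> H; have := Hl (gp X); rewrite linb H mulr0 => /(_ erefl).
  rewrite (lin_ext (y := fun k => L0 * gp (f X) k + 0 * 0) a); last first.
    by move=> k; rewrite mul0r addr0 fJ.
  rewrite (lin_lin a L0 0 (gp (f X)) (fun=> 0)) mul0r addr0 linb => H'.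
  by apply: (mulfI A2n); apply: (mulfI L0n); rewrite H' !mulr0.
pose l1 := c 1 * t1 / L0; pose l2 := c i2 * t2 / L0; pose l3 := t3 / L0.
have l1n : l1 != 0 by rewrite !mulf_neq0 ?invr_eq0.
have l2n : l2 != 0 by rewrite !mulf_neq0 ?invr_eq0.
have l3n : l3 != 0 by rewrite !mulf_neq0 ?invr_eq0.
have n2 : (2%:R : C) != 0 by rewrite pnatr_eq0.
have f0 k : f (basis_pt C 0) k = basis_pt C 0 k by rewrite (ffix _ _ Fg0) divff // mul1r.
have f1 k : f (basis_pt C 1) k = l1 * basis_pt C 1 k by rewrite (ffix _ _ Fg1).
have f2 k : f (basis_pt C i2) k = l2 * basis_pt C i2 k by rewrite (ffix _ _ Fg2).
have f3 k : f (fun=> 1) k = l3 by rewrite (ffix _ _ Fg3) mulr1.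
have [D [[eb1 eb2 em2 em3] [em4 JD]]] :=
  normal_jac n2 Jsym Jeuler b1n b2n b4n f0 f1 f2 f3 fline.
(* Conjugating by g and dividing by [L0] leaves I - Df unchanged up to similarity; only the
   multiplier mu becomes mu / L0. *)
have TD X mu : nonzero3 (gp X) -> mu != 0 -> (forall k, Fev F (gp X) k = mu * gp X k) ->
   trIDf F (gp X) = 4 - \tr (J X) / (mu / L0) /\
   detIDf F (gp X) = - \det ((mu / L0)%:M - J X) / (mu / L0) ^+ 3.
  move=> Xn mn H; rewrite (trIDfE hF Xn mn H) (detIDfE hF Xn mn H).
  have -> : \tr (J X) = L0^-1 * \tr (jac F (gp X)).
    by rewrite /J mxtraceZ mxtrace_mulC mulmxA mulmxV // mul1mx.
  have -> : (mu / L0)%:M - J X = L0^-1 *: (invmx g *m (mu%:M - jac F (gp X)) *m g).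
    rewrite mulmxBr mulmxBl scalerBr -/(J X) mul_mx_scalar -scalemxAl mulVmx //.
    by rewrite scalerA scalemx1 [_ / L0]mulrC.
  rewrite detZ !det_mulmx det_inv (_ : _ * _ * \det g = \det (mu%:M - jac F (gp X))).
    2: by rewrite mulrAC mulVf ?mul1r // -unitfE -unitmxE.
  by split; field; rewrite L0n mn.
have nzE (x y : 'I_3 -> C) : x =1 y -> nonzero3 y -> nonzero3 x by move=> xy [k yk]; exists k; rewrite xy.
have nzZ (x : 'I_3 -> C) d : d != 0 -> nonzero3 x -> nonzero3 (fun k => d * x k).
  by move=> dn [k xk]; exists k; rewrite mulf_neq0.
have ext (x y : 'I_3 -> C) : x =1 y -> x = y by move=> xy; apply: funext.
have Sp i : spec_t F p i = tD D i /\ spec_d F p i = dD D i.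
  rewrite /spec_t /spec_d.
  have : [\/ i = 0, i = 1, i = j2 | i = j3].
    by case: i => [[|[|[|[|]]]]] //= hi; [apply: Or41|apply: Or42|apply: Or43|apply: Or44];
      apply: val_inj; rewrite /= ?inordK.
  case=> ->.
  - have [<- <-] := td_scale (E4_nonzero HE (off 0)) t0n E0 (cn 0).
    rewrite -(ext _ _ gp0); have [-> ->] := TD _ _ (nzE _ _ gp0 (nzZ _ _ (cn 0) (E4_nonzero HE _))) L0n Fg0.
    by rewrite divff //; apply: (spectrum_e1 (JD _)).
  - have [<- <-] := td_scale (E4_nonzero HE (off 1)) t1n E1 (cn 1).
    rewrite -(ext _ _ gp1); have [-> ->] := TD _ _ (nzE _ _ gp1 (nzZ _ _ (cn 1) (E4_nonzero HE _)))
      (mulf_neq0 (cn 1) t1n) Fg1.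
    by rewrite -/l1 -em2; apply: (spectrum_e2 (JD _)) => //; rewrite em2.
  - have [<- <-] := td_scale (E4_nonzero HE (off j2)) t2n E2 (cn i2).
    rewrite -(ext _ _ gp2); have [-> ->] := TD _ _ (nzE _ _ gp2 (nzZ _ _ (cn i2) (E4_nonzero HE _)))
      (mulf_neq0 (cn i2) t2n) Fg2.
    by rewrite -/l2 -em3; apply: (spectrum_e3 (JD _)) => //; rewrite em3.
  - rewrite -(ext _ _ gp3); have [-> ->] := TD _ _ (nzE _ _ gp3 (E4_nonzero HE _)) t3n Fg3.
    by rewrite -/l3 -em4; apply: (spectrum_e4 (JD _)) => //; rewrite em4.
pose X (j : 'I_3) k := (invmx g *m cvec (p (rshift 4 j))) k 0.
have gX j : gp (X j) =1 p (rshift 4 j).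
  move=> r; rewrite /gp (_ : cvec (X j) = invmx g *m cvec (p (rshift 4 j))); last first.
    by apply/colP => k; rewrite mxE.
  by rewrite mulKVmx // mxE.
have Xl j : b1 * X j 0 + b2 * X j 1 + X j i2 = 0.
  have : lin a (gp (X j)) = 0.
    apply/eqP; rewrite (lin_ext _ (gX j)); have := offl (rshift 4 j).
    by rewrite /= => /esym/negbFE.
  by rewrite linb => /eqP; rewrite mulf_eq0 (negPf A2n) => /eqP.
have X2 j : X j i2 = - b1 * X j 0 - b2 * X j 1 by rewrite -[RHS]addr0 -(Xl j); ring.
have Xn j : X j 0 != 0 \/ X j 1 != 0.
  have [z0|] := eqVneq (X j 0) 0; last by left.
  have [z1|] := eqVneq (X j 1) 0; last by right.
  have [k] := nzE _ _ (gX j) (E4_nonzero HE _).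
  by rewrite gpE X2 z0 z1 !mulr0 subr0 !mulr0 !addr0 eqxx.
have Xprop i j : i != j -> X i 0 * X j 1 != X j 0 * X i 1.
  move=> ij; apply/eqP => H; move/eqP: ij; apply; apply/(@rshift_inj 4 3).
  case: (Xn j) => nz.
  - apply: (@E4_distinct _ _ _ _ HE _ _ (X i 0 / X j 0)) => k.
    rewrite -!gX !gpE !X2.
    have -> : X i 1 = X i 0 / X j 0 * X j 1 by rewrite mulrAC H mulrAC divff // mul1r.
    by field.
  - apply: (@E4_distinct _ _ _ _ HE _ _ (X i 1 / X j 1)) => k.
    rewrite -!gX !gpE !X2.
    have -> : X i 0 = X i 1 / X j 1 * X j 0.
      by rewrite mulrAC [X i 1 * _]mulrC -H mulfK.
    by field.
have /fin_all_exists2[mu mun Emu] j := E4_multiplier HE (rshift 4 j).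
have FX j k : Fev F (gp (X j)) k = mu j * gp (X j) k by rewrite (ext _ _ (gX j)) Emu.
pose nu j := mu j / L0.
have nun j : nu j != 0 by rewrite mulf_neq0 ?invr_eq0.
have fX j k : f (X j) k = nu j * X j k := ffix _ _ (FX j) k.
pose kap j := mD D (X j 0) (X j 1) - nu j.
have Sl j : [/\ Y0 D (X j 0) (X j 1) = kap j * X j 0, Y1 D (X j 0) (X j 1) = kap j * X j 1,
    u j = uD D (X j 0) (X j 1) (kap j) & v j = vD D (X j 0) (X j 1) (kap j)].
  have xl : a1 D * X j 0 + a2 D * X j 1 + X j i2 = 0 by rewrite eb1 eb2 Xl.
  have fE r : 2 * f (X j) r = J (X j) r 0 * X j 0 + J (X j) r 1 * X j 1 + J (X j) r i2 * X j i2.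
    exact: quad_euler.
  have [[S0 S1 S2 S3] aJ] := spectrum_line (JD (X j)) n2 (nun j) xl fE (fX j).
  have xn := nzE _ _ (gX j) (E4_nonzero HE (rshift 4 j)).
  have lx : lin a (gp (X j)) = 0 by rewrite linb Xl mulr0.
  have [tj uvj _] := Huv j; rewrite -!(ext _ _ (gX j)) in tj uvj.
  pose m := mD D (X j 0) (X j 1).
  pose ar : 'rV[C]_3 := \row_k a k.
  have agE : ar *m g = A2 *: \row_s match val s with 0 => b1 | 1 => b2 | _ => 1 end.
    apply/rowP => s; have := linb (basis_pt C s).
    rewrite /lin (_ : \sum_(k < 3) _ = (ar *m g) 0 s); last first.
      rewrite !mxE; apply: eq_bigr => k _; rewrite !mxE /gp mxE (bigD1 s) //= big1 => [|l ls].
        by rewrite !mxE /basis_pt eqxx mulr1 addr0.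
      by rewrite !mxE /basis_pt (negPf ls) mulr0.
    move=> ->; rewrite !mxE.
    by case: (ord3P s) => [|[|]] ->; rewrite !basis_ptE /= ?inordK //=; ring.
  (* The left eigenvector of J is carried back through g; undoing the normalisation multiplies its
     eigenvalue by [L0]. *)
  have arJ : ar *m jac F (gp (X j)) = (L0 * m) *: ar.
    have : ar *m g *m J (X j) = m *: (ar *m g).
      move: (J (X j)) aJ; rewrite agE -/m eb1 eb2 => M aM.
      apply/rowP => s; rewrite mxE sum_ord3 !mxE /= inordK //= [RHS]mulrCA -aM; ring.
    rewrite /J -scalemxAr !mulmxA mulmxK // => H.
    have {}H : L0^-1 *: (ar *m jac F (gp (X j))) *m g = m *: ar *m g by rewrite -!scalemxAl.
    have {}H := congr1 (fun N : 'rV_3 => N *m invmx g) H; rewrite /= !mulmxK // in H.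
    by rewrite -scalerA -H scalerA mulfV // scale1r.
  have aJF s : \sum_r a r * jac F (gp (X j)) r s = L0 * m * a s.
    have := congr1 (fun w : 'rV_3 => w 0 s) arJ; rewrite mxE [RHS]mxE [RHS]mulrC mxE => H.
    by rewrite mulrC -H; apply: eq_bigr => r _; rewrite [ar 0 r]mxE.
  have [-> ->] := tangent_eigenvalues hF xn (mun j) (FX j) an lx aJF tj uvj.
  have -> : \tr (jac F (gp (X j))) = L0 * \tr (J (X j)).
    by rewrite /J mxtraceZ mxtrace_mulC mulmxA mulmxV // mul1mx mulVKf.
  rewrite /kap -/m; rewrite -/m in S2 S3; rewrite -S2 -S3; split=> //.
  - by rewrite /nu; field; rewrite L0n mun.
  - by rewrite /nu; field; rewrite L0n mun.
have a1n : a1 D != 0 by rewrite eb1.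
have a2n : a2 D != 0 by rewrite eb2.
have a4n : a4 D != 0 by rewrite /a4 eb1 eb2.
have gc j : g0 D * X j 0 ^+ 3 + g1 D * X j 0 ^+ 2 * X j 1 + g2 D * X j 0 * X j 1 ^+ 2
    + g3 D * X j 1 ^+ 3 = 0.
  by rewrite -fixed_cubic; have [-> -> _ _] := Sl j; ring.
have [k [G0 G1 G2 G3]] := binary_cubic Xn Xprop gc.
(* If k = 0 the cubic vanishes identically, so N = 0 and d_1 = 0, against the nondegeneracy of
   p_1. *)
have kn : k != 0.
  apply: contra_neq (nd (off 0)) => k0; have [_] := Sp 0; rewrite /spec_d /detIDf => ->.
  have H : D = cubic_datum (a1 D) (a2 D) (m2 D) (m3 D) (fun=> 0) (fun=> 0).
    apply: cubic_datum_uniq => //=.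
    have [-> -> -> ->] := cubic_datumE (m2 D) (m3 D) (fun=> 0) (fun=> 0) a1n a2n a4n.
    by rewrite G0 G1 G2 G3 k0; split; ring.
  by rewrite /dD /=; have -> : cN D = 0; [rewrite H /cN /=; ring | rewrite oppr0 mul0r].
(* The constant factor k of the cubic is absorbed into the representative of the first root; [kap]
   has to be rescaled along with it. *)
pose s (j : 'I_3) : C := if j == 0 then k else 1.
have sn j : s j != 0 by rewrite /s; case: (j == 0); [exact: kn | exact: oner_neq0].
have s0 : s 0 = k by [].
have s1 : s 1 = 1 by [].
have s2 : s i2 = 1 by rewrite /s -val_eqE /= inordK.
pose y j := s j * X j 0; pose z j := s j * X j 1.
pose th (i : 'I_10) : C := if (i < 4)%N then nth 0 [:: b1; b2; l1; l2] i
  else if (i < 7)%N then y (inord (i - 4)) else z (inord (i - 7)).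
have thy (j : 'I_3) : th (inord (4 + j)) = y j.
  rewrite /th inordK; last by case: j => [[|[|[|]]]].
  by rewrite addKn inord_val; case: j => [[|[|[|]]]].
have thz (j : 'I_3) : th (inord (7 + j)) = z j.
  rewrite /th inordK; last by case: j => [[|[|[|]]]].
  by rewrite addKn inord_val; case: j => [[|[|[|]]]].
have HD : D = cubic_datum (a1 D) (a2 D) (m2 D) (m3 D) y z.
  apply: cubic_datum_uniq => //=.
  have [-> -> -> ->] := cubic_datumE (m2 D) (m3 D) y z a1n a2n a4n.
  by rewrite G0 G1 G2 G3 /y /z s0 s1 s2; split; ring.
have Dth : param th = D.
  rewrite /param (ext _ _ thy) (ext _ _ thz) [RHS]HD eb1 eb2 em2 em3.
  by rewrite /th !inordK.
have nD j : mD D (X j 0) (X j 1) - kap j != 0.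
  by rewrite (_ : _ - _ = nu j) // /kap; move: (mD _ _ _) => m; ring.
exists th, (fun j => s j * kap j); rewrite /good Dth.
split.
  split; first by rewrite em2.
  split; first by rewrite em3.
  split; first by rewrite em4.
  move=> j; rewrite thy thz /y /z; have [S0 S1 _ _] := Sl j; split.
  - by case: (Xn j) => h; [left | right]; rewrite mulf_neq0.
  - by rewrite Y0_scale S0; ring.
  - by rewrite Y1_scale S1; ring.
  - by rewrite mD_scale -mulrBr mulf_neq0.
split.
- by apply: funext => i; have [] := Sp i.
- by apply: funext => i; have [] := Sp i.
- apply: funext => j; rewrite thy thz.
  by have [_ _ -> _] := Sl j; have [-> _] := uD_hom (sn j) (nD j).
- apply: funext => j; rewrite thy thz.
  by have [_ _ _ ->] := Sl j; have [_ ->] := uD_hom (sn j) (nD j).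
Qed.

End E4NormalForm.

(** * The Jacobian criterion *)

Section ChainRule.
Variables (C : comNzRingType) (S : comNzRingType) (f : {rmorphism C -> S}) (m : nat).
Variables (g : 'I_m -> S) (del : S -> S).
Hypotheses (delD : forall x y, del (x + y) = del x + del y)
  (delM : forall x y, del (x * y) = del x * y + x * del y)
  (delC : forall c, del (f c) = 0).

Lemma mmap_chain_rule (P : {mpoly C[m]}) :
  del (mmap f g P) = \sum_i mmap f g P^`M(i) * del (g i).
Proof.
pose Q (P : {mpoly C[m]}) := del (mmap f g P) = \sum_i mmap f g P^`M(i) * del (g i).
have QC c : Q c%:MP.
  by rewrite /Q mmapC delC big1 // => i _; rewrite mderivC raddf0 mul0r.
have QX i : Q 'X_i.
  rewrite /Q mmapX mmap1U (bigD1 i) //= big1 => [|j ji].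
    rewrite mderivX mmapZ mmapX mnm1E eqxx rmorph1 mul1r.
    by rewrite (_ : (U_(i) - U_(i))%MM = 0%MM) ?mmap11 ?mul1r ?addr0 //;
      apply/mnmP => l; rewrite !mnmE subnn.
  by rewrite mderivX mmapZ mnm1E eq_sym (negPf ji) rmorph0 !mul0r.
have QD P1 P2 : Q P1 -> Q P2 -> Q (P1 + P2).
  move=> H1 H2; rewrite /Q raddfD delD H1 H2 -big_split; apply: eq_bigr => i _ /=.
  by rewrite mderivD raddfD mulrDl.
have QM P1 P2 : Q P1 -> Q P2 -> Q (P1 * P2).
  move=> H1 H2; rewrite /Q rmorphM /= delM H1 H2 mulr_suml mulr_sumr -big_split.
  by apply: eq_bigr => i _ /=; rewrite mderivM rmorphD !rmorphM /=; ring.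
elim/mpolyind: P => [|c e P _ _ IH]; first by rewrite -mpolyC0; apply: QC.
apply: QD => //; rewrite -mul_mpolyC; apply QM; first exact: QC.
rewrite mpolyXE_id; elim/big_ind: _ => [||i _]; [by rewrite -mpolyC1; apply: QC | exact: QM |].
by elim: (e i) => [|k IHk]; rewrite ?expr0 -?mpolyC1 ?exprS; [exact: QC | apply QM].
Qed.

End ChainRule.

Section Vanishing.
Variables (C : numFieldType) (m : nat) (Z : {mpoly C[m]} -> Prop).
Hypotheses (Zder : forall P i, Z P -> Z P^`M(i)) (Zcst : forall c, Z c%:MP -> c = 0).

(* Induction on the degree: all partial derivatives of P vanish, so P is constant. *)
Lemma deriv_closed_eq0 P : Z P -> P = 0.
Proof.
suff gen l : forall P, (forall e, e \in msupp P -> (mdeg e < l)%N) -> Z P -> P = 0.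
  by apply: (gen (msize P)) => e; apply: msize_mdeg_lt.
elim: l => [|l IH] {}P H ZP.
  by apply/eqP; rewrite -msupp_eq0; apply/eqP; case: (msupp P) H => // e s /(_ e (mem_head _ _)).
have D0 i : P^`M(i) = 0.
  apply: IH; last exact: Zder.
  move=> e; rewrite mcoeff_msupp mcoeff_mderiv => ne.
  have /H : (e + U_(i))%MM \in msupp P.
    by rewrite mcoeff_msupp; apply: contra_neq ne => ->; rewrite mul0rn.
  by rewrite mdegD mdeg1 addn1.
have EP : P = (P@_0%MM)%:MP.
  apply/mpolyP => e; rewrite mcoeffC.
  have [->|en] := eqVneq e 0%MM; first by rewrite mulr1.
  rewrite mulr0; have [i ei] : exists i, e i != 0%N.
    apply/existsP; apply: contraR en; rewrite negb_exists => /forallP h.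
    by apply/eqP/mnmP => i; rewrite mnm0E; apply/eqP; have := h i; rewrite negbK.
  have le : (U_(i) <= e)%MM.
    by apply/mnm_lepP => j; rewrite mnmE; case: eqP => [<-|//]; rewrite lt0n.
  have := congr1 (mcoeff (e - U_(i))%MM) (D0 i).
  by rewrite mcoeff_mderiv submK // mcoeff0 => /eqP; rewrite mulrn_eq0 => /eqP.
by rewrite EP in ZP *; rewrite (Zcst ZP) mpolyC0.
Qed.

End Vanishing.

(** Vanishing at all points passes to partial derivatives: on a line in a coordinate direction the
    polynomial is univariate with infinitely many zeros, hence zero with its derivative. *)
Lemma mpoly_neq0_point (C : numFieldType) m (P : {mpoly C[m]}) :
  P != 0 -> exists x, P.@[x] != 0.
Proof.
move=> Pn; apply: contrapT => H; move/eqP: Pn; apply.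
apply: (@deriv_closed_eq0 _ _ (fun P => forall x, P.@[x] = 0)); last first.
- by move=> x; apply/eqP; apply: contrapT => /negP ?; apply: H; exists x.
- by move=> c /(_ (fun=> 0)); rewrite mevalC.
move=> Q i HQ x.
pose g j : {poly C} := (x j)%:P + (i == j)%:R *: 'X.
have gs s (T : {mpoly C[m]}) : (mmap polyC g T).[s] = T.@[fun j => x j + (i == j)%:R * s].
  rewrite mevalE /mmap horner_sum; apply: eq_bigr => e _; rewrite hornerM hornerC; congr (_ * _).
  by rewrite /mmap1 horner_prod; apply: eq_bigr => j _; rewrite horner_exp /g !hornerE.
have z0 : mmap polyC g Q = 0.
  apply/eqP; apply: contraT => Zn.
  pose s := [seq (k%:R : C) | k <- iota 0 (size (mmap polyC g Q))].
  have us : uniq s by rewrite map_inj_uniq ?iota_uniq // => k l /eqP; rewrite eqr_nat => /eqP.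
  have := max_poly_roots Zn _ us; rewrite size_map size_iota ltnn; apply.
  by apply/allP => y _; rewrite rootE gs HQ.
have := mmap_chain_rule (f := polyC) (del := deriv) g (@derivD C) (@derivM C) (@derivC C) Q.
rewrite z0 deriv0 (bigD1 i) //= big1 => [|j ji]; last first.
  by rewrite /g eq_sym (negPf ji) scale0r addr0 derivC mulr0.
rewrite /g eqxx scale1r derivD derivC derivX add0r mulr1 addr0 => /esym/(congr1 (horner^~ 0)).
rewrite /= gs horner0 => <-; apply: meval_eq => j; by rewrite mulr0 addr0.
Qed.

(** * Partial derivatives of rational functions *)

Section FracDerivation.
Variables (C : fieldType) (n : nat).
Notation K := {fraction {mpoly C[n]}}.

Definition fnum (x : K) := sval (cid (fraction_num_den x)).
Definition fden (x : K) := sval (cid (svalP (cid (fraction_num_den x)))).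
Lemma fnum_den x : fden x != 0 /\ x = tofrac (fnum x) / tofrac (fden x).
Proof. exact: (svalP (cid (svalP (cid (fraction_num_den x))))). Qed.

(** The quotient rule on a chosen representation; [fderE] shows that the choice does not matter. *)
Definition fder (i : 'I_n) (x : K) : K :=
  tofrac ((fnum x)^`M(i) * fden x - fnum x * (fden x)^`M(i)) / tofrac (fden x) ^+ 2.

Lemma quotient_rule_cross (R : comPzRingType) (a b c d a' b' c' d' : R) :
  a * d = c * b -> a' * d + a * d' = c' * b + c * b' ->
  (a' * b - a * b') * d ^+ 2 = (c' * d - c * d') * b ^+ 2.
Proof.
move=> E E'.
transitivity (b * d * (a' * d + a * d') - a * d * (b * d' + b' * d)); first by ring.
by rewrite E' E; ring.
Qed.

Lemma fderE i nu de : de != 0 -> fder i (tofrac nu / tofrac de) =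
  tofrac (nu^`M(i) * de - nu * de^`M(i)) / tofrac de ^+ 2.
Proof.
move=> dn; have [dn' E] := fnum_den (tofrac nu / tofrac de).
rewrite /fder; set x := tofrac nu / tofrac de in E dn' *.
have cr : fnum x * de = nu * fden x.
  by apply/eqP; rewrite -tofrac_eq !tofracM -eqr_div ?tofrac_eq0 // -E.
have cr' := congr1 (mderiv i) cr; rewrite !mderivM in cr'.
have H := quotient_rule_cross cr cr'.
apply/eqP; rewrite eqr_div ?expf_neq0 ?tofrac_eq0 //.
by rewrite -!tofracXn -!tofracM H.
Qed.

Lemma fderC i c : fder i (fconst n c) = 0.
Proof.
have -> : fconst n c = tofrac c%:MP / tofrac 1 by rewrite tofrac1 divr1.
by rewrite fderE ?oner_neq0 // -mpolyC1 !mderivC mul0r mulr0 subr0 tofrac0 mul0r.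
Qed.

Lemma fderX i j : fder i (fvar C j) = (i == j)%:R.
Proof.
have -> : fvar C j = tofrac 'X_j / tofrac 1 by rewrite tofrac1 divr1.
rewrite fderE ?oner_neq0 // -mpolyC1 mderivC mulr0 subr0 mpolyC1 mulr1 tofrac1 expr1n divr1.
rewrite mderivX mnm1E eq_sym; case: eqP => [->|_]; last by rewrite scale0r tofrac0.
rewrite scale1r (_ : (U_(j) - U_(j))%MM = 0%MM) ?mpolyX0 ?tofrac1 //.
by apply/mnmP => l; rewrite !mnmE subnn.
Qed.

Lemma sum_rule (F : fieldType) (a b c d a' b' c' d' : F) : b != 0 -> d != 0 ->
  ((a' * d + a * d' + (c' * b + c * b')) * (b * d) - (a * d + c * b) * (b' * d + b * d'))
    / (b * d) ^+ 2 = (a' * b - a * b') / b ^+ 2 + (c' * d - c * d') / d ^+ 2.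
Proof. by move=> bn dn; field; rewrite bn dn. Qed.

Lemma product_rule (F : fieldType) (a b c d a' b' c' d' : F) : b != 0 -> d != 0 ->
  ((a' * c + a * c') * (b * d) - a * c * (b' * d + b * d')) / (b * d) ^+ 2 =
  (a' * b - a * b') / b ^+ 2 * (c / d) + a / b * ((c' * d - c * d') / d ^+ 2).
Proof. by move=> bn dn; field; rewrite bn dn. Qed.

Lemma inverse_rule (F : fieldType) (x d y : F) :
  x != 0 -> d / x + x * y = 0 -> y = - d / x ^+ 2.
Proof.
move=> xn H; transitivity ((d / x + x * y) / x - d / x ^+ 2); first by field.
by rewrite H mul0r sub0r mulNr.
Qed.

Lemma fderD i x y : fder i (x + y) = fder i x + fder i y.
Proof.
have [a [b [bn ->]]] := fraction_num_den x; have [c [d [dn ->]]] := fraction_num_den y.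
have -> : tofrac a / tofrac b + tofrac c / tofrac d = tofrac (a * d + c * b) / tofrac (b * d) :> K.
  by rewrite addf_div ?tofrac_eq0 // tofracD !tofracM.
rewrite !fderE ?mulf_neq0 // mderivD !mderivM.
rewrite !(tofracB, tofracD, tofracM).
by apply: sum_rule; rewrite tofrac_eq0.
Qed.

Lemma fderM i x y : fder i (x * y) = fder i x * y + x * fder i y.
Proof.
have [a [b [bn ->]]] := fraction_num_den x; have [c [d [dn ->]]] := fraction_num_den y.
have -> : tofrac a / tofrac b * (tofrac c / tofrac d) = tofrac (a * c) / tofrac (b * d) :> K.
  by rewrite mulf_div !tofracM.
rewrite !fderE ?mulf_neq0 // !mderivM.
rewrite !(tofracB, tofracD, tofracM).
by apply: product_rule; rewrite tofrac_eq0.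
Qed.

Lemma fder1 i : fder i 1 = 0.
Proof. by rewrite -(rmorph1 (@fconst C n)) fderC. Qed.

Lemma fderN i x : fder i (- x) = - fder i x.
Proof.
apply/eqP; rewrite -addr_eq0 -fderD addNr.
by rewrite -(rmorph0 (@fconst C n)) fderC.
Qed.

Lemma fderB i x y : fder i (x - y) = fder i x - fder i y.
Proof. by rewrite fderD fderN. Qed.

Lemma fderMn i x k : fder i (x *+ k) = fder i x *+ k.
Proof.
elim: k => [|k IH]; last by rewrite !mulrS fderD IH.
by rewrite !mulr0n -(rmorph0 (@fconst C n)) fderC.
Qed.

Lemma fderV i x : x != 0 -> fder i x^-1 = - fder i x / x ^+ 2.
Proof.
by move=> xn; apply: inverse_rule => //; rewrite -fderM divff // fder1.
Qed.

End FracDerivation.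

Section JacobianCriterion.
Variables (C : numFieldType) (n m : nat) (g : 'I_m -> {fraction {mpoly C[n]}}).
Hypothesis indep : forall kap : 'I_m -> {fraction {mpoly C[n]}},
  (forall j, \sum_i kap i * fder j (g i) = 0) -> forall i, kap i = 0.

(** By the chain rule, P(g) = 0 is a linear relation between the gradients of the g_i with
    coefficients (dP/dx_i)(g), all of which therefore vanish. So the relations between the g_i are
    closed under differentiation and contain no nonzero constant. *)
Lemma jacobian_criterion (P : {mpoly C[m]}) : mmap (@fconst C n) g P = 0 -> P = 0.
Proof.
apply: (@deriv_closed_eq0 _ _ (fun P => mmap (@fconst C n) g P = 0)) => [{}P i P0|c].
  apply: (indep (kap := fun i => mmap (@fconst C n) g P^`M(i))) => j.
  rewrite -(mmap_chain_rule g (@fderD _ _ j) (@fderM _ _ j) (@fderC _ _ j)) P0.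
  by rewrite -(rmorph0 (@fconst C n)) fderC.
by rewrite mmapC => /eqP; rewrite tofrac_eq0 mpolyC_eq0 => /eqP.
Qed.

End JacobianCriterion.

Lemma generic_point (C : numFieldType) n (s : seq {fraction {mpoly C[n]}}) :
  (forall x, x \in s -> x != 0) ->
  exists th, forall x, x \in s -> exists2 v, v != 0 & frac_val x th v.
Proof.
move=> H; suff [R Rn HR] : exists2 R : {mpoly C[n]}, R != 0 & forall th, R.@[th] != 0 ->
    forall x, x \in s -> exists2 v, v != 0 & frac_val x th v.
  by have [th Rth] := mpoly_neq0_point Rn; exists th; apply: HR.
elim: s H => [|x s IH] H; first by exists 1; rewrite ?oner_neq0.
have [R Rn HR] : exists2 R : {mpoly C[n]}, R != 0 & forall th, R.@[th] != 0 ->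
    forall x, x \in s -> exists2 v, v != 0 & frac_val x th v.
  by apply: IH => y ys; apply: H; rewrite inE ys orbT.
have [nu [de [den ex]]] := fraction_num_den x.
have nun : nu != 0.
  by apply: contra_neq (H x (mem_head _ _)) => nu0; rewrite ex nu0 tofrac0 mul0r.
exists (nu * de * R); first by rewrite !mulf_neq0.
move=> th; rewrite !mevalM !mulf_eq0 !negb_or => /andP[/andP[n1 n2] n3] y.
rewrite inE => /orP[/eqP->|]; last exact: HR.
by exists (nu.@[th] / de.@[th]); [rewrite mulf_neq0 ?invr_eq0 | exists nu, de].
Qed.

(** * Solutions of the known relations *)

(* An open part of the variety of solutions of the five known relations, with coordinates
   w_j = v_{5+j}, the t_i, A = sum 1/(u_j v_j) and 1/d_4.  Put q = prod (z - w_j) and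
   p = z^2 + (1 - s_1) z + A s_3.  With 1/u_j = p(w_j)/q'(w_j), partial fractions give
   sum 1/u_j = sum v_j/u_j = 1.  The remaining relations are linear in the 1/d_i. *)
Section Solutions.
Variables (K : fieldType) (w0 w1 w2 A t0 t1 t2 t3 e3 : K).
Definition sol_p (z : K) := z ^+ 2 + (1 - (w0 + w1 + w2)) * z + A * (w0 * w1 * w2).
Definition sol_u0 := (w0 - w1) * (w0 - w2) / sol_p w0.
Definition sol_u1 := (w1 - w0) * (w1 - w2) / sol_p w1.
Definition sol_u2 := (w2 - w0) * (w2 - w1) / sol_p w2.
Definition sol_B := w0^-1 + w1^-1 + w2^-1.
Definition sol_C := sol_u0 / w0 + sol_u1 / w1 + sol_u2 / w2.
Definition sol_R0 := 1 - A - e3.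
Definition sol_R1 := 3 - sol_B - t3 * e3.
Definition sol_R2 := 9 - sol_C - t3 ^+ 2 * e3.
Definition sol_e0 := (sol_R2 - (t1 + t2) * sol_R1 + t1 * t2 * sol_R0) / ((t0 - t1) * (t0 - t2)).
Definition sol_e1 := (sol_R2 - (t0 + t2) * sol_R1 + t0 * t2 * sol_R0) / ((t1 - t0) * (t1 - t2)).
Definition sol_e2 := (sol_R2 - (t0 + t1) * sol_R1 + t0 * t1 * sol_R0) / ((t2 - t0) * (t2 - t1)).

Definition sol_u (j : 'I_3) := match val j with 0 => sol_u0 | 1 => sol_u1 | _ => sol_u2 end.
Definition sol_v (j : 'I_3) := match val j with 0 => w0 | 1 => w1 | _ => w2 end.
Definition sol_t (i : 'I_4) := match val i with 0 => t0 | 1 => t1 | 2 => t2 | _ => t3 end.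
Definition sol_e (i : 'I_4) :=
  match val i with 0 => sol_e0 | 1 => sol_e1 | 2 => sol_e2 | _ => e3 end.

Hypotheses (wn0 : w0 != 0) (wn1 : w1 != 0) (wn2 : w2 != 0).
Hypotheses (d01 : w0 - w1 != 0) (d02 : w0 - w2 != 0) (d12 : w1 - w2 != 0).
Hypotheses (f01 : t0 - t1 != 0) (f02 : t0 - t2 != 0) (f12 : t1 - t2 != 0).

Lemma sol_line : [/\ sol_u0^-1 + sol_u1^-1 + sol_u2^-1 = 1,
  w0 / sol_u0 + w1 / sol_u1 + w2 / sol_u2 = 1 &
  (sol_u0 * w0)^-1 + (sol_u1 * w1)^-1 + (sol_u2 * w2)^-1 = A].
Proof.
have d10 : w1 - w0 != 0 by rewrite -opprB oppr_eq0.
have d20 : w2 - w0 != 0 by rewrite -opprB oppr_eq0.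
have d21 : w2 - w1 != 0 by rewrite -opprB oppr_eq0.
rewrite /sol_u0 /sol_u1 /sol_u2 !invfM !invrK /sol_p.
by split; field; rewrite ?d01 ?d02 ?d12 ?d10 ?d20 ?d21 ?wn0 ?wn1 ?wn2.
Qed.

Lemma sol_lagrange : [/\ sol_e0 + sol_e1 + sol_e2 = sol_R0,
  t0 * sol_e0 + t1 * sol_e1 + t2 * sol_e2 = sol_R1 &
  t0 ^+ 2 * sol_e0 + t1 ^+ 2 * sol_e1 + t2 ^+ 2 * sol_e2 = sol_R2].
Proof.
have f10 : t1 - t0 != 0 by rewrite -opprB oppr_eq0.
have f20 : t2 - t0 != 0 by rewrite -opprB oppr_eq0.
have f21 : t2 - t1 != 0 by rewrite -opprB oppr_eq0.
rewrite /sol_e0 /sol_e1 /sol_e2; move: sol_R0 sol_R1 sol_R2 => r0 r1 r2.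
by split; field; rewrite ?f01 ?f02 ?f12 ?f10 ?f20 ?f21.
Qed.

End Solutions.

Lemma cramer3 (K : fieldType) (x y z : K) (a b c : 'I_3 -> K) :
  let i2 : 'I_3 := inord 2 in
  a 0 * (b 1 * c i2 - b i2 * c 1) - a 1 * (b 0 * c i2 - b i2 * c 0)
    + a i2 * (b 0 * c 1 - b 1 * c 0) != 0 ->
  (forall j, x * a j + y * b j + z * c j = 0) -> [/\ x = 0, y = 0 & z = 0].
Proof.
move=> i2 dn E; have [[E0 E1] E2] := (E 0, E 1, E i2).
have Z (s t r : K) : s * (x * a 0 + y * b 0 + z * c 0) + t * (x * a 1 + y * b 1 + z * c 1)
  + r * (x * a i2 + y * b i2 + z * c i2) = 0 by rewrite E0 E1 E2 !mulr0 !addr0.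
split; apply: (mulfI dn); rewrite mulr0.
- by rewrite -[RHS](Z (b 1 * c i2 - b i2 * c 1) (- (b 0 * c i2 - b i2 * c 0)) (b 0 * c 1 - b 1 * c 0)); ring.
- by rewrite -[RHS](Z (- (a 1 * c i2 - a i2 * c 1)) (a 0 * c i2 - a i2 * c 0) (- (a 0 * c 1 - a 1 * c 0))); ring.
- by rewrite -[RHS](Z (a 1 * b i2 - a i2 * b 1) (- (a 0 * b i2 - a i2 * b 0)) (a 0 * b 1 - a 1 * b 0)); ring.
Qed.

Lemma vandermonde_kernel (K : fieldType) (t0 t1 t2 x0 x1 x2 : K) :
  t0 - t1 != 0 -> t0 - t2 != 0 -> t1 - t2 != 0 ->
  x0 + x1 + x2 = 0 -> x0 * (t1 + t2) + x1 * (t0 + t2) + x2 * (t0 + t1) = 0 ->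
  x0 * (t1 * t2) + x1 * (t0 * t2) + x2 * (t0 * t1) = 0 -> [/\ x0 = 0, x1 = 0 & x2 = 0].
Proof.
move=> n01 n02 n12 E0 E1 E2.
have Z (s t r : K) : s * (x0 + x1 + x2) + t * (x0 * (t1 + t2) + x1 * (t0 + t2) + x2 * (t0 + t1))
  + r * (x0 * (t1 * t2) + x1 * (t0 * t2) + x2 * (t0 * t1)) = 0 by rewrite E0 E1 E2 !mulr0 !addr0.
split.
- apply: (mulfI (mulf_neq0 n01 n02)); rewrite mulr0 -[RHS](Z (t0 ^+ 2) (- t0) 1); ring.
- apply: (mulfI (mulf_neq0 n01 n12)); rewrite mulr0 -[RHS](Z (- t1 ^+ 2) (t1) (- 1)); ring.
- apply: (mulfI (mulf_neq0 n02 n12)); rewrite mulr0 -[RHS](Z (t2 ^+ 2) (- t2) 1); ring.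
Qed.

(** * First-order expansions at a test solution *)

Section SolutionsGeneric.
Variable C : numFieldType.
Notation K := {fraction {mpoly C[9]}}.
Notation i2 := (inord 2 : 'I_3).
Notation X k := (@fvar C 9 (inord k)).
Notation app f := (f (X 0) (X 1) (X 2) (X 3) (X 4) (X 5) (X 6) (X 7) (X 8)).
Notation U := (sol_u (X 0) (X 1) (X 2) (X 3)).
Notation V := (sol_v (X 0) (X 1) (X 2)).
Notation T := (sol_t (X 4) (X 5) (X 6) (X 7)).
Notation E := (app (@sol_e K)).
Notation BB := (sol_B (X 0) (X 1) (X 2)).
Notation CC := (sol_C (X 0) (X 1) (X 2) (X 3)).

(** w = (1, -1, 2), A = 1/2, t = (0, 1, -1, 2) and 1/d_4 = 1; at this point the values of [sol_p] at
    the w_j are - 1, 1, 1. *)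
Definition sol_th0 (i : 'I_9) : C := nth 0 [:: 1; -1; 2; 2^-1; 0; 1; -1; 2; 1] i.

(** Value and derivatives in w_0, w_1, w_2 only. The dependence on the other six coordinates is
    explicit enough to be treated symbolically. *)
Definition jet (x : K) (v : C) (d : 'I_3 -> C) := frac_val x sol_th0 v /\
  forall j : 'I_3, frac_val (fder (inord j) x) sol_th0 (d j).
Definition d3 (a b c : C) (j : 'I_3) : C := nth 0 [:: a; b; c] j.

Lemma jet_eq x v d v' d' : jet x v d -> v = v' -> (forall j, d j = d' j) -> jet x v' d'.
Proof. by move=> [H1 H2] <- E; split=> // j; rewrite -E. Qed.

Lemma jetD x y v d v' d' : jet x v d -> jet y v' d' ->
  jet (x + y) (v + v') (fun j => d j + d' j).
Proof. by move=> [H1 H2] [H3 H4]; split=> [|j]; rewrite ?fderD; apply: fvD. Qed.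

Lemma jetN x v d : jet x v d -> jet (- x) (- v) (fun j => - d j).
Proof. by move=> [H1 H2]; split=> [|j]; rewrite ?fderN; apply: fvN. Qed.

Lemma jetM x y v d v' d' : jet x v d -> jet y v' d' ->
  jet (x * y) (v * v') (fun j => d j * v' + v * d' j).
Proof. by move=> [H1 H2] [H3 H4]; split=> [|j]; rewrite ?fderM; [|apply: fvD]; apply: fvM. Qed.

Lemma jetV x v d : v != 0 -> jet x v d -> jet x^-1 v^-1 (fun j => - d j / v ^+ 2).
Proof.
move=> vn [H1 H2]; split=> [|j]; first exact: fvV.
rewrite fderV; last exact: (fv_neq0 H1).
by apply: fv_div; [rewrite expf_neq0 | apply: fvN | apply: fv_exp].
Qed.

Lemma jet1 : jet 1 1 (fun=> 0).
Proof. by split=> [|j]; [exact: fv1 | rewrite fder1; exact: fv0]. Qed.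

Lemma jetX k : (k < 9)%N ->
  jet (X k) (sol_th0 (inord k)) (fun j => (nat_of_ord j == k)%:R).
Proof.
move=> kn; split=> [|j]; first exact: fvX.
rewrite fderX -val_eqE /= !inordK //; last by case: j => [[|[|[|]]]].
by rewrite -(rmorph_nat (@fconst C 9)); apply: fvC.
Qed.

Ltac jt := repeat first [ eassumption |
  lazymatch goal with
  | |- jet (_ + _) _ _ => eapply jetD
  | |- jet (- _) _ _ => eapply jetN
  | |- jet (_ * _) _ _ => eapply jetM
  | |- jet 1 _ _ => exact: jet1
  end ].
Ltac jn := rewrite /d3 /=; field; rewrite ?pnatr_eq0 ?oppr_eq0 ?oner_eq0.
Ltac jd := let j := fresh in move=> j; case: (ord3P j) => [|[|]] ->; rewrite /d3 /= ?inordK //=; jn.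

Lemma jet_w : [/\ jet (X 0) 1 (d3 1 0 0), jet (X 1) (- 1) (d3 0 1 0),
  jet (X 2) 2 (d3 0 0 1) & jet (X 3) (2^-1) (d3 0 0 0)].
Proof.
by split; (apply: jet_eq (jetX _) _ _; [| rewrite /sol_th0 inordK |
  move=> j; case: (ord3P j) => [|[|]] ->; rewrite /d3 /= ?inordK]).
Qed.

Lemma jet_p : [/\ jet (sol_p (X 0) (X 1) (X 2) (X 3) (X 0)) (- 1) (d3 (- 1) 0 (- 3 / 2)),
  jet (sol_p (X 0) (X 1) (X 2) (X 3) (X 1)) 1 (d3 0 (- 1) (1 / 2)) &
  jet (sol_p (X 0) (X 1) (X 2) (X 3) (X 2)) 1 (d3 (- 3) (- 1) (1 / 2))].
Proof.
have [j0 j1 j2 jA] := jet_w.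
move: (X 0) (X 1) (X 2) (X 3) j0 j1 j2 jA => x0 x1 x2 x3 j0 j1 j2 jA.
by rewrite /sol_p !expr2; split; (eapply jet_eq; [jt | jn | jd]).
Qed.

Lemma jet_u : [/\ jet (sol_u0 (X 0) (X 1) (X 2) (X 3)) 2 (d3 (- 3) (- 1) (- 1)),
  jet (sol_u1 (X 0) (X 1) (X 2) (X 3)) 6 (d3 3 1 (- 1)) &
  jet (sol_u2 (X 0) (X 1) (X 2) (X 3)) 3 (d3 6 2 (5 / 2))].
Proof.
have [j0 j1 j2 jA] := jet_w; have [p0 p1 p2] := jet_p.
move: (X 0) (X 1) (X 2) (X 3) j0 j1 j2 jA p0 p1 p2 => x0 x1 x2 x3 j0 j1 j2 jA p0 p1 p2.
have n1 : (- 1 : C) != 0 by rewrite oppr_eq0 oner_neq0.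
have v0 := jetV n1 p0; have v1 := jetV (oner_neq0 C) p1; have v2 := jetV (oner_neq0 C) p2.
rewrite /sol_u0 /sol_u1 /sol_u2.
move: (sol_p _ _ _ _ x0)^-1 (sol_p _ _ _ _ x1)^-1 (sol_p _ _ _ _ x2)^-1 v0 v1 v2 => y0 y1 y2 v0 v1 v2.
split; by eapply jet_eq; [jt | jn | jd].
Qed.

Lemma jet_BC : jet BB (1 / 2) (d3 (- 1) (- 1) (- 1 / 4)) /\
  jet CC (- 5 / 2) (d3 (- 5) (- 7) (1 / 2)).
Proof.
have [j0 j1 j2 _] := jet_w; have [u0 u1 u2] := jet_u.
have n1 : (- 1 : C) != 0 by rewrite oppr_eq0 oner_neq0.
have n2 : (2 : C) != 0 by rewrite pnatr_eq0.
have v0 := jetV (oner_neq0 C) j0; have v1 := jetV n1 j1; have v2 := jetV n2 j2.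
rewrite /sol_B /sol_C.
move: (sol_u0 _ _ _ _) (sol_u1 _ _ _ _) (sol_u2 _ _ _ _) u0 u1 u2 => y0 y1 y2 u0 u1 u2.
move: (X 0)^-1 (X 1)^-1 (X 2)^-1 v0 v1 v2 => z0 z1 z2 v0 v1 v2.
by split; (eapply jet_eq; [jt | jn | jd]).
Qed.

Definition sym10 : {mpoly C[6]} := uX C 0 + uX C 1 + uX C 2.
Definition sym30 : {mpoly C[6]} := uX C 0 * uX C 1 * uX C 2.
Definition sym01 : {mpoly C[6]} := vX C 0 + vX C 1 + vX C 2.
Definition sym11 : {mpoly C[6]} := uX C 0 * vX C 1 + uX C 0 * vX C 2 + uX C 1 * vX C 2
   + uX C 1 * vX C 0 + uX C 2 * vX C 0 + uX C 2 * vX C 1.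

Lemma mmap_uvX (S : fieldType) (f : {rmorphism C -> S}) (u v : 'I_3 -> S) j : (j < 3)%N ->
  mmap f (pt6 u v) (uX C j) = u (inord j) /\ mmap f (pt6 u v) (vX C j) = v (inord j).
Proof.
move=> hj; rewrite /uX /vX !mmapX !mmap1U /pt6.
by case: j hj => [|[|[|]]] //= _; rewrite !inordK.
Qed.

Lemma jet_sym : [/\ jet (mmap (@fconst C 9) (pt6 U V) sym10) 11 (d3 6 2 (1 / 2)),
  jet (mmap (@fconst C 9) (pt6 U V) sym30) 36 (d3 36 12 6),
  jet (mmap (@fconst C 9) (pt6 U V) sym01) 2 (d3 1 1 1) &
  jet (mmap (@fconst C 9) (pt6 U V) sym11) 20 (d3 15 7 4)].
Proof.
have [j0 j1 j2 _] := jet_w; have [u0 u1 u2] := jet_u.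
have [eu0 ev0] := mmap_uvX (@fconst C 9) U V (erefl : (0 < 3)%N).
have [eu1 ev1] := mmap_uvX (@fconst C 9) U V (erefl : (1 < 3)%N).
have [eu2 ev2] := mmap_uvX (@fconst C 9) U V (erefl : (2 < 3)%N).
rewrite /sym10 /sym30 /sym01 /sym11 !(rmorphD, rmorphM) /= eu0 eu1 eu2 ev0 ev1 ev2.
rewrite /sol_u /sol_v /= !inordK //=.
move: (sol_u0 _ _ _ _) (sol_u1 _ _ _ _) (sol_u2 _ _ _ _) u0 u1 u2 => y0 y1 y2 u0 u1 u2.
move: (X 0) (X 1) (X 2) j0 j1 j2 => z0 z1 z2 j0 j1 j2.
by split; (eapply jet_eq; [jt | jn | jd]).
Qed.

End SolutionsGeneric.

Definition sol_map (K : fieldType) (t e : 'I_4 -> K) (s : K) (i : 'I_9) : K :=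
  if (i < 8)%N then pt8 t (fun l => (e l)^-1) (inord i) else s.

Lemma sol_map_sum (K : fieldType) (t e : 'I_4 -> K) (s : K) (kap : 'I_9 -> K) (del : K -> K) :
  \sum_i kap i * del (sol_map t e s i) =
  \sum_(l < 4) (kap (inord (2 * l)) * del (t l) + kap (inord (2 * l + 1)) * del (e l)^-1)
  + kap (inord 8) * del s.
Proof.
rewrite !big_ord_recl !big_ord0 /= /sol_map /pt8 /= !inordK //= !addr0 !addrA.
by do 9?congr (_ + _); congr (kap _ * del _); try (congr (t _) + congr (e _)^-1);
  apply: val_inj; rewrite /= ?inordK.
Qed.

Section AlgebraicIndependence.
Variable C : numFieldType.
Notation K := {fraction {mpoly C[9]}}.
Notation i2 := (inord 2 : 'I_3).
Notation X k := (@fvar C 9 (inord k)).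
Notation U := (sol_u (X 0) (X 1) (X 2) (X 3)).
Notation V := (sol_v (X 0) (X 1) (X 2)).
Notation T := (sol_t (X 4) (X 5) (X 6) (X 7)).
Notation E := (sol_e (X 0) (X 1) (X 2) (X 3) (X 4) (X 5) (X 6) (X 7) (X 8)).
Notation BB := (sol_B (X 0) (X 1) (X 2)).
Notation CC := (sol_C (X 0) (X 1) (X 2) (X 3)).

Lemma fder_kernel_subfield (j : 'I_9) : subfield (fun x : K => fder j x = 0).
Proof.
split=> [|x y hx hy|x y hx hy|x hx]; first exact: fder1.
- by rewrite fderB hx hy subrr.
- by rewrite fderM hx hy mulr0 mul0r addr0.
- have [->|xn] := eqVneq x 0; last by rewrite fderV // hx oppr0 mul0r.
  by rewrite invr0 -(rmorph0 (@fconst C 9)) fderC.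
Qed.

Lemma fderX_nat i j : (i < 9)%N -> (j < 9)%N -> fder (inord i : 'I_9) (X j) = (i == j)%:R :> K.
Proof. by move=> hi hj; rewrite fderX -val_eqE /= !inordK. Qed.

Lemma sol_values : [/\ frac_val (E 0) (sol_th0 C) (- 8), frac_val (E 1) (sol_th0 C) 4,
  frac_val (E (inord 2)) (sol_th0 C) (7 / 2) & frac_val (E (inord 3)) (sol_th0 C) 1] /\
  [/\ frac_val (X 4) (sol_th0 C) 0, frac_val (X 5) (sol_th0 C) 1 &
      frac_val (X 6) (sol_th0 C) (- 1)].
Proof.
have hX k v : (k < 9)%N -> nth 0 [:: 1; -1; 2; 2^-1; 0; 1; -1; 2; 1] k = v ->
    frac_val (X k) (sol_th0 C) v.
  by move=> hk <-; have := fvX (sol_th0 C) (inord k); rewrite /sol_th0 inordK.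
have [[fB _] [fC _]] := jet_BC C.
have fA := hX 3 _ erefl erefl; have f4 := hX 4 _ erefl erefl; have f5 := hX 5 _ erefl erefl.
have f6 := hX 6 _ erefl erefl; have f7 := hX 7 _ erefl erefl; have f8 := hX 8 _ erefl erefl.
rewrite /= in fA f4 f5 f6 f7 f8.
split; last by [].
rewrite /sol_e /= !inordK //= /sol_e0 /sol_e1 /sol_e2 /sol_R0 /sol_R1 /sol_R2.
move: BB CC fB fC => bb cc fB fC.
have q3 := fvMn 3 (fv1 (sol_th0 C)); have q9 := fvMn 9 (fv1 (sol_th0 C)).
have R0 := fvB (fvB (fv1 _) fA) f8.
have R1 := fvB (fvB q3 fB) (fvM f7 f8).
have R2 := fvB (fvB q9 fC) (fvM (fv_exp 2 f7) f8).
have val (r0 r1 r2 a b c : K) (v0 v1 v2 va vb vc v : C) :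
    frac_val r0 (sol_th0 C) v0 -> frac_val r1 (sol_th0 C) v1 -> frac_val r2 (sol_th0 C) v2 ->
    frac_val a (sol_th0 C) va -> frac_val b (sol_th0 C) vb -> frac_val c (sol_th0 C) vc ->
    (vc - va) * (vc - vb) != 0 ->
    (v2 - (va + vb) * v1 + va * vb * v0) / ((vc - va) * (vc - vb)) = v ->
    frac_val ((r2 - (a + b) * r1 + a * b * r0) / ((c - a) * (c - b))) (sol_th0 C) v.
  move=> h0 h1 h2 ha hb hc n <-; apply: fv_div => //.
    by apply: fvD; [apply: fvB => //; apply: fvM => //; apply: fvD | apply: fvM => //; apply: fvM].
  by apply: fvM; apply: fvB.
split; last exact: f8.
- apply: (val _ _ _ _ _ _ _ _ _ _ _ _ _ R0 R1 R2 f5 f6 f4).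
    by rewrite (_ : _ * _ = - 1); [rewrite oppr_eq0 oner_neq0 | ring].
  by field; rewrite ?pnatr_eq0 ?oppr_eq0 ?oner_eq0.
- apply: (val _ _ _ _ _ _ _ _ _ _ _ _ _ R0 R1 R2 f4 f6 f5).
    by rewrite (_ : _ * _ = 2%:R); [rewrite pnatr_eq0 | ring].
  by field; rewrite ?pnatr_eq0 ?oppr_eq0 ?oner_eq0.
- apply: (val _ _ _ _ _ _ _ _ _ _ _ _ _ R0 R1 R2 f4 f5 f6).
    by rewrite (_ : _ * _ = 2%:R); [rewrite pnatr_eq0 | ring].
  by field; rewrite ?pnatr_eq0 ?oppr_eq0 ?oner_eq0.
Qed.

Lemma sol_generic_neq0 : (forall l, E l != 0) /\
  [/\ X 4 - X 5 != 0, X 4 - X 6 != 0 & X 5 - X 6 != 0].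
Proof.
have [[e0 e1 e2 e3] [f4 f5 f6]] := sol_values.
split; last first.
  split.
  - by apply: (fv_neq0 (fvB f4 f5)); apply: (@negS_neq0 _ _ 0); ring.
  - by apply: (fv_neq0 (fvB f4 f6)); apply: (@natS_neq0 _ _ 0); ring.
  - by apply: (fv_neq0 (fvB f5 f6)); apply: (@natS_neq0 _ _ 1); ring.
move=> l; have : [\/ l = 0, l = 1, l = inord 2 | l = inord 3].
  by case: l => [[|[|[|[|]]]]] //= hi; [apply: Or41|apply: Or42|apply: Or43|apply: Or44];
    apply: val_inj; rewrite /= ?inordK.
case=> ->.
- by apply: (fv_neq0 e0); rewrite oppr_eq0 pnatr_eq0.
- by apply: (fv_neq0 e1); rewrite pnatr_eq0.
- by apply: (fv_neq0 e2); rewrite mulf_neq0 ?invr_eq0 ?pnatr_eq0.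
- by apply: (fv_neq0 e3); rewrite oner_neq0.
Qed.

Lemma fder_lagrange (j : 'I_9) (r0 r1 r2 a b c : K) :
  fder j a = 0 -> fder j b = 0 -> fder j c = 0 ->
  fder j ((r2 - (a + b) * r1 + a * b * r0) / ((c - a) * (c - b))) =
  (fder j r2 - (a + b) * fder j r1 + a * b * fder j r0) / ((c - a) * (c - b)).
Proof.
move=> ha hb hc.
have [s1 sB sM sV] := fder_kernel_subfield j.
have hi : fder j ((c - a) * (c - b))^-1 = 0 by apply: sV; apply: sM; apply: sB.
have hs : fder j (a + b) = 0 by rewrite fderD ha hb addr0.
have hm : fder j (a * b) = 0 by apply: sM.
by rewrite fderM hi mulr0 addr0 fderD fderB (fderM _ (a + b)) (fderM _ (a * b)) hs hm !mul0r !add0r.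
Qed.

End AlgebraicIndependence.

Lemma div_eq0 (F : fieldType) (x y : F) : y != 0 -> x / y = 0 -> x = 0.
Proof. by move=> yn /eqP; rewrite mulf_eq0 invr_eq0 (negPf yn) orbF => /eqP. Qed.

Lemma subr_neq0C (F : fieldType) (x y : F) : x - y != 0 -> y - x != 0.
Proof. by rewrite -opprB oppr_eq0. Qed.

Lemma oppr_eq0P (F : fieldType) (x : F) : - x = 0 -> x = 0.
Proof. by move/eqP; rewrite oppr_eq0 => /eqP. Qed.

Section AbstractIndependence.
Variables (C : numFieldType) (t e : 'I_4 -> {fraction {mpoly C[9]}}).
Variables (s aa bb cc : {fraction {mpoly C[9]}}).
Notation K := {fraction {mpoly C[9]}}.
Notation i2 := (inord 2 : 'I_3).
Notation j2 := (inord 2 : 'I_4).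
Notation j3 := (inord 3 : 'I_4).
Notation D k := (@fder C 9 (inord k)).
Hypotheses (en : forall l, e l != 0)
  (n01 : t 0 - t 1 != 0) (n02 : t 0 - t j2 != 0) (n12 : t 1 - t j2 != 0).
Hypotheses (Dt : forall k (l : 'I_4), (k < 9)%N -> D k (t l) = (k == 4 + l)%N%:R)
  (De3 : forall k, (k < 9)%N -> D k (e j3) = (k == 8)%N%:R)
  (Daa : forall k, (k < 4)%N -> D k aa = (k == 3)%N%:R).
Hypotheses
  (De0 : forall k, (k < 4)%N -> D k (e 0) =
    (- D k cc + (t 1 + t j2) * D k bb - t 1 * t j2 * D k aa) / ((t 0 - t 1) * (t 0 - t j2)))
  (De1 : forall k, (k < 4)%N -> D k (e 1) =
    (- D k cc + (t 0 + t j2) * D k bb - t 0 * t j2 * D k aa) / ((t 1 - t 0) * (t 1 - t j2)))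
  (De2 : forall k, (k < 4)%N -> D k (e j2) =
    (- D k cc + (t 0 + t 1) * D k bb - t 0 * t 1 * D k aa) / ((t j2 - t 0) * (t j2 - t 1))).
Hypothesis detn : let a j := D (nat_of_ord (j : 'I_3)) bb in
  let b j := D (nat_of_ord (j : 'I_3)) cc in let c j := D (nat_of_ord (j : 'I_3)) s in
  a 0 * (b 1 * c i2 - b i2 * c 1) - a 1 * (b 0 * c i2 - b i2 * c 0)
    + a i2 * (b 0 * c 1 - b 1 * c 0) != 0.

Lemma mul_neg_div (F : fieldType) (x d z : F) : - x / z * d = x * (- d / z).
Proof. by ring. Qed.

Lemma lagrange_sign (F : fieldType) (a b c da db dc i : F) :
  (- dc - (a + b) * - db + a * b * - da) / i = (- dc + (a + b) * db - a * b * da) / i.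
Proof. by rewrite !mulrN opprK. Qed.

Lemma regroup (F : fieldType) (l0 l1 l2 t0 t1 t2 a b c i0 i1 i2' x : F) :
  l0 * ((- c + (t1 + t2) * b - t1 * t2 * a) / i0) + l1 * ((- c + (t0 + t2) * b - t0 * t2 * a) / i1)
  + l2 * ((- c + (t0 + t1) * b - t0 * t1 * a) / i2') + x =
  (l0 / i0 * (t1 + t2) + l1 / i1 * (t0 + t2) + l2 / i2' * (t0 + t1)) * b
  + (- (l0 / i0 + l1 / i1 + l2 / i2')) * c + x
  - (l0 / i0 * (t1 * t2) + l1 / i1 * (t0 * t2) + l2 / i2' * (t0 * t1)) * a.
Proof. by ring. Qed.

(** Block elimination in a relation between the gradients. In the w-directions only B, C and sigma
    vary, and the 3 x 3 determinant kills their coefficients; the A-direction adds the third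
    Vandermonde equation, so the multipliers of e_0, e_1, e_2 vanish. The directions t_l and e_3
    then isolate the rest. *)
Lemma abstract_independent (P : {mpoly C[9]}) :
  mmap (@fconst C 9) (sol_map t e s) P = 0 -> P = 0.
Proof.
apply: jacobian_criterion => kap H.
pose kt (l : 'I_4) := kap (inord (2 * l)); pose kd (l : 'I_4) := kap (inord (2 * l + 1)).
pose ks := kap (inord 8); pose lam l := - kd l / e l ^+ 2.
have sum4 (f : 'I_4 -> K) : \sum_(l < 4) f l = f 0 + f 1 + f j2 + f j3.
  rewrite !big_ord_recl big_ord0 addr0 !addrA.
  by congr (f _ + f _ + f _ + f _); apply: val_inj; rewrite /= ?inordK.
have HE j : \sum_(l < 4) kt l * fder j (t l) + (lam 0 * fder j (e 0) + lam 1 * fder j (e 1)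
    + lam j2 * fder j (e j2) + lam j3 * fder j (e j3)) + ks * fder j s = 0.
  rewrite -(sum4 (fun l => lam l * fder j (e l))) -big_split -[RHS](H j) sol_map_sum.
  congr (_ + _); apply: eq_bigr => l _; congr (_ + _).
  rewrite /lam /kd (fderV j (en l)).
  exact: (mul_neg_div (kap _) (fder j (e l)) (e l ^+ 2)).
have Tz k : (k < 4)%N -> \sum_(l < 4) kt l * D k (t l) = 0.
  move=> hk; rewrite big1 // => l _; rewrite Dt ?(leq_trans hk) //.
  by rewrite ltn_eqF ?mulr0 // (leq_trans hk) // leq_addr.
pose i0 := (t 0 - t 1) * (t 0 - t j2); pose i1 := (t 1 - t 0) * (t 1 - t j2).
pose i2' := (t j2 - t 0) * (t j2 - t 1).
pose n0 := lam 0 / i0; pose n1 := lam 1 / i1; pose n2 := lam j2 / i2'.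
have main k : (k < 4)%N ->
  (n0 * (t 1 + t j2) + n1 * (t 0 + t j2) + n2 * (t 0 + t 1)) * D k bb + (- (n0 + n1 + n2)) * D k cc
  + ks * D k s - (n0 * (t 1 * t j2) + n1 * (t 0 * t j2) + n2 * (t 0 * t 1)) * D k aa = 0.
  move=> hk; have := HE (inord k); rewrite Tz // De0 // De1 // De2 // De3 ?(leq_trans hk) //.
  rewrite (_ : (k == 8) = false) ?mulr0 ?addr0 ?add0r; last first.
    by apply/negbTE; rewrite neq_ltn (leq_trans hk).
  by rewrite regroup.
have [b0 c0 s0] : [/\ n0 * (t 1 + t j2) + n1 * (t 0 + t j2) + n2 * (t 0 + t 1) = 0,
    - (n0 + n1 + n2) = 0 & ks = 0].
  apply: (cramer3 detn) => j.
  have hj : (j < 4)%N by apply: (leq_trans (ltn_ord j)).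
  by have := main j hj; rewrite Daa // ltn_eqF // mulr0 subr0.
have a0 : n0 * (t 1 * t j2) + n1 * (t 0 * t j2) + n2 * (t 0 * t 1) = 0.
  have := main 3%N erefl; rewrite b0 c0 s0 !mul0r !add0r Daa // eqxx mulr1 => /eqP.
  by rewrite oppr_eq0 => /eqP.
have c0' : n0 + n1 + n2 = 0 := oppr_eq0P c0.
have [z0 z1 z2] := vandermonde_kernel n01 n02 n12 c0' b0 a0.
have inv := @div_eq0 K; have n10 := subr_neq0C n01.
have n20 := subr_neq0C n02; have n21 := subr_neq0C n12.
have l0 : lam 0 = 0 := inv _ _ (mulf_neq0 n01 n02) z0.
have l1 : lam 1 = 0 := inv _ _ (mulf_neq0 n10 n12) z1.
have l2 : lam j2 = 0 := inv _ _ (mulf_neq0 n20 n21) z2.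
have rest k : (k < 9)%N -> \sum_(l < 4) kt l * (k == 4 + l)%N%:R + lam j3 * (k == 8)%N%:R = 0.
  move=> hk; have := HE (inord k); rewrite l0 l1 l2 s0 !mul0r !add0r addr0 De3 // => E.
  by rewrite -[RHS]E; congr (_ + _); apply: eq_bigr => l _; rewrite Dt.
have l3 : lam j3 = 0.
  have := rest 8%N erefl; rewrite eqxx mulr1 big1 ?add0r // => l _.
  by rewrite gtn_eqF ?mulr0 // (leq_ltn_trans (n := 7)) // -[7%N]/(4 + 3)%N leq_add2l -ltnS.
have ktz l : kt l = 0.
  have hl : (4 + l < 9)%N by rewrite (leq_ltn_trans (n := 7)) // -[7%N]/(4 + 3)%N leq_add2l -ltnS.
  have := rest _ hl; rewrite l3 mul0r addr0 (bigD1 l) //= eqxx mulr1 big1 ?addr0 // => i il.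
  by rewrite eqn_add2l eq_sym val_eqE (negPf il) mulr0.
have kdz l : kd l = 0.
  have : lam l = 0.
    have : [\/ l = 0, l = 1, l = j2 | l = j3].
      by case: l => [[|[|[|[|]]]]] //= hi; [apply: Or41|apply: Or42|apply: Or43|apply: Or44];
        apply: val_inj; rewrite /= ?inordK.
    by case=> ->.
  by move/(inv _ _ (expf_neq0 2 (en l))); apply: oppr_eq0P.
move=> i; have [i8|i8] := ltnP i 8; last first.
  rewrite (_ : i = inord 8) //; apply: val_inj; rewrite /= inordK //.
  by apply/eqP; rewrite eqn_leq i8 -ltnS ltn_ord.
have hh : (i./2 < 4)%N by rewrite ltn_half_double.
have ei : nat_of_ord i = (odd i + 2 * i./2)%N by rewrite mul2n odd_double_half.
have [o|o] := boolP (odd i).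
- have ei' : nat_of_ord i = (2 * i./2 + 1)%N by rewrite {1}ei o addnC.
  by have := kdz (Ordinal hh); rewrite /kd /= -ei' inord_val.
- have ei' : nat_of_ord i = (2 * i./2)%N by rewrite {1}ei (negPf o).
  by have := ktz (Ordinal hh); rewrite /kt /= -ei' inord_val.
Qed.

End AbstractIndependence.

Section ConcreteIndependence.
Variable C : numFieldType.
Notation K := {fraction {mpoly C[9]}}.
Notation i2 := (inord 2 : 'I_3).
Notation X k := (@fvar C 9 (inord k)).
Notation T := (sol_t (X 4) (X 5) (X 6) (X 7)).
Notation E := (sol_e (X 0) (X 1) (X 2) (X 3) (X 4) (X 5) (X 6) (X 7) (X 8)).
Notation BB := (sol_B (X 0) (X 1) (X 2)).
Notation CC := (sol_C (X 0) (X 1) (X 2) (X 3)).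
Notation R0 := (sol_R0 (X 3) (X 8)).
Notation R1 := (sol_R1 (X 0) (X 1) (X 2) (X 7) (X 8)).
Notation R2 := (sol_R2 (X 0) (X 1) (X 2) (X 3) (X 7) (X 8)).

Lemma fder_R k : (k < 4)%N -> [/\ fder (inord k) R0 = - fder (inord k) (X 3),
  fder (inord k) R1 = - fder (inord k) BB & fder (inord k) R2 = - fder (inord k) CC].
Proof.
move=> hk; have hk9 : (k < 9)%N by rewrite (leq_trans hk).
have d7 : fder (inord k) (X 7) = 0 by rewrite fderX_nat // ltn_eqF // (leq_trans hk).
have d8 : fder (inord k) (X 8) = 0 by rewrite fderX_nat // ltn_eqF // (leq_trans hk).
have [_ _ sM _] := fder_kernel_subfield C (inord k).
have nat0 m : fder (inord k : 'I_9) (m%:R : K) = 0 by rewrite fderMn fder1 mul0rn.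
rewrite /sol_R0 /sol_R1 /sol_R2; move: BB CC => bb cc.
split; rewrite !fderB ?nat0 ?fder1 ?d8 ?subr0 ?sub0r //.
- by rewrite (sM _ _ d7 d8) subr0.
- by rewrite expr2 (sM _ _ (sM _ _ d7 d7) d8) subr0.
Qed.

Lemma sol_independent (s : K) (sv : C) (sd : 'I_3 -> C) : jet s sv sd ->
  (let a := d3 (- 1) (- 1) (- 1 / 4) in let b := d3 (- 5) (- 7) (1 / 2) in
   a 0 * (b 1 * sd i2 - b i2 * sd 1) - a 1 * (b 0 * sd i2 - b i2 * sd 0)
    + a i2 * (b 0 * sd 1 - b 1 * sd 0) != 0 :> C) ->
  forall P : {mpoly C[9]}, mmap (@fconst C 9) (sol_map T E s) P = 0 -> P = 0.
Proof.
move=> [_ js] /= dn; have [[_ jB] [_ jC]] := jet_BC C.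
have [En [n45 n46 n56]] := sol_generic_neq0 C.
have [T0 T1 T2] : [/\ T 0 = X 4, T 1 = X 5 & T (inord 2) = X 6].
  by rewrite /sol_t /= !inordK.
have dT k : (k < 4)%N -> [/\ fder (inord k) (X 4) = 0, fder (inord k) (X 5) = 0 &
    fder (inord k) (X 6) = 0].
  move=> hk; have hk9 : (k < 9)%N by rewrite (leq_trans hk).
  by rewrite !fderX_nat //; split; rewrite ltn_eqF // (leq_trans hk).
pose D k := @fder C 9 (inord k).
have Dt k (l : 'I_4) : (k < 9)%N -> D k (T l) = (k == 4 + l)%N%:R.
  by move=> hk; rewrite /D /sol_t; case: l => [[|[|[|[|]]]]] //= _; rewrite fderX_nat.
have De3 k : (k < 9)%N -> D k (E (inord 3)) = (k == 8)%N%:R.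
  by move=> hk; rewrite /D /sol_e /= inordK //= fderX_nat.
have Daa k : (k < 4)%N -> D k (X 3) = (k == 3)%N%:R.
  by move=> hk; rewrite /D fderX_nat // (leq_trans hk).
have De0 k : (k < 4)%N -> D k (E 0) = (- D k CC + (T 1 + T (inord 2)) * D k BB
    - T 1 * T (inord 2) * D k (X 3)) / ((T 0 - T 1) * (T 0 - T (inord 2))).
  move=> hk; have [z4 z5 z6] := dT k hk; have [r0 r1 r2] := fder_R hk.
  rewrite T0 T1 T2 /D [E 0]/sol_e /= /sol_e0 fder_lagrange // r0 r1 r2; exact: lagrange_sign.
have De1 k : (k < 4)%N -> D k (E 1) = (- D k CC + (T 0 + T (inord 2)) * D k BB
    - T 0 * T (inord 2) * D k (X 3)) / ((T 1 - T 0) * (T 1 - T (inord 2))).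
  move=> hk; have [z4 z5 z6] := dT k hk; have [r0 r1 r2] := fder_R hk.
  rewrite T0 T1 T2 /D [E 1]/sol_e /= /sol_e1 fder_lagrange // r0 r1 r2; exact: lagrange_sign.
have De2 k : (k < 4)%N -> D k (E (inord 2)) = (- D k CC + (T 0 + T 1) * D k BB
    - T 0 * T 1 * D k (X 3)) / ((T (inord 2) - T 0) * (T (inord 2) - T 1)).
  move=> hk; have [z4 z5 z6] := dT k hk; have [r0 r1 r2] := fder_R hk.
  rewrite T0 T1 T2 /D [E (inord 2)]/sol_e /= inordK //= /sol_e2 fder_lagrange // r0 r1 r2.
  exact: lagrange_sign.
have F (x y z : 'I_3 -> K) (x' y' z' : 'I_3 -> C) :
    (forall j, frac_val (x j) (sol_th0 C) (x' j)) -> (forall j, frac_val (y j) (sol_th0 C) (y' j)) ->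
    (forall j, frac_val (z j) (sol_th0 C) (z' j)) ->
    frac_val (x 0 * (y 1 * z i2 - y i2 * z 1) - x 1 * (y 0 * z i2 - y i2 * z 0)
      + x i2 * (y 0 * z 1 - y 1 * z 0)) (sol_th0 C)
     (x' 0 * (y' 1 * z' i2 - y' i2 * z' 1) - x' 1 * (y' 0 * z' i2 - y' i2 * z' 0)
      + x' i2 * (y' 0 * z' 1 - y' 1 * z' 0)).
  move=> hx hy hz.
  by apply: fvD; [apply: fvB|]; apply: fvM => //; apply: fvB; apply: fvM.
have dn' := fv_neq0 (F _ _ _ _ _ _ jB jC js) dn.
rewrite -T0 -T1 -T2 in n45 n46 n56.
exact: (@abstract_independent _ T E s (X 3) BB CC En n45 n46 n56 Dt De3 Daa De0 De1 De2 dn').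
Qed.

End ConcreteIndependence.

Lemma poly_neq0_point (C : numFieldType) (q : {poly C}) : q != 0 -> exists s, q.[s] != 0.
Proof.
move=> qn; apply: contrapT => H.
pose r := [seq (k%:R : C) | k <- iota 0 (size q)].
have ur : uniq r by rewrite map_inj_uniq ?iota_uniq // => k l /eqP; rewrite eqr_nat => /eqP.
have := max_poly_roots qn _ ur; rewrite size_map size_iota ltnn => H'.
suff : false by []; apply: H'; apply/allP => y _; rewrite rootE; apply: contraT => h.
by case: H; exists y.
Qed.

(** * A solution of the five relations that violates h *)

Section NotConsequence.
Variable C : numClosedFieldType.
Notation K := {fraction {mpoly C[9]}}.
Notation i2 := (inord 2 : 'I_3).
Notation X k := (@fvar C 9 (inord k)).
Notation U := (sol_u (X 0) (X 1) (X 2) (X 3)).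
Notation V := (sol_v (X 0) (X 1) (X 2)).
Notation T := (sol_t (X 4) (X 5) (X 6) (X 7)).
Notation E := (sol_e (X 0) (X 1) (X 2) (X 3) (X 4) (X 5) (X 6) (X 7) (X 8)).
Variable S6 : {mpoly C[6]}.
Notation s := (mmap (@fconst C 9) (pt6 U V) S6).
Hypothesis indep : forall P : {mpoly C[9]}, mmap (@fconst C 9) (sol_map T E s) P = 0 -> P = 0.

Section SolValues.
Variables (th : 'I_9 -> C) (x0 x1 x2 xA x4 x5 x6 x7 x8 : K) (v0 v1 v2 vA v4 v5 v6 v7 v8 : C).
Hypotheses (f0 : frac_val x0 th v0) (f1 : frac_val x1 th v1) (f2 : frac_val x2 th v2)
  (fA : frac_val xA th vA) (f4 : frac_val x4 th v4) (f5 : frac_val x5 th v5)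
  (f6 : frac_val x6 th v6) (f7 : frac_val x7 th v7) (f8 : frac_val x8 th v8).
Hypotheses (n0 : v0 != 0) (n1 : v1 != 0) (n2 : v2 != 0).
Hypotheses (p0 : sol_p v0 v1 v2 vA v0 != 0) (p1 : sol_p v0 v1 v2 vA v1 != 0)
  (p2 : sol_p v0 v1 v2 vA v2 != 0).
Hypotheses (d45 : v4 - v5 != 0) (d46 : v4 - v6 != 0) (d56 : v5 - v6 != 0).

Lemma fv_sol_p x v : frac_val x th v -> frac_val (sol_p x0 x1 x2 xA x) th (sol_p v0 v1 v2 vA v).
Proof. by move=> fx; rewrite /sol_p; fvt. Qed.

Lemma fv_sol_u j : frac_val (sol_u x0 x1 x2 xA j) th (sol_u v0 v1 v2 vA j).
Proof.
have g0 := fv_sol_p f0; have g1 := fv_sol_p f1; have g2 := fv_sol_p f2.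
rewrite /sol_u /sol_u0 /sol_u1 /sol_u2.
move: (sol_p x0 _ _ _ x0) (sol_p x0 _ _ _ x1) (sol_p x0 _ _ _ x2) g0 g1 g2 => *.
by case: (val j) => [|[|k]]; fvt.
Qed.

Lemma fv_sol_v j : frac_val (sol_v x0 x1 x2 j) th (sol_v v0 v1 v2 j).
Proof. by rewrite /sol_v; case: (val j) => [|[|k]]. Qed.

Lemma fv_sol_t i : frac_val (sol_t x4 x5 x6 x7 i) th (sol_t v4 v5 v6 v7 i).
Proof. by rewrite /sol_t; case: (val i) => [|[|[|k]]]. Qed.

Lemma fv_sol_e i : frac_val (sol_e x0 x1 x2 xA x4 x5 x6 x7 x8 i) th
  (sol_e v0 v1 v2 vA v4 v5 v6 v7 v8 i).
Proof.
have u0 := fv_sol_u 0; have u1 := fv_sol_u 1; have u2 := fv_sol_u i2.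
rewrite /sol_u /= inordK //= in u0 u1 u2.
have fB : frac_val (sol_B x0 x1 x2) th (sol_B v0 v1 v2) by rewrite /sol_B; fvt.
have fC : frac_val (sol_C x0 x1 x2 xA) th (sol_C v0 v1 v2 vA).
  by rewrite /sol_C; move: (sol_u0 x0 _ _ _) (sol_u1 x0 _ _ _) (sol_u2 x0 _ _ _) u0 u1 u2 => *; fvt.
have r0 : frac_val (sol_R0 xA x8) th (sol_R0 vA v8) by rewrite /sol_R0; fvt.
have r1 : frac_val (sol_R1 x0 x1 x2 x7 x8) th (sol_R1 v0 v1 v2 v7 v8).
  by rewrite /sol_R1; move: (sol_B x0 _ _) fB => *; fvt.
have r2 : frac_val (sol_R2 x0 x1 x2 xA x7 x8) th (sol_R2 v0 v1 v2 vA v7 v8).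
  by rewrite /sol_R2; move: (sol_C x0 _ _ _) fC => *; fvt.
have d54 := subr_neq0C d45; have d64 := subr_neq0C d46; have d65 := subr_neq0C d56.
rewrite /sol_e /sol_e0 /sol_e1 /sol_e2.
move: (sol_R0 xA _) (sol_R1 x0 _ _ _ _) (sol_R2 x0 _ _ _ _ _) r0 r1 r2 => *.
by case: (val i) => [|[|[|k]]]; fvt; rewrite mulf_neq0.
Qed.

End SolValues.

Lemma fv_sol_map (th : 'I_9 -> C) (t e : 'I_4 -> K) (r : K) (t' e' : 'I_4 -> C) (r' : C) :
  (forall i, frac_val (t i) th (t' i)) -> (forall i, frac_val (e i) th (e' i)) ->
  (forall i, e' i != 0) -> frac_val r th r' ->
  forall i, frac_val (sol_map t e r i) th (sol_map t' e' r' i).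
Proof.
move=> ft fe en fr i; rewrite /sol_map; case: ifP => // _.
by rewrite /pt8; case: (odd _); [apply: fvV | apply: ft].
Qed.

Lemma split_sum7 (f : 'I_7 -> C) :
  \sum_i f i = \sum_(l < 4) f (lshift 3 l) + \sum_(j < 3) f (rshift 4 j).
Proof. exact: (@big_split_ord _ _ _ 4 3). Qed.

Lemma sol_relations (w0 w1 w2 A t0 t1 t2 t3 e3 : C) :
  let u := sol_u w0 w1 w2 A in let v := sol_v w0 w1 w2 in
  let t := sol_t t0 t1 t2 t3 in let e := sol_e w0 w1 w2 A t0 t1 t2 t3 e3 in
  w0 != 0 -> w1 != 0 -> w2 != 0 -> w0 - w1 != 0 -> w0 - w2 != 0 -> w1 - w2 != 0 ->
  sol_p w0 w1 w2 A w0 != 0 -> sol_p w0 w1 w2 A w1 != 0 -> sol_p w0 w1 w2 A w2 != 0 ->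
  t0 - t1 != 0 -> t0 - t2 != 0 -> t1 - t2 != 0 -> (forall l, e l != 0) ->
  exists UU VV : 'I_7 -> C, [/\ forall i, UU i * VV i != 0,
    [/\ \sum_(i < 7) (UU i * VV i)^-1 = 1,
        \sum_(i < 7) (UU i + VV i) / (UU i * VV i) = 4,
        \sum_(i < 7) (UU i + VV i) ^+ 2 / (UU i * VV i) = 16,
        \sum_(j < 3) (UU (rshift 4 j))^-1 = 1 &
        \sum_(j < 3) VV (rshift 4 j) / UU (rshift 4 j) = 1],
    (forall l : 'I_4, UU (lshift 3 l) + VV (lshift 3 l) = t l),
    (forall l : 'I_4, UU (lshift 3 l) * VV (lshift 3 l) = (e l)^-1) &
    (forall j : 'I_3, UU (rshift 4 j) = u j /\ VV (rshift 4 j) = v j)].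
Proof.
move=> u v t e wn0 wn1 wn2 d01 d02 d12 p0 p1 p2 f01 f02 f12 en.
(* For i <= 4 the pair (u_i, v_i) must have sum t_i and product 1/e_i; the square root of the
   discriminant exists because the field is algebraically closed. *)
pose r l := sqrtC (t l ^+ 2 - 4 * (e l)^-1).
pose UU (i : 'I_7) := match fintype.split (i : 'I_(4 + 3)) with
  | inl l => (t l + r l) / 2 | inr j => u j end.
pose VV (i : 'I_7) := match fintype.split (i : 'I_(4 + 3)) with
  | inl l => (t l - r l) / 2 | inr j => v j end.
have UL (l : 'I_4) : UU (lshift 3 l) = (t l + r l) / 2.
  by rewrite /UU (unsplitK (@inl 'I_4 'I_3 l)).
have VL (l : 'I_4) : VV (lshift 3 l) = (t l - r l) / 2.
  by rewrite /VV (unsplitK (@inl 'I_4 'I_3 l)).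
have UR (j : 'I_3) : UU (rshift 4 j) = u j by rewrite /UU (unsplitK (@inr 'I_4 'I_3 j)).
have VR (j : 'I_3) : VV (rshift 4 j) = v j by rewrite /VV (unsplitK (@inr 'I_4 'I_3 j)).
have n2 : (2%:R : C) != 0 by rewrite pnatr_eq0.
have ts (l : 'I_4) : UU (lshift 3 l) + VV (lshift 3 l) = t l by rewrite UL VL; field.
have es (l : 'I_4) : UU (lshift 3 l) * VV (lshift 3 l) = (e l)^-1.
  rewrite UL VL; transitivity ((t l ^+ 2 - r l ^+ 2) / 4); first by field.
  by rewrite /r sqrtCK; move: (e l) (en l) => x xn; field.
have [ev0 ev1 ev2] : [/\ v 0 = w0, v 1 = w1 & v i2 = w2] by rewrite /v /sol_v /= inordK.
have [eu0 eu1 eu2] : [/\ u 0 = sol_u0 w0 w1 w2 A, u 1 = sol_u1 w0 w1 w2 A & u i2 = sol_u2 w0 w1 w2 A].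
  by rewrite /u /sol_u /= inordK.
have un : [/\ u 0 != 0, u 1 != 0 & u i2 != 0].
  by rewrite eu0 eu1 eu2; split; rewrite !mulf_neq0 ?invr_eq0 ?(subr_neq0C d01) ?(subr_neq0C d02)
    ?(subr_neq0C d12).
have [un0 un1 un2] := un.
have [L1 L2 L3] := sol_line A wn0 wn1 wn2 d01 d02 d12.
have [G0 G1 G2] := sol_lagrange w0 w1 w2 A t3 e3 f01 f02 f12.
have sum4 (f : 'I_4 -> C) : \sum_(l < 4) f l = f 0 + f 1 + f (inord 2) + f (inord 3).
  rewrite !big_ord_recl big_ord0 addr0 !addrA.
  by congr (f _ + f _ + f _ + f _); apply: val_inj; rewrite /= ?inordK.
have [te0 te1 te2 te3] : [/\ t 0 = t0, t 1 = t1, t (inord 2) = t2 & t (inord 3) = t3].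
  by rewrite /t /sol_t /= !inordK.
have [ee0 ee1 ee2 ee3] : [/\ e 0 = sol_e0 w0 w1 w2 A t0 t1 t2 t3 e3,
   e 1 = sol_e1 w0 w1 w2 A t0 t1 t2 t3 e3, e (inord 2) = sol_e2 w0 w1 w2 A t0 t1 t2 t3 e3 &
   e (inord 3) = e3] by rewrite /e /sol_e /= !inordK.
rewrite -eu0 -eu1 -eu2 in L1 L2 L3; rewrite -ee0 -ee1 -ee2 in G0 G1 G2.
have S0 : \sum_(l < 4) e l = 1 - A by rewrite sum4 G0 ee3 /sol_R0; ring.
have S1 : \sum_(l < 4) t l * e l = 3 - (w0^-1 + w1^-1 + w2^-1).
  by rewrite sum4 te0 te1 te2 te3 G1 ee3 /sol_R1 /sol_B; move: (w0^-1) (w1^-1) (w2^-1) => *; ring.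
have S2 : \sum_(l < 4) t l ^+ 2 * e l = 9 - (u 0 / w0 + u 1 / w1 + u i2 / w2).
  rewrite sum4 te0 te1 te2 te3 G2 ee3 /sol_R2 /sol_C -eu0 -eu1 -eu2.
  by move: (u 0 / w0) (u 1 / w1) (u i2 / w2) => *; ring.
exists UU, VV; split=> //.
- move=> i; rewrite -(splitK (i : 'I_(4 + 3))).
  case: (fintype.split (i : 'I_(4 + 3))) => [l|j] /=; first by rewrite es invr_eq0.
  by rewrite UR VR; case: (ord3P j) => [|[|]] ->; rewrite ?ev0 ?ev1 ?ev2 mulf_neq0.
- split.
  + rewrite split_sum7; under eq_bigr => l _ do rewrite es invrK.
    under [Y in _ + Y]eq_bigr => j _ do rewrite UR VR.
    by rewrite S0 sum_ord3 ev0 ev1 ev2 L3 subrK.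
  + rewrite split_sum7; under eq_bigr => l _ do rewrite ts es invrK.
    under [Y in _ + Y]eq_bigr => j _ do rewrite UR VR.
    rewrite S1 sum_ord3 ev0 ev1 ev2.
    transitivity (3 + ((u 0)^-1 + (u 1)^-1 + (u i2)^-1)); last by rewrite L1; ring.
    move: (u 0) (u 1) (u i2) un0 un1 un2 => x y z xn yn zn.
    by field; rewrite ?xn ?yn ?zn ?wn0 ?wn1 ?wn2.
  + rewrite split_sum7; under eq_bigr => l _ do rewrite ts es invrK.
    under [Y in _ + Y]eq_bigr => j _ do rewrite UR VR.
    rewrite S2 sum_ord3 ev0 ev1 ev2.
    (* 15 is the 9 of [sol_R2] plus the three cross terms 2 of (u + v)^2 / (u v). *)
    transitivity (15 + (w0 / u 0 + w1 / u 1 + w2 / u i2)); last by rewrite L2; ring.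
    move: (u 0) (u 1) (u i2) un0 un1 un2 => x y z xn yn zn.
    by field; rewrite ?xn ?yn ?zn ?wn0 ?wn1 ?wn2.
  + by under eq_bigr => j _ do rewrite UR; rewrite sum_ord3.
  + by under eq_bigr => j _ do rewrite UR VR; rewrite sum_ord3 ev0 ev1 ev2.
Qed.

(** With a ninth variable in place of sigma, a monic h becomes a nonzero rational function of nine
    variables. By independence it remains defined and nonzero on the generic solution of the five
    relations, hence at some particular solution. *)
Lemma sol_not_consequence (h : {poly {fraction {mpoly C[8]}}}) :
  h \is monic -> not_consequence h (tofrac S6).
Proof.
move=> hm; set n := size h.
have /fin_all_exists[P HP] (k : 'I_n) : exists PQ : {mpoly C[8]} * {mpoly C[8]},
    PQ.2 != 0 /\ h`_k = tofrac PQ.1 / tofrac PQ.2.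
  by have [a [b [bn E]]] := fraction_num_den h`_k; exists (a, b).
have fvh (k : 'I_n) (x : 'I_8 -> C) : (P k).2.@[x] != 0 ->
    frac_val h`_k x ((P k).1.@[x] / (P k).2.@[x]).
  by move=> hx; exists (P k).1, (P k).2; have [_ E] := HP k.
pose w8 (i : 'I_8) : 'I_9 := widen_ord (leqnSn 8) i.
pose up (q : {mpoly C[8]}) : {mpoly C[9]} := q \mPo [tuple 'X_(w8 i) | i < 8].
have upE q x : (up q).@[x] = q.@[x \o w8].
  by rewrite /up comp_mpoly_meval; apply: meval_eq => i; rewrite tnth_mktuple mevalXU.
pose H9 : {fraction {mpoly C[9]}} :=
  \sum_(k < n) tofrac (up (P k).1) / tofrac (up (P k).2) * fvar C ord_max ^+ k.
have fvH x : (forall k, (P k).2.@[x \o w8] != 0) ->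
    frac_val H9 x (\sum_(k < n) (P k).1.@[x \o w8] / (P k).2.@[x \o w8] * x ord_max ^+ k).
  move=> hx; apply: fv_sum => k; apply: fvM; last exact/fv_exp/fvX.
  by exists (up (P k).1), (up (P k).2); rewrite !upE.
pose Q8 := \prod_(k < n) (P k).2.
have Q8n : Q8 != 0 by apply/prodf_neq0 => k _; have [] := HP k.
have Q8P x : Q8.@[x] != 0 -> forall k, (P k).2.@[x] != 0.
  by rewrite /Q8 rmorph_prod /= => /prodf_neq0 hx k; apply: hx.
have n_gt0 : (0 < n)%N by rewrite lt0n size_poly_eq0 monic_neq0.
have H9n : H9 != 0.
  have [x0 /Q8P hx0] := mpoly_neq0_point Q8n.
  pose cc k := if insub k is Some i then (P i).1.@[x0] / (P i).2.@[x0] else 0.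
  have ccE (k : 'I_n) : cc k = (P k).1.@[x0] / (P k).2.@[x0] by rewrite /cc valK.
  pose q := \poly_(k < n) cc k.
  have qn : q != 0.
    have hn : (n.-1 < n)%N by rewrite prednK.
    apply/eqP => /(congr1 (fun r : {poly C} => r`_n.-1)); rewrite coef_poly hn coef0.
    have := fvh (Ordinal hn) x0 (hx0 _); rewrite -ccE /=.
    rewrite (_ : h`_n.-1 = 1); last by apply/eqP; rewrite -[_ == _]/(h \is monic).
    by move=> /fv_uniq -/(_ _ (fv1 x0)) -> /eqP; rewrite oner_eq0.
  have [r hr] := poly_neq0_point qn.
  pose x : 'I_9 -> C := fun i => if (i < 8)%N then x0 (inord i) else r.
  have xw : x \o w8 =1 x0 by move=> i; rewrite /x /= ltn_ord inord_val.
  have xm : x ord_max = r by [].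
  have hx k : (P k).2.@[x \o w8] != 0 by rewrite (meval_eq _ xw).
  apply: (fv_neq0 (fvH x hx)); move: hr; rewrite horner_poly.
  congr (_ != _); apply: eq_bigr => k _.
  by rewrite ccE xm !(meval_eq _ xw).
have [nu [de [den E9]]] := fraction_num_den H9.
have nun : nu != 0 by apply: contra_neq H9n => nu0; rewrite E9 nu0 tofrac0 mul0r.
(* [nu] controls the value of h at sigma, [de] and [Q8] its denominators and those of its
   coefficients. *)
pose R := nu * de * up Q8.
have upQ : up Q8 != 0.
  have [x0 hx0] := mpoly_neq0_point Q8n.
  pose x : 'I_9 -> C := fun i => if (i < 8)%N then x0 (inord i) else 0.
  apply: (@meval_neq0 _ _ x); rewrite upE (meval_eq (v2 := x0)) // => i.
  by rewrite /x /= ltn_ord inord_val.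
have Rn : R != 0 by rewrite !mulf_neq0.
have gRn : mmap (@fconst C 9) (sol_map T E s) R != 0.
  by apply: contra_neq Rn => /indep.
have [jw0 jw1 jw2 _] := jet_w C.
have [En [n45 n46 n56]] := sol_generic_neq0 C.
have X0n := fv_neq0 jw0.1 (oner_neq0 C).
have X1n : X 1 != 0 by apply: (fv_neq0 jw1.1); rewrite oppr_eq0 oner_neq0.
have X2n : X 2 != 0 by apply: (fv_neq0 jw2.1); rewrite pnatr_eq0.
have d01 : X 0 - X 1 != 0.
  by apply: (fv_neq0 (fvB jw0.1 jw1.1)); apply: (@natS_neq0 _ _ 1); ring.
have d02 : X 0 - X 2 != 0.
  by apply: (fv_neq0 (fvB jw0.1 jw2.1)); apply: (@negS_neq0 _ _ 0); ring.
have d12 : X 1 - X 2 != 0.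
  by apply: (fv_neq0 (fvB jw1.1 jw2.1)); apply: (@negS_neq0 _ _ 2); ring.
have [jp0 jp1 jp2] := jet_p C.
have p0n : sol_p (X 0) (X 1) (X 2) (X 3) (X 0) != 0.
  by apply: (fv_neq0 jp0.1); rewrite oppr_eq0 oner_neq0.
have p1n := fv_neq0 jp1.1 (oner_neq0 C); have p2n := fv_neq0 jp2.1 (oner_neq0 C).
(* All that must not vanish at the chosen solution; the entries are referred to below by their
   position. *)
pose L := [:: mmap (@fconst C 9) (sol_map T E s) R; X 0; X 1; X 2; X 0 - X 1; X 0 - X 2;
  X 1 - X 2; sol_p (X 0) (X 1) (X 2) (X 3) (X 0); sol_p (X 0) (X 1) (X 2) (X 3) (X 1);
  sol_p (X 0) (X 1) (X 2) (X 3) (X 2); X 4 - X 5; X 4 - X 6; X 5 - X 6;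
  E 0; E 1; E (inord 2); E (inord 3)].
have Ln : all (fun x => x != 0) L.
  apply/andP; split; first exact: gRn.
  apply/andP; split; first exact: X0n.
  apply/andP; split; first exact: X1n.
  apply/andP; split; first exact: X2n.
  apply/andP; split; first exact: d01.
  apply/andP; split; first exact: d02.
  apply/andP; split; first exact: d12.
  apply/andP; split; first exact: p0n.
  apply/andP; split; first exact: p1n.
  apply/andP; split; first exact: p2n.
  apply/andP; split; first exact: n45.
  apply/andP; split; first exact: n46.
  apply/andP; split; first exact: n56.
  apply/andP; split; first exact: (En 0).
  apply/andP; split; first exact: (En 1).
  apply/andP; split; first exact: (En (inord 2)).
  apply/andP; split; first exact: (En (inord 3)).
  by [].
have [th Hth] := generic_point (allP Ln).
have nz i v : (i < size L)%N -> frac_val (nth 0 L i) th v -> v != 0.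
  by move=> hi hv; have [v' vn hv'] := Hth _ (mem_nth 0 hi); rewrite (fv_uniq hv hv').
pose y k := th (inord k).
have f k : frac_val (X k) th (y k) by exact: fvX.
have m0 := nz 1%N _ isT (f 0%N); have m1 := nz 2%N _ isT (f 1%N); have m2 := nz 3%N _ isT (f 2%N).
have m01 := nz 4%N _ isT (fvB (f 0%N) (f 1%N)); have m02 := nz 5%N _ isT (fvB (f 0%N) (f 2%N)).
have m12 := nz 6%N _ isT (fvB (f 1%N) (f 2%N)).
have q0 := nz 7%N _ isT (fv_sol_p (f 0%N) (f 1%N) (f 2%N) (f 3%N) (f 0%N)).
have q1 := nz 8%N _ isT (fv_sol_p (f 0%N) (f 1%N) (f 2%N) (f 3%N) (f 1%N)).
have q2 := nz 9%N _ isT (fv_sol_p (f 0%N) (f 1%N) (f 2%N) (f 3%N) (f 2%N)).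
have m45 := nz 10%N _ isT (fvB (f 4%N) (f 5%N)); have m46 := nz 11%N _ isT (fvB (f 4%N) (f 6%N)).
have m56 := nz 12%N _ isT (fvB (f 5%N) (f 6%N)).
have fu := fv_sol_u (f 0%N) (f 1%N) (f 2%N) (f 3%N) q0 q1 q2.
have fv := fv_sol_v (f 0%N) (f 1%N) (f 2%N).
have ft := fv_sol_t (f 4%N) (f 5%N) (f 6%N) (f 7%N).
have fe := fv_sol_e (f 0%N) (f 1%N) (f 2%N) (f 3%N) (f 4%N) (f 5%N) (f 6%N) (f 7%N) (f 8%N)
  m0 m1 m2 q0 q1 q2 m45 m46 m56.
set e' := sol_e (y 0%N) _ _ _ _ _ _ _ _ in fe.
set t' := sol_t (y 4%N) _ _ _ in ft.
have en l : e' l != 0.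
  have : [\/ l = 0, l = 1, l = inord 2 | l = inord 3].
    by case: l => [[|[|[|[|]]]]] //= hi; [apply: Or41|apply: Or42|apply: Or43|apply: Or44];
      apply: val_inj; rewrite /= ?inordK.
  case=> ->.
  - exact: (nz 13%N _ isT (fe 0)).
  - exact: (nz 14%N _ isT (fe 1)).
  - exact: (nz 15%N _ isT (fe (inord 2))).
  - exact: (nz 16%N _ isT (fe (inord 3))).
set u' := sol_u (y 0%N) _ _ _ in fu; set v' := sol_v (y 0%N) _ _ in fv.
have f6 i : frac_val (pt6 U V i) th (pt6 u' v' i) by rewrite /pt6; case: (odd i).
pose s' := S6.@[pt6 u' v'].
have fs : frac_val s th s' := fv_mmap S6 f6.
have fg := fv_sol_map ft fe en fs.
have Rg : R.@[sol_map t' e' s'] != 0 := nz 0%N _ isT (fv_mmap R fg).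
move: Rg; rewrite /R !mevalM !mulf_eq0 !negb_or => /andP[/andP[Rnu Rde] RQ].
have gw : sol_map t' e' s' \o w8 =1 pt8 t' (fun l => (e' l)^-1).
  by move=> i; rewrite /sol_map /= ltn_ord inord_val.
rewrite upE (meval_eq _ gw) in RQ; have PQ := Q8P _ RQ.
have [UU [VV [UVn rels tE eE uvE]]] :=
  sol_relations m0 m1 m2 m01 m02 m12 q0 q1 q2 m45 m46 m56 en.
exists UU, VV; split=> //; split=> //.
have -> : (fun i : 'I_4 => UU (lshift 3 i) + VV (lshift 3 i)) = t' by apply: funext.
have -> : (fun i : 'I_4 => UU (lshift 3 i) * VV (lshift 3 i)) = (fun l => (e' l)^-1) by apply: funext.
have -> : (fun j : 'I_3 => UU (rshift 4 j)) = u' by apply: funext => j; have [] := uvE j.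
have -> : (fun j : 'I_3 => VV (rshift 4 j)) = v' by apply: funext => j; have [] := uvE j.
set p8 := pt8 t' _ in gw RQ PQ *.
pose c k := if insub k is Some i then (P i).1.@[p8] / (P i).2.@[p8] else 0.
have cE (k : 'I_n) : c k = (P k).1.@[p8] / (P k).2.@[p8] by rewrite /c valK.
exists c, s'; split.
- by move=> k hk; have := fvh (Ordinal hk) p8 (PQ _); rewrite -cE.
- by exists S6, 1; rewrite meval1 tofrac1 !divr1 oner_neq0.
- have hx k : (P k).2.@[sol_map t' e' s' \o w8] != 0 by rewrite (meval_eq _ gw).
  have := fvH _ hx; rewrite E9 => H.
  have H' : frac_val (tofrac nu / tofrac de) (sol_map t' e' s')
    (nu.@[sol_map t' e' s'] / de.@[sol_map t' e' s']) by exists nu, de.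
  have := fv_uniq H H'; rewrite (_ : sol_map t' e' s' ord_max = s') // => E1.
  rewrite (_ : \sum_(k < _) _ = nu.@[sol_map t' e' s'] / de.@[sol_map t' e' s']).
    by rewrite mulf_neq0 ?invr_eq0.
  by rewrite -E1; apply: eq_bigr => k _; rewrite cE !(meval_eq _ gw).
Qed.

End NotConsequence.

(** * The theorem *)

Lemma annihilator_exists (C : numFieldType) (sigma : {fraction {mpoly C[6]}}) : S3inv sigma ->
  exists h : {poly {fraction {mpoly C[8]}}},
    [/\ h \is monic, (size h <= 5)%N & annihilates h sigma].
Proof.
move=> inv; have [h [hm hs H]] := generic_annihilator inv; exists h; split=> //.
move=> F a p u v HE Huv c s.
have [th [kap [gd [-> -> -> ->]]]] := E4_normal_form HE Huv.
exact: (H _ _ gd).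
Qed.

Section SymmetricExamples.
Variable C : numFieldType.

Lemma pair_act_uvX (s : 'S_3) (j : 'I_3) :
  pair_act s (uX C j) = uX C (s j) /\ pair_act s (vX C j) = vX C (s j).
Proof.
have [h0 h1] : (2 * j < 6)%N /\ (2 * j + 1 < 6)%N by case: j => [[|[|[|]]]].
have [o0 o1] : odd (2 * j) = false /\ odd (2 * j + 1) by rewrite addn1 /= mul2n odd_double.
have [k0 k1] : ((2 * j)./2 = j /\ (2 * j + 1)./2 = j)%N.
  by rewrite addn1 /= uphalfE mul2n -uphalfE uphalf_double doubleK.
rewrite /pair_act /uX /vX /comp_mpoly !mmapX !mmap1U !tnth_mktuple !inordK //.
by rewrite o0 o1 k0 k1 inord_val addn0.
Qed.

Lemma S3inv_tofrac (E : {mpoly C[6]}) : (forall s, pair_act s E = E) -> S3inv (tofrac E).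
Proof.
move=> inv nu de den H s.
have dn : tofrac de != 0 by rewrite tofrac_eq0.
have -> : nu = E * de.
  by apply/eqP; rewrite -tofrac_eq tofracM H divfK.
have -> : pair_act s (E * de) = pair_act s E * pair_act s de by rewrite /pair_act rmorphM.
by rewrite inv mulrAC.
Qed.

Lemma sum3_nat (V : nmodType) (f : nat -> V) : \sum_(j < 3) f j = f 0%N + f 1%N + f 2%N.
Proof. by rewrite sum_ord3 /= inordK. Qed.

Lemma sum_uv_act (s : 'S_3) (f : {mpoly C[6]} -> {mpoly C[6]} -> {mpoly C[6]}) :
  \sum_(j < 3) f (pair_act s (uX C j)) (pair_act s (vX C j)) = \sum_(j < 3) f (uX C j) (vX C j).
Proof.
rewrite [RHS](reindex_inj (@perm_inj _ s)); apply: eq_bigr => j _.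
by have [-> ->] := pair_act_uvX s j.
Qed.

Lemma sym_invariant (s : 'S_3) (E : {mpoly C[6]}) :
  E \in [:: sym10 C; sym30 C; sym01 C; sym11 C] -> pair_act s E = E.
Proof.
pose A : {rmorphism {mpoly C[6]} -> {mpoly C[6]}} := comp_mpoly
  [tuple ('X_(inord (2 * s (inord i./2) + odd i)) : {mpoly C[6]}) | i < 6].
have AE q : pair_act s q = A q by [].
have S1 : sym10 C = \sum_(j < 3) uX C j by rewrite sum3_nat.
have S2 : sym01 C = \sum_(j < 3) vX C j by rewrite sum3_nat.
have S3 : sym30 C = \prod_(j < 3) uX C j.
  by rewrite 3!big_ord_recr big_ord0 /= mul1r.
have S4 : sym11 C = sym10 C * sym01 C - \sum_(j < 3) uX C j * vX C j.
  by rewrite (sum3_nat (fun j => uX C j * vX C j)) /sym11 /sym10 /sym01; ring.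
have I1 : A (sym10 C) = sym10 C.
  by rewrite S1 rmorph_sum; exact: (sum_uv_act s (fun x y => x)).
have I2 : A (sym01 C) = sym01 C.
  by rewrite S2 rmorph_sum; exact: (sum_uv_act s (fun x y => y)).
rewrite AE !inE => /or4P[] /eqP->; [exact: I1 | | exact: I2 |].
- rewrite S3 rmorph_prod [RHS](reindex_inj (@perm_inj _ s)); apply: eq_bigr => j _.
  by have [E1 _] := pair_act_uvX s j; rewrite -E1.
- rewrite S4 rmorphB rmorphM I1 I2 rmorph_sum; congr (_ - _).
  rewrite -(sum_uv_act s (fun x y => x * y)); apply: eq_bigr => j _.
  by rewrite rmorphM.
Qed.

End SymmetricExamples.

Lemma known_relations_insufficient (C : numClosedFieldType) (E : {mpoly C[6]})
    (h : {poly {fraction {mpoly C[8]}}}) :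
  E \in [:: sym10 C; sym30 C; sym01 C; sym11 C] -> h \is monic -> not_consequence h (tofrac E).
Proof.
have [j1 j2 j3 j4] := jet_sym C.
rewrite !inE => /or4P[] /eqP->; apply: sol_not_consequence.
(* The Jacobian determinants at the test point are - 9, - 48, 3/2 and - 27/2 in the four cases. *)
- apply: (sol_independent j1); rewrite /d3 /= inordK //=.
  by apply: (@negS_neq0 _ _ 8); field; rewrite ?pnatr_eq0.
- apply: (sol_independent j2); rewrite /d3 /= inordK //=.
  by apply: (@negS_neq0 _ _ 47); field; rewrite ?pnatr_eq0.
- apply: (sol_independent j3); rewrite /d3 /= inordK //=.
  rewrite (_ : _ + _ = 3 / 2); last by field; rewrite ?pnatr_eq0.
  by rewrite mulf_neq0 ?invr_eq0 ?pnatr_eq0.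
- apply: (sol_independent j4); rewrite /d3 /= inordK //=.
  rewrite (_ : _ + _ = - (27 / 2)); last by field; rewrite ?pnatr_eq0.
  by rewrite oppr_eq0 mulf_neq0 ?invr_eq0 ?pnatr_eq0.
Qed.

Unset Implicit Arguments.

(* C is modelled as R[i] for an arbitrary R : realType (all are isomorphic to the reals). *)
Theorem theorem1 (R : realType) :
  (forall sigma : {fraction {mpoly R[i][6]}}, S3inv sigma ->
     exists h : {poly {fraction {mpoly R[i][8]}}},
       [/\ h \is monic, (size h <= 5)%N & annihilates h sigma]) /\
  (forall sigma, sigma \in [:: e10 (R[i]); e30 (R[i]); e01 (R[i]); e11 (R[i])] ->
     exists h : {poly {fraction {mpoly R[i][8]}}},
       [/\ h \is monic, (size h <= 5)%N, annihilates h sigma & not_consequence h sigma]).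
Proof.
split=> [sigma|sigma Hs]; first exact: annihilator_exists.
have [E EE ->] : exists2 E : {mpoly R[i][6]},
    E \in [:: sym10 R[i]; sym30 R[i]; sym01 R[i]; sym11 R[i]] & sigma = tofrac E.
  move: Hs; rewrite !inE => /or4P[] /eqP->.
  - by exists (sym10 R[i]); rewrite ?inE ?eqxx.
  - by exists (sym30 R[i]); rewrite ?inE ?eqxx ?orbT.
  - by exists (sym01 R[i]); rewrite ?inE ?eqxx ?orbT.
  - by exists (sym11 R[i]); rewrite ?inE ?eqxx ?orbT.
have inv : S3inv (tofrac E) by apply: S3inv_tofrac => s; apply: sym_invariant.
have [h [hm hs ha]] := annihilator_exists inv.
by exists h; split=> //; apply: known_relations_insufficient.
Qed.
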